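(* Let $\Omega\subset\mathbb{C}\simeq\mathbb{R}^2$ be a simply connected domain with base point $z_0\in\Omega$, and let $\alpha\in C^\infty(\Omega,T^\star\mathbb{R}^2\otimes\mathfrak{g})$ be a smooth $\mathfrak{g}$-valued 1-form, decomposed as $\alpha=\alpha_{-1}+\alpha_0+\alpha_1+\alpha_2$ with $\alpha_k$ the $\mathfrak{g}_k^{\mathbb{C}}$-component of $\alpha$, and $\alpha_k=\alpha_k'+\alpha_k''$ with $\alpha_k'=\alpha_k(\partial/\partial z)\,dz$, $\alpha_k''=\alpha_k(\partial/\partial\bar z)\,d\bar z$. Then: 1. $\alpha$ is the Maurer–Cartan form of a lifted conformal Lagrangian immersion (LCLI) if and only if $d\alpha+\alpha\wedge\alpha=0$, $\alpha_{-1}''=\alpha_1'=0$, and $\alpha_{-1}'\neq0$, $\alpha_1''\neq 0$ at every point of $\Omega$. 2. Furthermore, if $\alpha$ is the Maurer–Cartan form of an LCLI, then the corresponding immersion is Hamiltonian stationary if and only if the extended Maurer–Cartan form $$\alpha_\lambda=\lambda^{-2}\alpha_2'+\lambda^{-1}\alpha_{-1}'+\alpha_0+\lambda\alpha_1''+\lambda^2\alpha_2''$$ satisfies $d\alpha_\lambda+\alpha_\lambda\wedge\alpha_\lambda=0$ for all $\lambda\in\mathbb{C}^\star=\mathbb{C}\setminus\{0\}$.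
   Context: $\mathbb{R}^4$ has its standard inner product $\langle\cdot,\cdot\rangle$, standard basis $\epsilon_1,\dots,\epsilon_4$ and symplectic form $\omega=dx^1\wedge dx^2+dx^3\wedge dx^4$. Identify $\mathbb{R}^4$ with the quaternions by $(x^1,x^2,x^3,x^4)\mapsto x^1+ix^2+jx^3+kx^4$. $L_p$ denotes the $4\times4$ matrix of left multiplication $x\mapsto px$ and $R_p$ that of right multiplication $x\mapsto xp$. So $L_i$ is the complex structure with $\omega(x,y)=\langle L_ix,y\rangle$. Groups: $\mathcal{G}_0=\{q^1\mathbf 1-q^2R_i-q^3R_j-q^4R_k:\ q\in\mathbb{R}^4,|q|=1\}\simeq SU(2)$; $\mathcal{G}_2=\{p^1\mathbf 1+p^2L_i:\ (p^1)^2+(p^2)^2=1\}\simeq U(1)$; $\vec{\mathcal{G}}=\mathcal{G}_0\mathcal{G}_2=\{G\in SO(4):GL_i=L_iG\}\simeq U(2)$; $\mathcal{G}=\vec{\mathcal{G}}\ltimes\mathbb{R}^4$ with $(G,T)(G',T')=(GG',GT'+T)$, embedded in $5\times5$ matrices by $(G,T)\mapsto\begin{pmatrix}G&T\\0&1\end{pmatrix}$. Its Lie algebra is $\mathfrak{g}=\{(aL_i+b^1R_i+b^2R_j+b^3R_k,t):a,b^1,b^2,b^3\in\mathbb{R},\,t\in\mathbb{R}^4\}$, with $[(\eta,t),(\tilde\eta,\tilde t)]=(\eta\tilde\eta-\tilde\eta\eta,\eta\tilde t-\tilde\eta t)$; $\alpha\wedge\alpha$ is computed with matrix multiplication. Let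 $\epsilon=\frac12(1,0,-i,0)^T$, $\bar\epsilon=\frac12(1,0,i,0)^T$. Then $\mathfrak{g}^{\mathbb{C}}=\mathfrak{g}\otimes\mathbb{C}=\mathfrak{g}_{-1}^{\mathbb{C}}\oplus\mathfrak{g}_0^{\mathbb{C}}\oplus\mathfrak{g}_1^{\mathbb{C}}\oplus\mathfrak{g}_2^{\mathbb{C}}$, where $\mathfrak{g}_{-1}^{\mathbb{C}}=\{0\}\times(\mathbb{C}\epsilon\oplus\mathbb{C}L_i\bar\epsilon)$, $\mathfrak{g}_0^{\mathbb{C}}=\mathrm{span}_{\mathbb{C}}\{(R_i,0),(R_j,0),(R_k,0)\}$, $\mathfrak{g}_1^{\mathbb{C}}=\{0\}\times(\mathbb{C}\bar\epsilon\oplus\mathbb{C}L_i\epsilon)$, $\mathfrak{g}_2^{\mathbb{C}}=\mathbb{C}(L_i,0)$. An LCLI is a smooth map $U=(F,X):\Omega\to\mathcal{G}$ with $U(z_0)=(\mathbf 1,0)$ such that the translation component of $U^{-1}dU$ has the form $F^{-1}dX=e^fK(\epsilon\,dz+\bar\epsilon\,d\bar z)$ with $K\in C^\infty(\Omega,\mathcal{G}_0)$, $f\in C^\infty(\Omega,\mathbb{R})$. Then $X$ is a conformal Lagrangian immersion; this $X$ is the immersion corresponding to $\alpha=U^{-1}dU$. The Maurer–Cartan form of $U$ is $U^{-1}dU$. The (lifted) Lagrangian angle map of $U$ is the smooth $\beta:\Omega\to\mathbb{R}$ with $\beta(z_0)=0$ and $F=e^{\beta L_i/2}M_0$, $M_0\in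 C^\infty(\Omega,\mathcal{G}_0)$. A conformal Lagrangian immersion $X$ is Hamiltonian stationary if it is critical for area under compactly supported Hamiltonian variations; by a known characterization, which may be taken as the definition, this is equivalent to $\Delta\beta=0$ on $\Omega$. *)

(* Defs.v *)
From HB Require Import structures.
From mathcomp Require Import all_boot all_order all_algebra.
From mathcomp Require Import complex.
From mathcomp Require Import all_classical all_reals all_analysis.
Set Implicit Arguments.
Unset Strict Implicit.
Unset Printing Implicit Defensive.
Import Order.TTheory GRing.Theory Num.Theory.
Import numFieldNormedType.Exports.
Local Open Scope classical_set_scope.
Local Open Scope complex_scope.
Local Open Scope ring_scope.

(* Objects living on the open set Omega are total functions on the plane
   R * R, of which only the values on Omega are ever constrained or used. *)

Section Plane.
Context {R : realType}.
Implicit Types (Omega : set (R * R)) (V : normedModType R).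

Definition dirx : R * R := (1, 0).
Definition diry : R * R := (0, 1).

Definition null_homotopic Omega (p : R * R) (gam : R -> R * R) : Prop :=
  exists H : R * R -> R * R,
    [/\ {within `[0, 1]%classic `*` `[0, 1]%classic, continuous H},
        (forall s t, 0 <= s <= 1 -> 0 <= t <= 1 -> Omega (H (s, t))),
        (forall t, 0 <= t <= 1 -> H (0, t) = gam t /\ H (1, t) = p) &
        (forall s, 0 <= s <= 1 -> H (s, 0) = p /\ H (s, 1) = p)].

Definition simply_connected Omega : Prop :=
  connected Omega /\
  forall (p : R * R) (gam : R -> R * R),
    {within `[0, 1]%classic, continuous gam} ->
    (forall t, 0 <= t <= 1 -> Omega (gam t)) -> gam 0 = p -> gam 1 = p ->
    null_homotopic Omega p gam.

Fixpoint Ck Omega V (k : nat) (f : R * R -> V) : Prop :=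
  (forall z, Omega z -> {for z, continuous f}) /\
  if k is k'.+1 then
    [/\ forall z, Omega z -> derivable f z dirx /\ derivable f z diry,
        Ck Omega k' (fun z => 'D_dirx f z) & Ck Omega k' (fun z => 'D_diry f z)]
  else True.

Definition smooth Omega V (f : R * R -> V) : Prop := forall k, Ck Omega k f.

Definition laplacian (f : R * R -> R) (z : R * R) : R :=
  'D_dirx (fun w => 'D_dirx f w) z + 'D_diry (fun w => 'D_diry f w) z.

Definition expmx (n : nat) (A : 'M[R]_n.+1) : 'M[R]_n.+1 :=
  \matrix_(i, j) limn (series (fun k : nat => (A ^+ k) i j / k`!%:R)).

End Plane.

Section Quaternions.
Variable K : comNzRingType.

Definition qmul (p x : 'cV[K]_4) : 'cV[K]_4 :=
  let p1 := p (inord 0) 0 in let p2 := p (inord 1) 0 in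
  let p3 := p (inord 2) 0 in let p4 := p (inord 3) 0 in
  let x1 := x (inord 0) 0 in let x2 := x (inord 1) 0 in
  let x3 := x (inord 2) 0 in let x4 := x (inord 3) 0 in
  \col_r nth 0 [:: p1 * x1 - p2 * x2 - p3 * x3 - p4 * x4;
                   p1 * x2 + p2 * x1 + p3 * x4 - p4 * x3;
                   p1 * x3 - p2 * x4 + p3 * x1 + p4 * x2;
                   p1 * x4 + p2 * x3 - p3 * x2 + p4 * x1] r.

Definition qi : 'cV[K]_4 := delta_mx (inord 1) 0.
Definition qj : 'cV[K]_4 := delta_mx (inord 2) 0.
Definition qk : 'cV[K]_4 := delta_mx (inord 3) 0.

Definition Lq (p : 'cV[K]_4) : 'M[K]_4 :=
  \matrix_(r, c) qmul p (delta_mx c 0) r 0.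
Definition Rq (p : 'cV[K]_4) : 'M[K]_4 :=
  \matrix_(r, c) qmul (delta_mx c 0) p r 0.

Definition emb_alg (eta : 'M[K]_4) (t : 'cV[K]_4) : 'M[K]_(4 + 1) :=
  block_mx eta t 0 0.

Definition emb_grp (G : 'M[K]_4) (T : 'cV[K]_4) : 'M[K]_(4 + 1) :=
  block_mx G T 0 1.

End Quaternions.

Arguments qi {K}.
Arguments qj {K}.
Arguments qk {K}.

Section Groups.
Context {R : realType}.

Definition G0 (M : 'M[R]_4) : Prop :=
  exists q1 q2 q3 q4 : R,
    q1 ^+ 2 + q2 ^+ 2 + q3 ^+ 2 + q4 ^+ 2 = 1 /\
    M = q1 *: 1 - q2 *: Rq qi - q3 *: Rq qj - q4 *: Rq qk.

Definition G2 (M : 'M[R]_4) : Prop :=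
  exists p1 p2 : R, p1 ^+ 2 + p2 ^+ 2 = 1 /\ M = p1 *: 1 + p2 *: Lq qi.

Definition Gvec (M : 'M[R]_4) : Prop :=
  exists A B : 'M[R]_4, [/\ G0 A, G2 B & M = A *m B].

Definition in_g (A : 'M[R]_(4 + 1)) : Prop :=
  exists (a b1 b2 b3 : R) (t : 'cV[R]_4),
    A = emb_alg (a *: Lq qi + b1 *: Rq qi + b2 *: Rq qj + b3 *: Rq qk) t.

End Groups.

Section Grading.
Context {R : realType}.
Let C := R[i].

Definition cplx (m n : nat) (A : 'M[R]_(m, n)) : 'M[C]_(m, n) :=
  map_mx (real_complex R) A.

Definition eps : 'cV[C]_4 :=
  2^-1 *: (delta_mx (inord 0) 0 - 'i *: delta_mx (inord 2) 0).
Definition epsbar : 'cV[C]_4 :=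
  2^-1 *: (delta_mx (inord 0) 0 + 'i *: delta_mx (inord 2) 0).

(* The grading is indexed by the integers modulo 4, so that the index -1 is the
   class of 3. *)
Definition gC (k : 'Z_4) : {vspace 'M[C]_(4 + 1)} :=
  match val k with
  | 0 => <<[:: emb_alg (Rq qi) 0; emb_alg (Rq qj) 0; emb_alg (Rq qk) 0]>>%VS
  | 1 => <<[:: emb_alg 0 epsbar; emb_alg 0 (Lq qi *m eps)]>>%VS
  | 2 => <<[:: emb_alg (Lq qi) 0]>>%VS
  | _ => <<[:: emb_alg 0 eps; emb_alg 0 (Lq qi *m epsbar)]>>%VS
  end.

(* The component in gC k of an element of the direct sum of the gC l. *)
Definition gcomp (k : 'Z_4) : 'M[C]_(4 + 1) -> 'M[C]_(4 + 1) :=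
  sumv_pi (\sum_(l : 'Z_4) gC l)%VS k.

End Grading.

(* A covector on the plane with values in T is the pair of its values on
   d/dx and d/dy; a T-valued 1-form is a function R * R -> T * T. *)
Section Forms.
Context {R : realType}.
Let C := R[i].

Definition cov_cplx (m n : nat) (a : 'M[R]_(m, n) * 'M[R]_(m, n)) :
  'M[C]_(m, n) * 'M[C]_(m, n) := (cplx a.1, cplx a.2).

Definition dz (T : lmodType C) (v : T) : T * T := (v, 'i *: v).
Definition dzbar (T : lmodType C) (v : T) : T * T := (v, - 'i *: v).

Definition on_dz (T : lmodType C) (a : T * T) : T :=
  2^-1 *: (a.1 - 'i *: a.2).
Definition on_dzbar (T : lmodType C) (a : T * T) : T :=
  2^-1 *: (a.1 + 'i *: a.2).

Definition part10 (T : lmodType C) (a : T * T) : T * T := dz (on_dz a).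
Definition part01 (T : lmodType C) (a : T * T) : T * T := dzbar (on_dzbar a).

Definition cov_comp (k : 'Z_4) (a : 'M[R]_(4 + 1) * 'M[R]_(4 + 1)) :
  'M[C]_(4 + 1) * 'M[C]_(4 + 1) :=
  (gcomp k (cov_cplx a).1, gcomp k (cov_cplx a).2).

(* The value on (d/dx, d/dy) of a wedge b, for the matrix product. *)
Definition wedge (K : pzRingType) (n : nat) (a b : 'M[K]_n * 'M[K]_n) :
  'M[K]_n := a.1 *m b.2 - a.2 *m b.1.

(* The value on (d/dx, d/dy) of the exterior derivative of a. *)
Definition ext_d (n : nat) (a : R * R -> 'M[R]_n * 'M[R]_n) (z : R * R) :
  'M[R]_n := 'D_dirx (fun w => (a w).2) z - 'D_diry (fun w => (a w).1) z.

Definition flat (Omega : set (R * R)) (n : nat)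
  (a : R * R -> 'M[R]_n * 'M[R]_n) : Prop :=
  forall z, Omega z -> ext_d a z + wedge (a z) (a z) = 0.

Definition ext_dC (n : nat) (a : R * R -> 'M[C]_n * 'M[C]_n) (z : R * R) :
  'M[C]_n :=
  let re w := (map_mx (@complex.Re R) (a w).1, map_mx (@complex.Re R) (a w).2) in
  let im w := (map_mx (@complex.Im R) (a w).1, map_mx (@complex.Im R) (a w).2) in
  cplx (ext_d re z) + 'i *: cplx (ext_d im z).

Definition flatC (Omega : set (R * R)) (n : nat)
  (a : R * R -> 'M[C]_n * 'M[C]_n) : Prop :=
  forall z, Omega z -> ext_dC a z + wedge (a z) (a z) = 0.

Definition extended_form (alpha : R * R -> 'M[R]_(4 + 1) * 'M[R]_(4 + 1))
  (lambda : C) (z : R * R) : 'M[C]_(4 + 1) * 'M[C]_(4 + 1) :=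
  lambda ^- 2 *: part10 (cov_comp 2 (alpha z))
  + lambda^-1 *: part10 (cov_comp (-1) (alpha z))
  + cov_comp 0 (alpha z)
  + lambda *: part01 (cov_comp 1 (alpha z))
  + lambda ^+ 2 *: part01 (cov_comp 2 (alpha z)).

End Forms.

(* U stands for the pair (F, X) of its rotation and translation components. *)
Section LCLI.
Context {R : realType}.
Implicit Types (Omega : set (R * R))
  (U : R * R -> 'M[R]_4 * 'cV[R]_4).

Definition MC_form U (z : R * R) : 'M[R]_(4 + 1) * 'M[R]_(4 + 1) :=
  let Uhat w := emb_grp (U w).1 (U w).2 in
  (invmx (Uhat z) *m 'D_dirx Uhat z, invmx (Uhat z) *m 'D_diry Uhat z).

Definition FinvdX U (z : R * R) : 'cV[R]_4 * 'cV[R]_4 :=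
  let X w := (U w).2 in
  (invmx (U z).1 *m 'D_dirx X z, invmx (U z).1 *m 'D_diry X z).

Definition LCLI Omega (z0 : R * R) U : Prop :=
  [/\ smooth Omega U, (forall z, Omega z -> Gvec (U z).1), U z0 = (1, 0) &
      exists (K : R * R -> 'M[R]_4) (f : R * R -> R),
        [/\ smooth Omega K, (forall z, Omega z -> G0 (K z)), smooth Omega f &
            forall z, Omega z ->
              cov_cplx (FinvdX U z) =
              (expR (f z))%:C *: (dz (cplx (K z) *m eps)
                                  + dzbar (cplx (K z) *m epsbar))]].

Definition is_MC_form_of Omega
  (alpha : R * R -> 'M[R]_(4 + 1) * 'M[R]_(4 + 1)) U : Prop :=
  forall z, Omega z -> alpha z = MC_form U z.

Definition lagrangian_angle Omega (z0 : R * R) U (beta : R * R -> R) : Prop :=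
  [/\ smooth Omega beta, beta z0 = 0 &
      exists M0 : R * R -> 'M[R]_4,
        [/\ smooth Omega M0, (forall z, Omega z -> G0 (M0 z)) &
            forall z, Omega z ->
              (U z).1 = expmx ((beta z / 2) *: Lq qi) *m M0 z]].

(* Hamiltonian stationarity of the immersion (U z).2, through its
   characterization by harmonicity of the Lagrangian angle map.  That map is
   unique on a connected Omega and exists on a simply connected one. *)
Definition hamiltonian_stationary Omega (z0 : R * R) U : Prop :=
  exists beta : R * R -> R,
    lagrangian_angle Omega z0 U beta /\
    forall z, Omega z -> laplacian beta z = 0.

End LCLI.

(* Main.v *)
Require Import Defs.
From HB Require Import structures.
From mathcomp Require Import all_boot all_order all_algebra.
From mathcomp Require Import complex.
From mathcomp Require Import all_classical all_reals all_analysis.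
From mathcomp Require Import ring lra.
Import Order.TTheory GRing.Theory Num.Theory.
Import numFieldNormedType.Exports.
Local Open Scope classical_set_scope.
Local Open Scope complex_scope.
Local Open Scope ring_scope.
Set Implicit Arguments.
Unset Strict Implicit.
Unset Printing Implicit Defensive.

(** Write the form as alpha = (a L_i + R_b, t), with a real covector a, a covector
    b of imaginary quaternions and a covector t of vectors of R^4.

    Types.  L_j commutes with all right multiplications, and on complex vectors
    its eigenspaces for the eigenvalues i and -i are the components of degrees -1
    and 1.  Hence the two vanishing conditions on the types both say that
    t(d/dy) = L_j t(d/dx), so that t is determined by u = t(d/dx), and the two
    nonvanishing conditions both say that u is not 0 ([type_cond],
    [immersion_cond] and their converses).  A frame with F^-1 dX = t then
    satisfies the equation of a lifted conformal Lagrangian immersion with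
    e^f = |u| and K the right multiplication by u / |u| ([frame_equation]).

    Integration.  A Maurer-Cartan form is flat because second derivatives are
    symmetric ([total_sol_flat]).  Conversely a flat form has local primitives
    dP = P alpha, found by solving linear ordinary differential equations along
    one horizontal and all vertical lines of a small square ([square_sol]); on a
    simply connected domain they are continued along paths ([monodromy],
    [frobenius]).  That the primitive takes its values in the group follows from
    uniqueness ([angle_exists]): the degree 2 part of alpha is closed, so a is the
    differential of a function beta / 2, and after multiplication by
    exp (- beta L_i / 2) the rotation part solves a system whose coefficients are
    right multiplications by imaginary quaternions; it is orthogonal and commutes
    with L_i and L_j, hence is the right multiplication by a unit quaternion.  The
    function beta is the Lagrangian angle, and d beta = 2 a holds for every
    Lagrangian angle ([angle_derivative]).

    The spectral parameter.  For lambda = e^(i theta) the extended form is alpha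
    with t turned by the angle theta in the plane of t(d/dx) and L_j t(d/dx), and
    with the covector a turned by the angle 2 theta.  Since L_j commutes with R_b
    and anticommutes with L_i, the curvature still vanishes in degrees -1, 0 and 1
    after such a turn, while in degree 2 the turn replaces da by cos (2 theta) da
    plus sin (2 theta) times the divergence of a ([flat_rotated]).  These are
    polynomial identities, valid for complex theta.  As da = 0 and the Laplacian
    of beta is twice the divergence of a, the curvature of the extended form is
    sin (2 theta) / 2 times that Laplacian ([extended_curvature]): it vanishes for
    all lambda as soon as beta is harmonic, and conversely one lambda with
    sin (2 theta) different from 0 forces beta to be harmonic. *)

(** * Locally constant properties and the monodromy principle *)

(** Relatively to [A] both the set where [P] holds and the set where it fails are
    traces of open sets, so that connectedness leaves no room for both. *)
Lemma connected_locally_const (T : topologicalType) (A : set T) (P : T -> Prop) :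
  connected A ->
  (forall x, A x -> exists2 V, nbhs x V &
     forall y z, V y -> V z -> A y -> A z -> P y -> P z) ->
  forall x y, A x -> A y -> P x -> P y.
Proof.
move=> cA lcP.
have key Q : (forall x, A x -> exists2 V, nbhs x V &
    forall y z, V y -> V z -> A y -> A z -> Q y -> Q z) ->
    A `&` Q = A `&` (~` A `|` Q)°.
  move=> lcQ; apply/seteqP; split=> [x [Ax Qx]|x [Ax /interior_subset[]//]].
  split=> //; have [V xV HV] := lcQ x Ax.
  apply: filterS (xV) => z Vz.
  have [Az|nAz] := pselect (A z); [right|by left].
  by apply: (HV x) => //; exact: nbhs_singleton.
move=> x y Ax Ay Px.
suff : A `&` P = A by move=> E; have [] : (A `&` P) y by rewrite E.
apply: cA.
- by exists x.
- by exists (~` A `|` P)°; [exact: open_interior|exact: key].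
- exists (~` (~` A `|` ~` P)°); first exact/open_closedC/open_interior.
  have E : A `&` ~` P = A `&` (~` A `|` ~` P)°.
    apply: key => z /lcP[V zV HV]; exists V => // u v Vu Vv Au Av nPu Pv.
    exact/nPu/(HV v).
  apply/seteqP; split=> z [Az].
    by move=> Pz; split=> // Iz; have [_] : (A `&` ~` P) z by rewrite E.
  move=> nIz; split=> //; apply: contrapT => nPz; apply: nIz.
  by have [] : (A `&` (~` A `|` ~` P)°) z by rewrite -E.
Qed.

Section Monodromy.
Context {R : realType} {T : Type}.
Variables (Omega : set (R * R)) (sol : (R * R -> T) -> R * R -> Prop).

(** The axioms of the sheaf of solutions of a completely integrable system:
    on arbitrarily small squares a solution is determined by its value at any
    point, and on some square around each point every value at every point is
    attained. *)
Definition local_system : Prop :=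
  forall c, Omega c -> exists2 r : R, 0 < r &
    [/\ ball c r `<=` Omega,
        forall z g, ball c r z ->
          exists2 P, (forall w, ball c r w -> sol P w) & P z = g &
        forall r' P Q z w, 0 < r' -> r' <= r ->
          (forall w, ball c r' w -> sol P w) ->
          (forall w, ball c r' w -> sol Q w) ->
          ball c r' z -> ball c r' w -> P z = Q z -> P w = Q w].

Definition I01 : set R := `[0, 1]%classic.

(** The value [g] follows, near the time [t], the values along [gam] of one
    solution: analytic continuation along a path. *)
Definition lift_at (gam : R -> R * R) (g : R -> T) (t : R) : Prop :=
  exists2 P, (\forall w \near gam t, sol P w) &
    \forall u \near t, I01 u -> g u = P (gam u).

Definition path_in (gam : R -> R * R) : Prop :=
  {within I01, continuous gam} /\ forall t, I01 t -> Omega (gam t).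

Lemma path_near gam t V : path_in gam -> I01 t -> nbhs (gam t) V ->
  \forall u \near t, I01 u -> V (gam u).
Proof. by move=> [/subspace_continuousP + _] It => /(_ t It); apply. Qed.

Hypothesis ls : local_system.

Lemma sol_eq_near P Q z : Omega z -> (\forall w \near z, sol P w) ->
  (\forall w \near z, sol Q w) ->
  exists2 V, nbhs z V & forall u v, V u -> V v -> P u = Q u -> P v = Q v.
Proof.
move=> Oz sP sQ; have [r r0 [_ _ uniq]] := ls Oz.
have /nbhs_ballP[e /= e0 eB] : nbhs z [set w | sol P w /\ sol Q w].
  by apply: filterS2 sP sQ.
pose r' := Num.min r e.
have r'0 : 0 < r' by rewrite lt_min r0.
exists (ball z r'); first exact: nbhsx_ballx.
have sub w : ball z r' w -> sol P w /\ sol Q w.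
  by move=> bw; apply: eB; apply: le_ball bw; rewrite ge_min lexx orbT.
move=> u v Bu Bv; apply: (uniq r' P Q u v) => //.
- by rewrite ge_min lexx.
- by move=> w /sub[].
- by move=> w /sub[].
Qed.

Lemma sol_germ P Q z : Omega z -> (\forall w \near z, sol P w) ->
  (\forall w \near z, sol Q w) -> P z = Q z -> \forall w \near z, P w = Q w.
Proof.
move=> Oz sP sQ PQ; have [V zV HV] := sol_eq_near Oz sP sQ.
by apply: filterS (zV) => w Vw; apply: (HV z) => //; exact: nbhs_singleton.
Qed.

Lemma lift_germ gam g t P : path_in gam -> I01 t -> lift_at gam g t ->
  (\forall w \near gam t, sol P w) -> g t = P (gam t) ->
  \forall u \near t, I01 u -> g u = P (gam u).
Proof.
move=> pg It [Q sQ gQ] sP gP.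
have QP : Q (gam t) = P (gam t) by rewrite -gP (nbhs_singleton gQ).
have := path_near pg It (sol_germ (pg.2 t It) sQ sP QP).
by apply: filterS2 gQ => u gu Qu Iu; rewrite gu// Qu.
Qed.

Lemma lift_unique gam g1 g2 (I : set R) : path_in gam -> connected I ->
  I `<=` I01 -> (forall t, I t -> lift_at gam g1 t) ->
  (forall t, I t -> lift_at gam g2 t) ->
  forall t u, I t -> I u -> g1 t = g2 t -> g1 u = g2 u.
Proof.
move=> pg cI I1 l1 l2; apply: (connected_locally_const cI) => t It.
have [P1 sP1 E1] := l1 t It; have [P2 sP2 E2] := l2 t It.
have [V zV HV] := sol_eq_near (pg.2 t (I1 _ It)) sP1 sP2.
have nV := path_near pg (I1 _ It) zV.
exists [set u | I01 u -> [/\ V (gam u), g1 u = P1 (gam u) & g2 u = P2 (gam u)]].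
  by apply: filterS3 E1 E2 nV => u H1 H2 H3 Iu; rewrite H1// H2//; split=> //; exact: H3.
move=> u v Wu Wv Iu Iv.
have [Vu -> ->] := Wu (I1 _ Iu); have [Vv -> ->] := Wv (I1 _ Iv).
exact: HV.
Qed.

(** Near each of its points a path can be continued by a solution on a square,
    so the set of times up to which a lift exists is open and closed. *)
Lemma lift_exists gam g0 : path_in gam ->
  exists2 g, g 0 = g0 & forall t, I01 t -> lift_at gam g t.
Proof.
move=> pg.
pose E s := exists2 g, g 0 = g0 & forall t, I01 t -> t <= s -> lift_at gam g t.
have I0 : I01 0 by rewrite /I01 /= in_itv /= lexx ler01.
have I1 : I01 1 by rewrite /I01 /= in_itv /= lexx ler01.
suff : E 1.
  move=> [g gE gl]; exists g => // t It; apply: gl => //.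
  by move: It; rewrite /I01 /= in_itv => /andP[].
have cI : connected I01.
  by apply/connected_intervalP; exact: interval_is_interval.
apply: (connected_locally_const cI _ I0 I1); last first.
  have [r r0 [_ ex _]] := ls (pg.2 0 I0).
  have [P sP Pg] := ex (gam 0) g0 (ballxx _ r0).
  exists (P \o gam) => // t It t0.
  have -> : t = 0 by apply/eqP; rewrite eq_le t0; move: It; rewrite /I01 /= in_itv /= => /andP[].
  exists P; last by apply: filterE.
  by apply: filterS (nbhsx_ballx (gam 0) r r0).
move=> t It; have [r r0 [_ ex _]] := ls (pg.2 t It).
have nV := path_near pg It (nbhsx_ballx (gam t) r r0).
have /nbhs_ballP[e /= e0 eB] := nV.
exists (ball t e); first exact: nbhsx_ballx.
move=> u v Bu Bv Iu Iv [g gE gl].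
have [P sP Pu] := ex (gam u) (g u) (eB _ Bu Iu).
exists (fun s => if s <= u then g s else P (gam s)).
  by rewrite ifT //; move: Iu; rewrite /I01 /= in_itv /= => /andP[].
move=> s Is sv.
have [su|us|->] := ltgtP s u.
- have [Q sQ gQ] := gl s Is (ltW su); exists Q => //.
  have := lt_nbhsl su; apply: filterS2 gQ => w gw /= wu Iw.
  by rewrite (ltW wu) gw.
- exists P.
    have Bs : ball t e s.
      move: Bu Bv; rewrite /ball /= !ltr_norml => /andP[Bu1 Bu2] /andP[Bv1 Bv2].
      clear -us sv Bu1 Bu2 Bv1 Bv2; apply/andP; split; lra.
    by apply: filterS sP _; apply: open_nbhs_nbhs; split;
      [exact: ball_open|exact: eB].
  have := lt_nbhsr us; apply: filterS => w /= uw Iw.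
  by rewrite leNgt uw.
- have sPu : \forall w \near gam u, sol P w.
    apply: filterS sP _; apply: open_nbhs_nbhs; split; first exact: ball_open.
    exact: eB.
  exists P => //.
  have := lift_germ pg Iu (gl u Iu (lexx _)) sPu (esym Pu).
  by apply: filterS => w gw Iw; case: ifP => // _; exact: gw.
Qed.
Lemma I01P t : I01 t <-> 0 <= t <= 1.
Proof. by rewrite /I01 /= in_itv. Qed.

Lemma I01_0 : I01 0. Proof. by rewrite I01P lexx ler01. Qed.
Lemma I01_1 : I01 1. Proof. by rewrite I01P lexx ler01. Qed.

Lemma I01_rev t : I01 t -> I01 (1 - t).
Proof. by move=> /I01P ?; apply/I01P; lra. Qed.

Lemma I01_half0 t : I01 t -> I01 (2^-1 * t).
Proof. by move=> /I01P ?; apply/I01P; lra. Qed.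

Lemma I01_half1 t : I01 t -> I01 (2^-1 * t + 2^-1).
Proof. by move=> /I01P ?; apply/I01P; lra. Qed.

Lemma I01_half0P t : I01 t -> 2^-1 * t <= 2^-1 /\ 2^-1 <= 1 - 2^-1 * t.
Proof. by move=> /I01P ?; split; lra. Qed.

Lemma I01_half1P t : I01 t -> 2^-1 <= 2^-1 * t + 2^-1.
Proof. by move=> /I01P ?; lra. Qed.

Lemma I01_connected : connected I01.
Proof. by apply/connected_intervalP; exact: interval_is_interval. Qed.

(** Lifts are carried along by a reparametrization, which serves to restrict a
    lift of a concatenation to its two halves. *)
Lemma lift_comp gam gam' g phi t : I01 t -> continuous phi ->
  (forall u, I01 u -> I01 (phi u)) -> (forall u, I01 u -> gam' u = gam (phi u)) ->
  lift_at gam g (phi t) -> lift_at gam' (g \o phi) t.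
Proof.
move=> It cphi Iphi gamE [P sP gP]; exists P; first by rewrite gamE.
have : \forall u \near t, I01 (phi u) -> g (phi u) = P (gam (phi u)) := cphi t _ gP.
apply: filterS => u gu Iu.
by rewrite /= gu ?gamE//; exact: Iphi.
Qed.

(** In a homotopy with fixed end points, the solution that continues one slice
    up to a given time also continues all nearby slices; hence the final
    value of the lift is locally constant in the slice. *)
Lemma homotopy_lift (H : R * R -> R * R) (G : R -> R -> T) p g0 :
  {within `[0, 1]%classic `*` `[0, 1]%classic, continuous H} ->
  (forall s t, I01 s -> I01 t -> Omega (H (s, t))) ->
  (forall s, I01 s -> H (s, 0) = p /\ H (s, 1) = p) ->
  (forall s, I01 s -> G s 0 = g0) ->
  (forall s t, I01 s -> I01 t -> lift_at (fun t => H (s, t)) (G s) t) ->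
  G 0 1 = G 1 1.
Proof.
move=> /subspace_continuousP cH OH H01 G0 lG.
have Hnear s t V : I01 s -> I01 t -> nbhs (H (s, t)) V ->
    exists2 e : R, 0 < e & forall s' t', ball s e s' -> ball t e t' ->
      I01 s' -> I01 t' -> V (H (s', t')).
  move=> Is It HV.
  have /nbhs_ballP[e /= e0 eB] := cH (s, t) (conj Is It) V HV.
  by exists e => // s' t' Bs Bt Is' It'; apply: (eB (s', t')); split.
have path_slice s : I01 s -> path_in (fun t => H (s, t)).
  move=> Is; split=> [|t It]; last exact: OH.
  apply/subspace_continuousP => t It V HV.
  have [e e0 eV] := Hnear s t V Is It HV.
  apply/nbhs_ballP; exists e => //= t' Bt It'.
  by apply: eV => //; exact: ballxx.
(* [good s t] says that one solution gives the values at time [t] of the lifts of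
   all slices near [s]; it propagates in [t] from 0 to 1. *)
pose good s t := exists2 P, (\forall w \near H (s, t), sol P w) &
  \forall u \near s, I01 u -> G u t = P (H (u, t)).
have step s : I01 s -> good s 1.
  move=> Is; apply: (connected_locally_const I01_connected _ I01_0 I01_1).
    move=> t It; have [r r0 [_ ex _]] := ls (OH s t Is It).
    have [e e0 eB] := Hnear s t _ Is It (nbhsx_ballx (H (s, t)) r r0).
    exists (ball t e); first exact: nbhsx_ballx.
    move=> a b Ba Bb Ia Ib [P1 sP1 GP1].
    have [P sP PE] := ex (H (s, a)) (P1 (H (s, a))) (eB _ _ (ballxx _ e0) Ba Is Ia).
    have sP' c w : ball t e c -> I01 c -> ball s e w -> I01 w ->
        \forall z \near H (w, c), sol P z.
      move=> Bc Ic Bw Iw; apply: filterS sP _; apply: open_nbhs_nbhs.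
      by split; [exact: ball_open|exact: eB].
    exists P; first by apply: sP' => //; exact: ballxx.
    have germ := sol_germ (OH s a Is Ia) (sP' _ _ Ba Ia (ballxx _ e0) Is) sP1 PE.
    have [d d0 dP] := Hnear s a _ Is Ia germ.
    have nd := nbhsx_ballx s d d0.
    have ne := nbhsx_ballx s e e0.
    apply: filterS3 GP1 nd ne => u Gu du eu Iu.
    pose J := I01 `&` ball t e.
    have cJ : connected J.
      apply/connected_intervalP => x y [Ix Bx] [Iy By] z /andP[xz zy]; split.
        move: Ix Iy; rewrite !I01P => /andP[x0 _] /andP[_ y1].
        by rewrite (le_trans x0 xz) (le_trans zy y1).
      move: Bx By; rewrite /ball /= !ltr_norml => /andP[x1 x2] /andP[y1 y2].
      by clear -xz zy x1 x2 y1 y2; apply/andP; split; lra.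
    apply: (lift_unique (path_slice u Iu) cJ (g2 := fun t => P (H (u, t)))
             (@subIsetl _ _ _) _ _ (conj Ia Ba) (conj Ib Bb)).
    - by move=> c [Ic _]; exact: lG.
    - move=> c [Ic Bc]; exists P; first exact: sP'.
      by apply: filterE.
    - by rewrite Gu// dP//; exact: ballxx.
  have [r r0 [_ ex _]] := ls (OH s 0 Is I01_0).
  have [P sP PE] := ex (H (s, 0)) g0 (ballxx _ r0).
  exists P; first by apply: filterS sP _; exact: nbhsx_ballx.
  by apply: filterE => u Iu; rewrite G0// (H01 u Iu).1 -PE (H01 s Is).1.
symmetry; apply: (connected_locally_const (P := fun s => G s 1 = G 0 1)
  I01_connected _ I01_0 I01_1) => // s Is.
have [P _ GP] := step s Is.
exists [set u | I01 u -> G u 1 = P (H (u, 1))] => // a b Ga Gb Ia Ib <-.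
by rewrite Ga// Gb// (H01 a Ia).2 (H01 b Ib).2.
Qed.

(** The lifts of the slices of a null homotopy form a family to which
    [homotopy_lift] applies; the last slice is a constant path, whose lift is
    constant. *)
Lemma loop_lift p gam g : path_in gam -> gam 0 = p -> gam 1 = p ->
  null_homotopic Omega p gam -> (forall t, I01 t -> lift_at gam g t) ->
  g 1 = g 0.
Proof.
move=> pg gam0 gam1 [H [cH OH Hs Ht]] lg.
have Op : Omega p by rewrite -gam0; apply: pg.2; exact: I01_0.
have OH' s t : I01 s -> I01 t -> Omega (H (s, t)) by rewrite !I01P; exact: OH.
have Ht' s : I01 s -> H (s, 0) = p /\ H (s, 1) = p by rewrite I01P; exact: Ht.
have Hs' t : I01 t -> H (0, t) = gam t /\ H (1, t) = p by rewrite I01P; exact: Hs.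
have pslice s : I01 s -> path_in (fun t => H (s, t)).
  move=> Is; split=> [|t It]; last exact: OH'.
  apply/subspace_continuousP => t It V HV.
  move/subspace_continuousP : cH => /(_ (s, t) (conj Is It) V HV).
  move=> /nbhs_ballP[e /= e0 eB]; apply/nbhs_ballP; exists e => //= t' Bt It'.
  by apply: (eB (s, t')); split => //=; exact: ballxx.
pose G s := if pselect (I01 s) is left Is then sval (cid2 (lift_exists (g 0) (pslice s Is)))
            else g.
have GP s : I01 s -> G s 0 = g 0 /\ forall t, I01 t -> lift_at (fun t => H (s, t)) (G s) t.
  by move=> Is; rewrite /G; case: pselect => // Is'; case: cid2.
have E := homotopy_lift cH OH' Ht' (fun s Is => (GP s Is).1) (fun s t Is => (GP s Is).2 t).
have G0 : G 0 1 = g 1.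
  apply: (lift_unique (pslice 0 I01_0) I01_connected (@subset_refl _ _)
    (GP 0 I01_0).2 _ I01_0 I01_1) (GP 0 I01_0).1 => t It.
  apply: (lift_comp (gam := gam) (phi := idfun) It); [|by []| |exact: lg].
    by move=> u; exact: cvg_id.
  by move=> u Iu; rewrite (Hs' u Iu).1.
have G1 : G 1 1 = g 0.
  apply: (lift_unique (pslice 1 I01_1) I01_connected (@subset_refl _ _)
    (GP 1 I01_1).2 _ I01_0 I01_1 (g2 := fun=> g 0)) (GP 1 I01_1).1 => t It.
  have [r r0 [_ ex _]] := ls Op.
  have [P sP PE] := ex p (g 0) (ballxx _ r0).
  exists P.
    by rewrite (Hs' t It).2; apply: filterS sP _; exact: nbhsx_ballx.
  by apply: filterE => u Iu; rewrite (Hs' u Iu).2.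
by rewrite -G0 E.
Qed.

(** The two halves are truncated and added instead of being defined by cases, so
    that continuity is immediate and no gluing is needed. *)
Definition path_cat (gam1 gam2 : R -> R * R) (t : R) : R * R :=
  gam1 (Num.min (2 * t) 1) + (gam2 (Num.max (2 * t - 1) 0) - gam2 0).

Lemma path_cat_l gam1 gam2 t : t <= 2^-1 -> path_cat gam1 gam2 t = gam1 (2 * t).
Proof.
move=> t2; rewrite /path_cat min_l; last lra.
by rewrite max_r ?subrr ?addr0//; lra.
Qed.

Lemma path_cat_r gam1 gam2 t : gam1 1 = gam2 0 -> 2^-1 <= t ->
  path_cat gam1 gam2 t = gam2 (2 * t - 1).
Proof.
move=> E t2; rewrite /path_cat min_r; last lra.
by rewrite max_l ?E 1?addrC ?subrK//; lra.
Qed.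

Lemma path_cat_continuous (gam1 gam2 : R -> R * R) : continuous gam1 -> continuous gam2 ->
  continuous (path_cat gam1 gam2).
Proof.
move=> c1 c2 t; apply: cvgD.
  apply: (@cvg_comp _ _ _ (fun t : R => Num.min (2 * t) 1) gam1 _ _ _ _ (c1 _)).
  by apply: continuous_min; [apply: cvgMr; exact: cvg_id|exact: cvg_cst].
apply: cvgB; last exact: cvg_cst.
apply: (@cvg_comp _ _ _ (fun t : R => Num.max (2 * t - 1) 0) gam2 _ _ _ _ (c2 _)).
apply: (@continuous_max _ _ (fun t : R => 2 * t - 1) (fun=> 0)); last exact: cvg_cst.
by apply: cvgB; [apply: cvgMr; exact: cvg_id|exact: cvg_cst].
Qed.

Lemma path_cat_in (gam1 gam2 : R -> R * R) : continuous gam1 -> continuous gam2 ->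
  gam1 1 = gam2 0 -> (forall t, I01 t -> Omega (gam1 t)) ->
  (forall t, I01 t -> Omega (gam2 t)) -> path_in (path_cat gam1 gam2).
Proof.
move=> c1 c2 E O1 O2; split.
  exact/continuous_subspaceT/path_cat_continuous.
move=> t /I01P /andP[t0 t1]; have [t2|t2] := leP t 2^-1.
  by rewrite path_cat_l//; apply: O1; apply/I01P; clear -t0 t1 t2; apply/andP; split; lra.
rewrite path_cat_r//; last exact: ltW.
by apply: O2; apply/I01P; clear -t0 t1 t2; apply/andP; split; lra.
Qed.

Definition joins (z0 z : R * R) (gam : R -> R * R) : Prop :=
  [/\ continuous gam, forall t, I01 t -> Omega (gam t), gam 0 = z0 & gam 1 = z].

Lemma joins_path z0 z gam : joins z0 z gam -> path_in gam.
Proof. by move=> [c O _ _]; split=> //; exact: continuous_subspaceT. Qed.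

Lemma joins_cat z0 z w gam1 gam2 : joins z0 z gam1 -> joins z w gam2 ->
  joins z0 w (path_cat gam1 gam2).
Proof.
move=> [c1 O1 <- E1] [c2 O2 F0 <-]; have E : gam1 1 = gam2 0 by rewrite E1.
split.
- exact: path_cat_continuous.
- exact: (path_cat_in c1 c2 E O1 O2).2.
- by rewrite path_cat_l ?mulr0//; lra.
- by rewrite path_cat_r//; [congr gam2; lra|lra].
Qed.

Lemma joins_rev z0 z gam : joins z0 z gam -> joins z z0 (fun t => gam (1 - t)).
Proof.
move=> [c O E0 E1]; split; rewrite ?subrr ?subr0//.
- move=> t; apply: (@cvg_comp _ _ _ (fun t : R => 1 - t) gam _ _ _ _ (c _)).
  by apply: cvgB; [exact: cvg_cst|exact: cvg_id].
- move=> t /I01P /andP[t0 t1]; apply: O; apply/I01P.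
  by clear -t0 t1; apply/andP; split; lra.
Qed.

Lemma ball_segment (c z w : R * R) (r t : R) : ball c r z -> ball c r w -> I01 t ->
  ball c r (z + t *: (w - z)).
Proof.
have seg (a b d : R) : 0 <= t -> t <= 1 -> ball a r b -> ball a r d ->
    ball a r (b + t * (d - b)).
  rewrite /ball /= !ltr_norml => t0 t1 /andP[b1 b2] /andP[d1 d2].
  have u0 : 0 <= 1 - t by rewrite subr_ge0.
  have [bd|/ltW bd] := leP b d.
    have P1 : 0 <= t * (d - b) by rewrite mulr_ge0 ?subr_ge0.
    have P2 : 0 <= (1 - t) * (d - b) by rewrite mulr_ge0 ?subr_ge0.
    by clear -b1 b2 d1 d2 P1 P2; apply/andP; split; lra.
  have P1 : 0 <= t * (b - d) by rewrite mulr_ge0 ?subr_ge0.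
  have P2 : 0 <= (1 - t) * (b - d) by rewrite mulr_ge0 ?subr_ge0.
  by clear -b1 b2 d1 d2 P1 P2; apply/andP; split; lra.
move=> [z1 z2] [w1 w2] /I01P /andP[t0 t1].
by split; exact: seg.
Qed.

Lemma joins_segment c r z w : ball c r `<=` Omega -> ball c r z -> ball c r w ->
  joins z w (fun t => z + t *: (w - z)).
Proof.
move=> BO Bz Bw; split.
- move=> t; apply: cvgD; first exact: cvg_cst.
  by apply: cvgZr_tmp; exact: cvg_id.
- by move=> t It; apply: BO; exact: ball_segment.
- by rewrite scale0r addr0.
- by rewrite scale1r addrC subrK.
Qed.

Section SimplyConnected.
Hypothesis sc : simply_connected Omega.
Variables (z0 : R * R) (g0 : T).
Hypothesis Oz0 : Omega z0.

Lemma joins_exists z : Omega z -> exists gam, joins z0 z gam.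
Proof.
move=> Oz.
apply: (connected_locally_const (P := fun z => exists gam, joins z0 z gam)
  sc.1 _ Oz0 Oz).
  move=> c Oc; have [r r0 [BO _ _]] := ls Oc.
  exists (ball c r); first exact: nbhsx_ballx.
  move=> u v Bu Bv _ _ [gam jg].
  by eexists; apply: joins_cat jg _; exact: joins_segment BO Bu Bv.
exists (fun=> z0); split=> // t; exact: cvg_cst.
Qed.

(** Going along the first path and back along the second is a null homotopic loop,
    so its lift closes up; the two halves of that lift are the two given lifts, by
    uniqueness. *)
Lemma lift_end_unique z gam1 gam2 g1 g2 : joins z0 z gam1 -> joins z0 z gam2 ->
  (forall t, I01 t -> lift_at gam1 g1 t) ->
  (forall t, I01 t -> lift_at gam2 g2 t) -> g1 0 = g2 0 -> g1 1 = g2 1.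
Proof.
move=> j1 j2 l1 l2 E.
have jr := joins_rev j2; have jc := joins_cat j1 jr.
have [cc Oc c0 c1] := jc; have pc := joins_path jc.
have [h h0 lh] := lift_exists (g1 0) pc.
(* The lift [h] of the loop made of the first path and the reverse of the second. *)
have h1 : h 1 = h 0.
  apply: (loop_lift pc c0 c1) lh; apply: sc.2 c0 c1; first exact: continuous_subspaceT.
  by move=> t tI; apply: Oc; exact/I01P.
have [_ _ _ e1] := j1; have [_ _ f0 _] := jr.
have <- : h (2^-1 * 1) = g1 1.
  apply: (lift_unique (joins_path j1) I01_connected (@subset_refl _ _)
    (g1 := h \o (fun t => 2^-1 * t)) _ l1 I01_0 I01_1); last first.
    by rewrite /= mulr0.
  move=> t It; have HI := I01_half0.
  apply: (lift_comp (gam := path_cat gam1 (fun t => gam2 (1 - t))) It _ HI).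
  - by move=> u; apply: cvgMr; exact: cvg_id.
  - move=> u /I01_half0P [u0 _]; rewrite path_cat_l//.
    by congr gam1; rewrite mulrA mulfV ?mul1r.
  - by apply: lh; exact: HI.
have <- : h (1 - 2^-1 * 1) = g2 1.
  apply: (lift_unique (joins_path j2) I01_connected (@subset_refl _ _)
    (g1 := h \o (fun t => 1 - 2^-1 * t)) _ l2 I01_0 I01_1); last first.
    by rewrite /= mulr0 subr0 h1 h0.
  move=> t It; have HI u (Iu : I01 u) := I01_rev (I01_half0 Iu).
  apply: (lift_comp (gam := path_cat gam1 (fun t => gam2 (1 - t))) It _ HI).
  - move=> u; apply: cvgB; first exact: cvg_cst.
    by apply: cvgMr; exact: cvg_id.
  - move=> u /I01_half0P [_ u1]; rewrite path_cat_r ?e1 ?f0//.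
    by congr gam2; field.
  - by apply: lh; exact: HI.
by congr h; field.
Qed.

Hypothesis sol_local : forall P Q z,
  (\forall w \near z, P w = Q w) -> sol P z -> sol Q z.

(** The global solution takes at [z] the final value of a lift along any path from
    [z0] to [z]. Near a point it agrees with a solution on a square, because a
    path to a nearby point may be chosen to end by a segment in that square. *)
Theorem monodromy : exists2 P, (forall z, Omega z -> sol P z) & P z0 = g0.
Proof.
have ch z : {gg : (R -> R * R) * (R -> T) | Omega z ->
    [/\ joins z0 z gg.1, gg.2 0 = g0 & forall t, I01 t -> lift_at gg.1 gg.2 t]}.
  apply: cid; have [Oz|nOz] := pselect (Omega z); last first.
    by exists (fun=> z0, fun=> g0).
  have [gam jg] := joins_exists Oz.
  have [g ge gl] := lift_exists g0 (joins_path jg).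
  by exists (gam, g).
pose P z := (sval (ch z)).2 1.
have PE z gam g : joins z0 z gam -> g 0 = g0 ->
    (forall t, I01 t -> lift_at gam g t) -> P z = g 1.
  move=> jg ge gl; have Oz : Omega z.
    by case: jg => _ O _ <-; apply: O; exact: I01_1.
  rewrite /P; case: (ch z) => -[gam' g'] /= /(_ Oz)[jg' ge' gl'].
  by apply: lift_end_unique jg' jg gl' gl _; rewrite ge' ge.
have Pz0 : P z0 = g0.
  have [r r0 [_ ex _]] := ls Oz0; have [Q sQ QE] := ex z0 g0 (ballxx _ r0).
  rewrite (PE z0 (fun=> z0) (fun=> g0))//.
    by split=> // t; exact: cvg_cst.
  move=> t It; exists Q; last by apply: filterE.
  by apply: filterS sQ _; exact: nbhsx_ballx.
exists P => // c Oc; have [r r0 [BO ex _]] := ls Oc.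
have [Q sQ QE] := ex c (P c) (ballxx _ r0).
apply: (sol_local (P := Q)); last by apply: sQ; exact: ballxx.
apply: filterS (nbhsx_ballx c r r0) => w Bw.
have jg : joins z0 c (sval (ch c)).1 by case: (ch c) => gg /= /(_ Oc)[].
have js := joins_segment BO (ballxx c r0) Bw.
have jc := joins_cat jg js.
have [h h0 lh] := lift_exists g0 (joins_path jc).
rewrite (PE w _ h jc h0 lh).
have [_ _ _ e1] := jg; have [cs Os s0 s1] := js.
have hc : h (2^-1 * 1) = P c.
  symmetry; apply: (PE c _ (h \o (fun t => 2^-1 * t)) jg); first by rewrite /= mulr0.
  move=> t It; have HI := I01_half0.
  apply: (lift_comp (gam := path_cat (sval (ch c)).1 (fun t => c + t *: (w - c))) It _ HI).
  - by move=> u; apply: cvgMr; exact: cvg_id.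
  - move=> u /I01_half0P [u0 _]; rewrite path_cat_l//.
    by congr ((sval (ch c)).1 _); rewrite mulrA mulfV ?mul1r.
  - by apply: lh; exact: HI.
have -> : h 1 = h (2^-1 * 1 + 2^-1) by congr h; field.
rewrite -[w in LHS]s1.
apply: (lift_unique (joins_path js) I01_connected (@subset_refl _ _)
  (g1 := fun t => Q (c + t *: (w - c))) (g2 := h \o (fun t => 2^-1 * t + 2^-1)) _ _ I01_0 I01_1).
- move=> t It; exists Q; last by apply: filterE.
  apply: filterS sQ _; apply: open_nbhs_nbhs; split; first exact: ball_open.
  by apply: ball_segment => //; exact: ballxx.
- move=> t It; have HI := I01_half1.
  apply: (lift_comp (gam := path_cat (sval (ch c)).1 (fun t => c + t *: (w - c))) It _ HI).
  - move=> u; apply: cvgD; last exact: cvg_cst.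
    by apply: cvgMr; exact: cvg_id.
  - move=> u /I01_half1P u0; rewrite path_cat_r ?e1 ?s0//.
    by congr (_ + _ *: _); field.
  - by apply: lh; exact: HI.
- by rewrite /= s0 mulr0 add0r QE -hc mulr1.
Qed.

End SimplyConnected.
End Monodromy.

(** * Matrix-valued functions of one variable *)

Section MatrixNorm.
Context {R : realType}.

Lemma mx_norm_le m n (A : 'M[R]_(m, n)) e : 0 <= e ->
  (forall i j, `|A i j| <= e) -> `|A| <= e.
Proof.
by move=> e0 Ae; rewrite /Num.Def.normr /= mx_normrE; apply: bigmax_le => // -[i j].
Qed.

Lemma mx_norm_entry m n (A : 'M[R]_(m, n)) i j : `|A i j| <= `|A|.
Proof.
by rewrite [leRHS]/Num.Def.normr /= mx_normrE; exact: (le_bigmax _ _ (i, j)).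
Qed.

Lemma mx_norm_mul m n p (A : 'M[R]_(m, n)) (B : 'M[R]_(n, p)) :
  `|A *m B| <= n%:R * (`|A| * `|B|).
Proof.
apply: mx_norm_le; first by rewrite !mulr_ge0.
move=> i j; rewrite mxE; apply: le_trans (ler_norm_sum _ _ _) _.
have -> : n%:R * (`|A| * `|B|) = \sum_(k < n) `|A| * `|B|.
  by rewrite big_const_ord iter_addr_0 mulr_natl.
by apply: ler_sum => k _; rewrite normrM; apply: ler_pM => //; exact: mx_norm_entry.
Qed.

Lemma is_derive_mxP (V : normedModType R) m n (f : V -> 'M[R]_(m, n)) x v df :
  is_derive x v f df <-> forall i j, is_derive x v (fun y => f y i j) (df i j).
Proof.
split=> [[fd <-] i j|H].
  split; first by move/derivable_mxP : fd.
  by rewrite (derive_mx fd) mxE.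
have fd : derivable f x v by apply/derivable_mxP => i j; have [] := H i j.
split=> //; rewrite (derive_mx fd); apply/matrixP => i j; rewrite mxE.
by have [_ ->] := H i j.
Qed.

Lemma is_derive_mulmx (V : normedModType R) m n p (f : V -> 'M[R]_(m, n))
    (g : V -> 'M[R]_(n, p)) x v df dg :
  is_derive x v f df -> is_derive x v g dg ->
  is_derive x v (fun y => f y *m g y) (df *m g x + f x *m dg).
Proof.
move=> /is_derive_mxP Hf /is_derive_mxP Hg; apply/is_derive_mxP => i j.
have -> : (fun y => (f y *m g y) i j) = \sum_(k < n) (fun y => f y i k * g y k j).
  by apply/funext => y; rewrite mxE fct_sumE.
have -> : (df *m g x + f x *m dg) i j =
    \sum_(k < n) (f x i k *: dg k j + g x k j *: df i k).
  rewrite !mxE -big_split /=; apply: eq_bigr => k _.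
  by rewrite addrC; congr (_ + _); rewrite /GRing.scale /= mulrC.
apply: is_derive_sum => k; exact: is_deriveM.
Qed.

Lemma is_derive1_continuous m n (f : R -> 'M[R]_(m, n)) (x : R) df :
  is_derive x 1 f df -> {for x, continuous f}.
Proof.
by move=> [fd _]; apply: differentiable_continuous; exact/derivable1_diffP.
Qed.

Lemma continuous_mxP (T : topologicalType) m n (f : T -> 'M[R]_(m, n)) x :
  {for x, continuous f} <-> forall i j, {for x, continuous (fun y => f y i j)}.
Proof.
split=> [cf i j|cf].
  by apply: (@cvg_comp _ _ _ f (fun M : 'M[R]_(m, n) => M i j) _ _ _ cf); exact: coord_continuous.
apply/cvgrPdist_le => e e0; near=> y; apply: mx_norm_le; first exact: ltW.
move=> i j; rewrite !mxE.
have : forall ij : 'I_m * 'I_n, `|f x ij.1 ij.2 - f y ij.1 ij.2| <= e.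
  near: y; apply: filter_forall => -[i' j'] /=.
  exact: ((@cvgrPdist_le _ _ _ _ _ _ _).1 (cf i' j')).
by move=> /(_ (i, j)).
Unshelve. all: by end_near. Qed.

Lemma continuous_mulmx (T : topologicalType) m n p (f : T -> 'M[R]_(m, n))
    (g : T -> 'M[R]_(n, p)) x : {for x, continuous f} -> {for x, continuous g} ->
  {for x, continuous (fun y => f y *m g y)}.
Proof.
move=> /continuous_mxP cf /continuous_mxP cg; apply/continuous_mxP => i j.
have -> : (fun y => (f y *m g y) i j) = (fun y => \sum_(k < n) f y i k * g y k j).
  by apply/funext => y; rewrite mxE.
elim: (index_enum _) => [|k r IH].
  have -> : (fun y => \sum_(k <- [::]) f y i k * g y k j) = (fun=> 0).
    by apply/funext => y; rewrite big_nil.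
  exact: cvg_cst.
have -> : (fun y => \sum_(k0 <- k :: r) f y i k0 * g y k0 j) =
    (fun y => f y i k * g y k j + \sum_(k0 <- r) f y i k0 * g y k0 j).
  by apply/funext => y; rewrite big_cons.
by apply: cvgD; [apply: cvgM; [exact: cf|exact: cg]|exact: IH].
Qed.

Definition between (a b t : R) : Prop := Num.min a b <= t <= Num.max a b.

Lemma betweenl a b : between a b a.
Proof. by rewrite /between ge_min le_max lexx. Qed.

Lemma betweenr a b : between a b b.
Proof. by rewrite /between ge_min le_max lexx !orbT. Qed.

Lemma between_trans a b s t : between a b s -> between a s t -> between a b t.
Proof.
rewrite /between; case: (leP a b) => ab; case: (leP a s) => as_;
  move=> /andP[H1 H2] /andP[H3 H4]; apply/andP; split; lra.
Qed.

Lemma between_norm a b t : between a b t -> `|t - a| <= `|b - a|.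
Proof.
rewrite /between; have [ab|ba] := leP a b => /andP[H1 H2].
  by rewrite !ger0_norm; lra.
by rewrite !ler0_norm; lra.
Qed.

Lemma between_oo l u a b t : l < a < u -> l < b < u -> between a b t -> l < t < u.
Proof.
rewrite /between => /andP[H1 H2] /andP[H3 H4].
by case: (leP a b) => ab /andP[H5 H6]; apply/andP; split; lra.
Qed.

Lemma mean_value_real (f f' : R -> R) a b c K :
  (forall t, between a b t -> is_derive t 1 f (f' t) /\ `|f' t - c| <= K) ->
  `|f b - f a - (b - a) * c| <= K * `|b - a|.
Proof.
wlog ab : a b / a < b.
  move=> W H; have [ab|ba|->] := ltgtP a b; first exact: W.
    have -> : f b - f a - (b - a) * c = - (f a - f b - (a - b) * c) by ring.
    rewrite normrN [`|b - a|]distrC.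
    by apply: W => // t Bt; apply: H; move: Bt; rewrite /between minC maxC.
  by rewrite !subrr mul0r subr0 normr0 mulr0.
move=> H; have Bab t : t \in `[a, b] -> between a b t.
  by rewrite in_itv /between (min_l (ltW ab)) (max_r (ltW ab)).
have Boo t : t \in `]a, b[ -> between a b t.
  by move=> tab; apply: Bab; apply: subset_itv_oo_cc.
have [||d dab ->] := @MVT R f f' a b ab.
- by move=> t /Boo /H[].
- apply: derivable_within_continuous => t /Bab /H[[]]; done.
- have [_ Kd] := H d (Boo _ dab).
  have -> : f' d * (b - a) - (b - a) * c = (f' d - c) * (b - a) by ring.
  by rewrite normrM ler_wpM2r.
Qed.

(** Centering the derivative at [c] makes the same inequality serve as a bound of
    the increments, for c = 0, and as a Taylor estimate of first order. *)
Lemma mean_value_mx m n (f f' : R -> 'M[R]_(m, n)) a b c K : 0 <= K ->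
  (forall t, between a b t -> is_derive t 1 f (f' t) /\ `|f' t - c| <= K) ->
  `|f b - f a - (b - a) *: c| <= K * `|b - a|.
Proof.
move=> K0 H; apply: mx_norm_le => [|i j]; first by rewrite mulr_ge0.
rewrite !mxE; apply: (@mean_value_real (fun t => f t i j) (fun t => f' t i j)).
move=> t /H[/is_derive_mxP Hd HK]; split; first exact: Hd.
by apply: le_trans HK; have := mx_norm_entry (f' t - c) i j; rewrite !mxE.
Qed.

(** A Gronwall inequality on intervals short enough that the exponential may be
    replaced by the absorption of half of the maximum. *)
Lemma short_gronwall m n (Z Z' : R -> 'M[R]_(m, n)) a b L d : 0 <= L -> 0 <= d ->
  `|b - a| * L <= 2^-1 ->
  (forall t, between a b t -> is_derive t 1 Z (Z' t) /\ `|Z' t| <= L * `|Z t| + d) ->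
  `|Z b| <= 2 * (`|Z a| + `|b - a| * d).
Proof.
move=> L0 d0 Lab H.
have mM : Num.min a b <= Num.max a b by rewrite ge_min le_max lexx.
have cZ : {within `[Num.min a b, Num.max a b], continuous (fun t => `|Z t|)}.
  apply: continuous_in_subspaceT => t; rewrite inE /= in_itv /= => Bt.
  have [Zd _] := H t Bt; have cZt := is_derive1_continuous Zd.
  by apply: (@cvg_comp _ _ _ Z (@Num.norm _ _) _ _ _ cZt); exact: norm_continuous.
have [s Bs smax] := EVT_max mM cZ.
have {}Bs : between a b s by move: Bs; rewrite in_itv.
have {}smax t : between a b t -> `|Z t| <= `|Z s|.
  by move=> Bt; apply: smax; rewrite in_itv.
have K0 : 0 <= L * `|Z s| + d by rewrite addr_ge0 ?mulr_ge0.
have := @mean_value_mx _ _ Z Z' a s 0 (L * `|Z s| + d) K0.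
rewrite scaler0 subr0 => MV0; have MV : `|Z s - Z a| <= (L * `|Z s| + d) * `|s - a|.
  apply: MV0 => t Bt; have [Zd ZL] := H t (between_trans Bs Bt); split=> //; rewrite subr0.
  apply: le_trans ZL _; rewrite lerD2r ler_wpM2l//; apply: smax.
  exact: between_trans Bs Bt.
have h1 : `|Z s| <= `|Z s - Z a| + `|Z a|.
  by rewrite -{1}(subrK (Z a) (Z s)) ler_normD.
have h2 := between_norm Bs.
have h3 := smax b (betweenr a b).
have h4 : (L * `|Z s| + d) * `|s - a| <= (L * `|Z s| + d) * `|b - a| by rewrite ler_wpM2l.
have h5 : `|b - a| * L * `|Z s| <= 2^-1 * `|Z s| by rewrite ler_wpM2r.
have : (L * `|Z s| + d) * `|b - a| = `|b - a| * L * `|Z s| + `|b - a| * d by ring.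
move: h1 h3 h4 h5 MV; generalize (`|Z s|) (`|Z b|) (`|Z a|) (`|Z s - Z a|)
  (`|b - a| * d) (`|b - a| * L * `|Z s|) ((L * `|Z s| + d) * `|b - a|) ((L * `|Z s| + d) * `|s - a|).
move=> *; lra.
Qed.

(** The sum is the supremum of the partial sums lowered by their tail bounds,
    which increase. *)
Lemma geometric_sum (y : nat -> R) C :
  (forall k, `|y k| <= C * 2^-1 ^+ k) ->
  exists w, forall k, `|w - \sum_(i < k) y i| <= 2 * C * 2^-1 ^+ k.
Proof.
move=> yC; pose S k := \sum_(i < k) y i; pose t k := 2 * C * 2^-1 ^+ k : R.
have tS k : t k = C * 2^-1 ^+ k + t k.+1 by rewrite /t exprS; field.
have SS k : S k.+1 = S k + y k by rewrite /S big_ord_recr.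
have lo k : S k - t k <= S k.+1 - t k.+1.
  by have := yC k; rewrite ler_norml => /andP[H1 H2]; have := tS k; have := SS k; lra.
have hi k : S k.+1 + t k.+1 <= S k + t k.
  by have := yC k; rewrite ler_norml => /andP[H1 H2]; have := tS k; have := SS k; lra.
have t0 k : 0 <= t k.
  have C0 : 0 <= C by have := yC 0%N; rewrite expr0 mulr1; exact: le_trans.
  by rewrite /t !mulr_ge0.
have lom i j : (i <= j)%N -> S i - t i <= S j - t j.
  by move=> /subnK <-; elim: (j - i)%N => [//|d IH]; apply: le_trans IH (lo _).
have him i j : (i <= j)%N -> S j + t j <= S i + t i.
  by move=> /subnK <-; elim: (j - i)%N => [//|d IH]; apply: le_trans (hi _) IH.
have lohi i j : S i - t i <= S j + t j.
  have [ij|/ltnW ji] := leqP i j.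
    by apply: le_trans (lom _ _ ij) _; have := t0 j; lra.
  by apply: le_trans (him _ _ ji); have := t0 i; lra.
pose A := [set S k - t k | k in [set: nat]].
have A0 : A !=set0 by exists (S 0%N - t 0%N), 0%N.
exists (sup A) => k; rewrite ler_distl; apply/andP; split.
  apply: ub_le_sup; last by exists k.
  by exists (S 0%N + t 0%N) => _ [i _ <-]; exact: lohi.
by apply: ge_sup => // _ [i _ <-]; exact: lohi.
Qed.

(** This turns estimates with an error decreasing geometrically into estimates
    without error. *)
Lemma le_geometric (x y C : R) :
  (forall k, x <= y + C * 2^-1 ^+ k) -> x <= y.
Proof.
move=> H; have : (fun k => y + C * 2^-1 ^+ k) @ \oo --> y + C * 0.
  apply: cvgD; first exact: cvg_cst.
  by apply: cvgMr; apply: cvg_expr; rewrite ger0_norm; lra.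
rewrite mulr0 addr0 => /(@cvg_lim _ _ _) <-//.
apply: limr_ge; last exact: nearW.
apply/cvg_ex; exists (y + C * 0); apply: cvgD; first exact: cvg_cst.
by apply: cvgMr; apply: cvg_expr; rewrite ger0_norm; lra.
Qed.

(** Coefficients defined on an interval are extended to the line by constants,
    which keeps them continuous and bounded. *)
Definition clamp (l u t : R) : R := Num.max l (Num.min t u).

Lemma clamp_continuous l u : continuous (clamp l u).
Proof.
move=> t; apply: (@continuous_max _ _ (fun=> l) (fun t => Num.min t u)).
  exact: cvg_cst.
by apply: (@continuous_min _ _ id (fun=> u)); [exact: cvg_id|exact: cvg_cst].
Qed.

Lemma clamp_id l u t : l <= t <= u -> clamp l u t = t.
Proof. by move=> /andP[H1 H2]; rewrite /clamp min_l// max_r. Qed.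

Lemma clamp_itv l u t : l <= u -> l <= clamp l u t <= u.
Proof. by move=> lu; rewrite /clamp le_max lexx ge_max lu ge_min lexx orbT. Qed.

Lemma antiderivative (f : R -> R) (l u : R) : continuous f -> l < u ->
  exists2 J : R -> R, continuous J &
    forall t, l < t < u -> is_derive t 1 J (f t).
Proof.
move=> cf lu; pose I (t : R) := (\int[lebesgue_measure]_(x in `[l - 1, t]) f x)%R.
have dI t : l - 1 < t < u + 1 -> is_derive t 1 I (f t).
  move=> /andP[lt tu].
  have [||dI IE] := @continuous_FTC1_closed R f (l - 1) t (u + 1) tu _ lt.
  - apply: continuous_compact_integrable; first exact: segment_compact.
    exact: continuous_subspaceT.
  - exact: cf.
  - by split; [exact: dI|rewrite -derive1E].
exists (I \o clamp l u).
  move=> t; apply: (@cvg_comp _ _ _ (clamp l u) I _ _ _ (@clamp_continuous l u t)).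
  have /andP[H1 H2] := @clamp_itv l u t (ltW lu).
  have [] := dI (clamp l u t); first by apply/andP; split; lra.
  by move=> /derivable1_diffP/differentiable_continuous.
move=> t /andP[lt tu]; apply: (near_eq_is_derive (f := I)); last first.
  by apply: dI; apply/andP; split; lra.
near=> s; rewrite /= clamp_id//.
have ls : l < s by near: s; exact: lt_nbhsr.
have su : s < u by near: s; exact: lt_nbhsl.
by rewrite !ltW.
Unshelve. all: by end_near. Qed.

Lemma antiderivative_mx m n (f : R -> 'M[R]_(m, n)) (l u a : R) : continuous f -> l < u ->
  exists J : R -> 'M[R]_(m, n), [/\ continuous J, J a = 0 &
    forall t, l < t < u -> is_derive t 1 J (f t)].
Proof.
move=> cf lu.
have ex i j : exists J : R -> R, continuous J /\
    forall t, l < t < u -> is_derive t 1 J (f t i j).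
  have [|J cJ dJ] := @antiderivative (fun t => f t i j) l u _ lu; last by exists J.
  by move=> t; have /continuous_mxP := cf t; apply.
pose J t : 'M[R]_(m, n) := \matrix_(i, j) sval (cid (ex i j)) t.
have JE i j : (fun t => J t i j) = sval (cid (ex i j)).
  by apply/funext => t; rewrite mxE.
have dJ t : l < t < u -> is_derive t 1 J (f t).
  by move=> tlu; apply/is_derive_mxP => i j; rewrite JE; exact: (svalP (cid (ex i j))).2.
have cJ : continuous J.
  by move=> t; apply/continuous_mxP => i j; rewrite JE; exact: (svalP (cid (ex i j))).1.
exists (fun t => J t - J a); split; [|exact: subrr|].
  by move=> t; apply: cvgB; [exact: cJ|exact: cvg_cst].
move=> t tlu; have := is_deriveB (dJ t tlu) (is_derive_cst (J a) t 1).
by rewrite subr0.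
Qed.

(** The differential quotient is avoided: estimates of the increment, with the
    increment of the variable as a factor, pass to limits and need no division. *)
Lemma is_derive_approx m n (W : R -> 'M[R]_(m, n)) (t : R) L :
  (forall e, 0 < e -> \forall s \near t,
     `|W s - W t - (s - t) *: L| <= e * `|s - t|) -> is_derive t 1 W L.
Proof.
move=> H; have lim_W : (fun h : R => h^-1 *: ((W \o shift t) (h *: 1) - W t)) @ 0^' --> L.
  apply/cvgrPdist_le => e e0.
  have He := H e e0.
  have : \forall h \near (0 : R), `|W (h + t) - W t - (h + t - t) *: L| <= e * `|h + t - t|.
    have ct : (fun h : R => h + t) @ 0 --> t.
      by rewrite -{2}[t]add0r; apply: cvgD; [exact: cvg_id|exact: cvg_cst].
    exact: ct He.
  move=> Hh; near=> h; have h0 : h != 0 by near: h; exact: nbhs_dnbhs_neq.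
  have : `|W (h + t) - W t - (h + t - t) *: L| <= e * `|h + t - t|.
    by near: h; exact: nbhs_dnbhs.
  rewrite addrK /= => Hb; rewrite [h *: 1]mulr1.
  have -> : L - h^-1 *: (W (h + t) - W t) = - (h^-1 *: (W (h + t) - W t - h *: L)).
    by rewrite [in RHS]scalerBr [in RHS]scalerA mulVf// scale1r opprB.
  rewrite normrN normrZ normfV mulrC ler_pdivrMr ?normr_gt0//.
split; last exact: cvg_lim.
by apply/cvg_ex; exists L.
Unshelve. all: by end_near. Qed.

(** Picard iteration: on an interval this short the increments of the
    iterates at least halve at each step. *)
Lemma linear_ode m n (B : R -> 'M[R]_n) (M l u a : R) (g : 'M[R]_(m, n)) :
  continuous B -> (forall t, `|B t| <= M) -> l < a < u ->
  n%:R * M * (u - l) <= 2^-1 ->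
  exists2 W : R -> 'M[R]_(m, n), W a = g &
    forall t, l < t < u -> is_derive t 1 W (W t *m B t).
Proof.
move=> cB BM alu small; have M0 : 0 <= M := le_trans (normr_ge0 _) (BM 0).
have lu : l < u by case/andP: alu; exact: lt_trans.
have nex (Y : R -> 'M[R]_(m, n)) : exists J : R -> 'M[R]_(m, n), continuous Y ->
   [/\ continuous J, J a = 0 & forall t, l < t < u -> is_derive t 1 J (Y t *m B t)].
  have [cY|ncY] := pselect (continuous Y); last by exists (fun=> 0).
  have cYB : continuous (fun t => Y t *m B t).
    by move=> t; apply: continuous_mulmx; [exact: cY|exact: cB].
  by have [J HJ] := antiderivative_mx a cYB lu; exists J.
pose next Y := sval (cid (nex Y)).
have nextP Y : continuous Y -> [/\ continuous (next Y), next Y a = 0 &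
    forall t, l < t < u -> is_derive t 1 (next Y) (Y t *m B t)].
  exact: (svalP (cid (nex Y))).
(* [Y k] is the increment between consecutive Picard iterates, and [S k] below is
   the iterate itself; the solution [W] is their limit. *)
pose Y k := iter k next (fun=> g).
have cY k : continuous (Y k).
  elim: k => [|k IH]; first by move=> t; exact: cvg_cst.
  by have [] := nextP _ IH.
have YE k t : l < t < u -> is_derive t 1 (Y k.+1) (Y k t *m B t).
  by have [_ _] := nextP _ (cY k); apply.
have Ya k : Y k.+1 a = 0 by have [] := nextP _ (cY k).
have len t : l < t < u -> `|t - a| <= u - l.
  by move: alu => /andP[? ?] /andP[? ?]; rewrite ler_norml; apply/andP; split; lra.
have YB k t : l < t < u -> `|Y k t| <= `|g| * 2^-1 ^+ k.
  elim: k t => [|k IH] t tlu; first by rewrite expr0 mulr1.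
  have K0 : 0 <= n%:R * (`|g| * 2^-1 ^+ k * M) by rewrite !mulr_ge0// exprn_ge0.
  have := @mean_value_mx _ _ (Y k.+1) (fun t => Y k t *m B t) a t 0 _ K0.
  rewrite Ya scaler0 !subr0 => H; apply: le_trans (H _) _ => [s Bs|].
    have slu := between_oo alu tlu Bs.
    split; first exact: YE.
    rewrite subr0; apply: le_trans (mx_norm_mul _ _) _.
    by rewrite ler_wpM2l// ler_pM//; exact: IH.
  apply: (@le_trans _ _ (n%:R * (`|g| * 2^-1 ^+ k * M) * (u - l))).
    by apply: ler_wpM2l; [exact: K0|exact: len].
  have -> : n%:R * (`|g| * 2^-1 ^+ k * M) * (u - l) = `|g| * 2^-1 ^+ k * (n%:R * M * (u - l)) by ring.
  by rewrite exprSr [leRHS]mulrA ler_wpM2l// mulr_ge0// exprn_ge0.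
pose S k t := \sum_(i < k) Y i t.
have dS k t : l < t < u -> is_derive t 1 (S k.+1) (S k t *m B t).
  move=> tlu; elim: k => [|k IH].
    have -> : S 1%N = cst g by apply/funext => s; rewrite /S big_ord1.
    by rewrite /S big_ord0 mul0mx; exact: is_derive_cst.
  have -> : S k.+2 = S k.+1 \+ Y k.+1 by apply/funext => s; rewrite /S big_ord_recr.
  have -> : S k.+1 t = S k t + Y k t by rewrite /S big_ord_recr.
  by rewrite mulmxDl; exact: (is_deriveD IH (YE k t tlu)).
have exW t i j : exists w, l < t < u -> forall k, `|w - S k t i j| <= 2 * `|g| * 2^-1 ^+ k.
  have [tlu|ntlu] := boolP (l < t < u); last by exists 0.
  have [|w Hw] := @geometric_sum (fun k => Y k t i j) `|g|.
    by move=> k; apply: le_trans (YB k t tlu); exact: mx_norm_entry.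
  by exists w => _ k; rewrite /S summxE.
pose W t : 'M[R]_(m, n) := \matrix_(i, j) sval (cid (exW t i j)).
have WS t k : l < t < u -> `|W t - S k t| <= 2 * `|g| * 2^-1 ^+ k.
  move=> tlu; apply: mx_norm_le; first by rewrite !mulr_ge0// exprn_ge0.
  by move=> i j; rewrite !mxE; exact: (svalP (cid (exW t i j)) tlu k).
have Wa : W a = g.
  have SE k : S k.+1 a = g.
    by rewrite /S big_ord_recl /= big1 ?addr0// => i _; exact: Ya.
  apply/eqP; rewrite -subr_eq0 -normr_eq0 eq_le normr_ge0 andbT.
  apply: (@le_geometric _ _ (2 * `|g|)) => k; rewrite add0r.
  apply: (@le_trans _ _ (2 * `|g| * 2^-1 ^+ k.+1)).
    by rewrite -{1}(SE k); exact: WS.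
  rewrite exprS mulrA [X in _ <= X]mulrC [X in X <= _]mulrC ler_wpM2l ?exprn_ge0//.
  by have := normr_ge0 g; lra.
exists W => // t tlu.
pose C := n%:R * (2 * `|g| * M).
have C0 : 0 <= C by rewrite !mulr_ge0.
(* The mean value estimate for the iterates passes to the limit; it yields the
   Lipschitz continuity of [W], for [N = 0], and then its derivative. *)
have main s N K : l < s < u -> 0 <= K ->
    (forall r, between t s r -> `|W r *m B r - N| <= K) ->
    `|W s - W t - (s - t) *: N| <= K * `|s - t|.
  move=> slu K0 HK.
  apply: (@le_geometric _ _ (4 * `|g| + C * `|s - t|)) => k.
  have Kk : 0 <= K + C * 2^-1 ^+ k by rewrite addr_ge0 ?mulr_ge0 ?exprn_ge0.
  have Hk : `|S k.+1 s - S k.+1 t - (s - t) *: N| <= (K + C * 2^-1 ^+ k) * `|s - t|.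
    apply: (@mean_value_mx _ _ (S k.+1) (fun t => S k t *m B t)) => // r Br.
    have rlu := between_oo tlu slu Br.
    split; first exact: dS.
    have -> : S k r *m B r - N = (W r *m B r - N) - (W r - S k r) *m B r.
      by rewrite mulmxBl opprB [RHS]addrC subrKA.
    apply: le_trans (ler_normB _ _) _; apply: lerD; first exact: HK.
    apply: le_trans (mx_norm_mul _ _) _.
    have -> : C * 2^-1 ^+ k = n%:R * (2 * `|g| * 2^-1 ^+ k * M) by rewrite /C; ring.
    by rewrite ler_wpM2l// ler_pM//; exact: WS.
  have -> : W s - W t - (s - t) *: N =
     (S k.+1 s - S k.+1 t - (s - t) *: N) + ((W s - S k.+1 s) - (W t - S k.+1 t)).
    by apply/matrixP => i j; rewrite !mxE; ring.
  apply: le_trans (ler_normD _ _) _.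
  apply: le_trans (lerD Hk (ler_normB _ _)) _.
  apply: le_trans (lerD (lexx _) (lerD (WS s k.+1 slu) (WS t k.+1 tlu))) _.
  rewrite exprS; set q := 2^-1 ^+ k.
  have q0 : 0 <= q by rewrite exprn_ge0.
  have gq : 0 <= `|g| * q by rewrite mulr_ge0.
  by move: gq; generalize (`|s - t|) (`|g|) => x y gq; lra.
have Wbound r : l < r < u -> `|W r| <= 2 * `|g|.
  by move=> rlu; have := WS r 0%N rlu; rewrite /S big_ord0 subr0 expr0 mulr1.
have lip s : l < s < u -> `|W s - W t| <= C * `|s - t|.
  move=> slu; have := main s 0 C slu C0; rewrite scaler0 subr0; apply=> r Br.
  have rlu := between_oo tlu slu Br.
  rewrite subr0; apply: le_trans (mx_norm_mul _ _) _.
  by rewrite /C ler_wpM2l// ler_pM//; exact: Wbound.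
have nlu : \forall s \near t, l < s < u.
  near=> s; apply/andP; split.
    by near: s; case/andP: tlu => ? _; exact: lt_nbhsr.
  by near: s; case/andP: tlu => _ ?; exact: lt_nbhsl.
have cW : {for t, continuous W}.
  apply/cvgrPdist_le => e e0; near=> s.
  have slu : l < s < u by near: s.
  rewrite distrC; apply: le_trans (lip s slu) _.
  apply: (@le_trans _ _ ((C + 1) * `|s - t|)).
    by rewrite ler_wpM2r// lerDl.
  rewrite mulrC -ler_pdivlMr; last by rewrite ltr_wpDl.
  rewrite distrC; near: s.
  by apply: (@cvgr_dist_le _ _ _ (nbhs t) _ id t (@cvg_id _ _)); rewrite divr_gt0// ltr_wpDl.
have cWB : {for t, continuous (fun s => W s *m B s)} by apply: continuous_mulmx cW (cB t).
apply: is_derive_approx => e e0.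
have /nbhs_ballP[d /= d0 dB] : \forall s \near t, `|W t *m B t - W s *m B s| <= e.
  exact: ((@cvgrPdist_le _ _ _ _ _ _ _).1 cWB).
near=> s; have slu : l < s < u by near: s.
apply: main => //; first exact: ltW.
move=> r Br; rewrite distrC; apply: dB; rewrite /ball /= distrC.
apply: le_lt_trans (between_norm Br) _; rewrite distrC.
by near: s; exact: nbhsx_ballx.
Unshelve. all: by end_near. Qed.

End MatrixNorm.

(** * Local integration of flat matrix-valued forms *)

Section LocalFrobenius.
Context {R : realType}.

Lemma is_derive_dirx (V : normedModType R) (f : R * R -> V) x y df :
  is_derive (x, y) dirx f df <-> is_derive x 1 (fun t => f (t, y)) df.
Proof.
have E : (fun h : R => h^-1 *: ((f \o shift (x, y)) (h *: dirx) - f (x, y))) =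
    (fun h : R => h^-1 *: (((fun t => f (t, y)) \o shift x) (h *: 1) - f (x, y))).
  apply/funext => h /=; congr (_ *: (f _ - _)).
  by congr (_, _); rewrite /= /GRing.scale /= mulr0 add0r.
by split=> -[fd fE]; split; move: fd fE; rewrite /derivable /derive E.
Qed.

Lemma is_derive_diry (V : normedModType R) (f : R * R -> V) x y df :
  is_derive (x, y) diry f df <-> is_derive y 1 (fun t => f (x, t)) df.
Proof.
have E : (fun h : R => h^-1 *: ((f \o shift (x, y)) (h *: diry) - f (x, y))) =
    (fun h : R => h^-1 *: (((fun t => f (x, t)) \o shift y) (h *: 1) - f (x, y))).
  apply/funext => h /=; congr (_ *: (f _ - _)).
  by congr (_, _); rewrite /= /GRing.scale /= mulr0 add0r.
by split=> -[fd fE]; split; move: fd fE; rewrite /derivable /derive E.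
Qed.

Lemma slicex_continuous (y : R) : continuous (fun t : R => (t, y)).
Proof.
move=> x V /nbhs_ballP[e /= e0 eV]; apply/nbhs_ballP; exists e => //= t Bt.
by apply: eV; split=> //; exact: ballxx.
Qed.

Lemma slicey_continuous (x : R) : continuous (fun t : R => (x, t)).
Proof.
move=> y V /nbhs_ballP[e /= e0 eV]; apply/nbhs_ballP; exists e => //= t Bt.
by apply: eV; split=> //; exact: ballxx.
Qed.

Lemma is_derive_near_bound m n (W : R -> 'M[R]_(m, n)) (t : R) L e :
  is_derive t 1 W L -> 0 < e ->
  \forall s \near t, `|W s - W t - (s - t) *: L| <= e * `|s - t|.
Proof.
move=> [dW WL] e0.
have : (fun h : R => h^-1 *: ((W \o shift t) (h *: 1) - W t)) @ 0^' --> L.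
  by rewrite -WL; exact: dW.
move=> /cvgrPdist_le /(_ e e0) He.
have : \forall h \near (0 : R), h != 0 ->
    `|L - h^-1 *: ((W \o shift t) (h *: 1) - W t)| <= e by exact: He.
move=> {}He.
have ct : (fun s : R => s - t) @ t --> (0 : R).
  by rewrite -[X in _ --> X](subrr t); apply: cvgB; [exact: cvg_id|exact: cvg_cst].
have : \forall s \near t, s - t != 0 ->
    `|L - (s - t)^-1 *: ((W \o shift t) ((s - t) *: 1) - W t)| <= e by exact: ct He.
apply: filterS => s; have [->|st] := eqVneq s t.
  by move=> _; rewrite !subrr scale0r subr0 !normr0 mulr0.
rewrite subr_eq0 => /(_ st) /=.
rewrite [(s - t) *: 1]mulr1 subrK => H.
have -> : W s - W t - (s - t) *: L = - ((s - t) *: (L - (s - t)^-1 *: (W s - W t))).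
  by rewrite [in RHS]scalerBr [in RHS]scalerA mulfV ?subr_eq0// scale1r opprB.
by rewrite normrN normrZ mulrC ler_wpM2r.
Qed.

Variables (m n : nat) (A1 A2 : R * R -> 'M[R]_n).

(** The total differential system dP = P (A1 dx + A2 dy), for matrices [P] of any
    height, so that it covers group-valued primitives as well as their rows. *)
Definition total_sol (P : R * R -> 'M[R]_(m, n)) (z : R * R) : Prop :=
  is_derive z dirx P (P z *m A1 z) /\ is_derive z diry P (P z *m A2 z).

Lemma total_sol_near P Q z : (\forall w \near z, P w = Q w) ->
  total_sol P z -> total_sol Q z.
Proof.
move=> PQ [dx dy]; rewrite /total_sol -(nbhs_singleton PQ : P z = Q z).
by split; [apply: near_eq_is_derive dx|apply: near_eq_is_derive dy].
Qed.

Variables (Omega : set (R * R)) (A1y A2x A2xx : R * R -> 'M[R]_n).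
Hypothesis Oo : open Omega.
Hypothesis cA1 : forall z, Omega z -> {for z, continuous A1}.
Hypothesis cA2 : forall z, Omega z -> {for z, continuous A2}.
Hypothesis cA2x : forall z, Omega z -> {for z, continuous A2x}.
Hypothesis cA2xx : forall z, Omega z -> {for z, continuous A2xx}.
Hypothesis dA1 : forall z, Omega z -> is_derive z diry A1 (A1y z).
Hypothesis dA2 : forall z, Omega z -> is_derive z dirx A2 (A2x z).
Hypothesis dA2x : forall z, Omega z -> is_derive z dirx A2x (A2xx z).
Hypothesis fl : forall z, Omega z ->
  A2x z - A1y z + (A1 z *m A2 z - A2 z *m A1 z) = 0.

(** On squares this small the one-dimensional estimates hold with absolute
    constants. The bounds are required on the square of double size because the
    solutions along lines use coefficients clamped to the closed square. *)
Definition good_square (c : R * R) (r M : R) : Prop :=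
  [/\ 0 < r, 0 <= M, n%:R * M * (2 * r) <= 2^-1 &
    forall z, ball c (2 * r) z -> [/\ Omega z, `|A1 z| <= M, `|A2 z| <= M,
      `|A2x z| <= M & `|A2xx z| <= M]].

Lemma good_square_exists c : Omega c -> exists r M, good_square c r M.
Proof.
move=> Oc.
have bnd (f : R * R -> 'M[R]_n) : {for c, continuous f} ->
    \forall z \near c, `|f z| <= `|f c| + 1.
  move=> cf; have : \forall z \near c, `|f c - f z| <= 1.
    exact: ((@cvgrPdist_le _ _ _ _ _ _ _).1 cf).
  apply: filterS => z H; rewrite -[f z](subKr (f c)).
  by apply: le_trans (ler_normB _ _) _; rewrite lerD2l.
have b1 := bnd A1 (cA1 Oc); have b2 := bnd A2 (cA2 Oc).
have b3 := bnd _ (cA2x Oc); have b4 := bnd _ (cA2xx Oc).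
have sum4 (x1 x2 x3 x4 : R) : 0 <= x1 -> 0 <= x2 -> 0 <= x3 -> 0 <= x4 ->
    exists2 M, 0 < M & [/\ x1 + 1 <= M, x2 + 1 <= M, x3 + 1 <= M & x4 + 1 <= M].
  by move=> p1 p2 p3 p4; exists (x1 + x2 + x3 + x4 + 1); [lra|split; lra].
have [M M0 [M1 M2 M3 M4]] := sum4 _ _ _ _ (normr_ge0 (A1 c)) (normr_ge0 (A2 c))
  (normr_ge0 (A2x c)) (normr_ge0 (A2xx c)).
have : \forall z \near c, [/\ Omega z, `|A1 z| <= M, `|A2 z| <= M,
      `|A2x z| <= M & `|A2xx z| <= M].
  apply: filterS2 (open_nbhs_nbhs (conj Oo Oc))
    (filterI b1 (filterI b2 (filterI b3 b4))) => z Oz [h1 [h2 [h3 h4]]].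
  split; [exact: Oz|exact: le_trans h1 M1|exact: le_trans h2 M2| |].
    exact: le_trans h3 M3.
  exact: le_trans h4 M4.
move=> /nbhs_ballP[e /= e0 eB].
(* The first bound keeps the double square in the neighbourhood, the second makes
   the coefficients small in comparison with the side. *)
pose r := Num.min (e / 2) (4 * (n%:R * M + 1))^-1.
have nM0 : 0 <= n%:R * M by rewrite mulr_ge0// ltW.
have r0 : 0 < r by rewrite lt_min divr_gt0//= invr_gt0 mulr_gt0// ltr_wpDl.
exists r, M; split=> //; first exact: ltW.
  have H : r <= (4 * (n%:R * M + 1))^-1 by rewrite /r ge_min lexx orbT.
  have P0 : 0 < 4 * (n%:R * M + 1) by rewrite mulr_gt0// ltr_wpDl.
  have H2 : r * (4 * (n%:R * M + 1)) <= 1 by rewrite -ler_pdivlMr// mul1r.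
  have H3 : n%:R * M * (2 * r) = 2^-1 * (r * (4 * (n%:R * M + 1))) - 2 * r by field.
  by rewrite H3; move: H2 r0; generalize (r * (4 * (n%:R * M + 1))) r => x y; lra.
move=> z Bz; apply: eB; apply: le_ball Bz.
have H : r <= e / 2 by rewrite /r ge_min lexx.
by lra.
Qed.

Section Square.
Variables (c : R * R) (r M : R).
Hypothesis gs : good_square c r M.

Lemma square_itv x y : ball c r (x, y) <->
  c.1 - r < x < c.1 + r /\ c.2 - r < y < c.2 + r.
Proof. by rewrite /ball /= /prod_ball /ball /= !ltr_distlC. Qed.

Lemma ball_double z : ball c r z -> ball c (2 * r) z.
Proof. by case: gs => r0 _ _ _; apply: le_ball; lra. Qed.

(** Gronwall's inequality along a horizontal line. It is stated for solutions of
    the horizontal equation on one segment only, since it is applied to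
    differences of solutions. *)
Lemma sol_horizontal_bound (Z : R * R -> 'M[R]_(m, n)) x x' y :
  (forall t, between x x' t -> is_derive (t, y) dirx Z (Z (t, y) *m A1 (t, y))) ->
  ball c r (x, y) -> ball c r (x', y) -> `|Z (x', y)| <= 2 * `|Z (x, y)|.
Proof.
case: gs => r0 M0 small HB HZ /square_itv[Ix Iy] /square_itv[Ix' _].
have := @short_gronwall _ _ _ (fun t => Z (t, y)) (fun t => Z (t, y) *m A1 (t, y)) x x'
  (n%:R * M) 0.
rewrite mulr0 addr0; apply=> //; first by rewrite mulr_ge0.
  rewrite mulrC; apply: le_trans small; apply: ler_wpM2l; first by rewrite mulr_ge0.
  by move: Ix Ix' => /andP[? ?] /andP[? ?]; rewrite ler_norml; apply/andP; split; lra.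
move=> t Bt; split; first exact/is_derive_dirx/HZ.
rewrite addr0; apply: le_trans (mx_norm_mul _ _) _.
have [_ H1 _ _ _] : [/\ Omega (t, y), `|A1 (t, y)| <= M, `|A2 (t, y)| <= M,
      `|A2x (t, y)| <= M & `|A2xx (t, y)| <= M].
  by apply/HB/ball_double/square_itv; split=> //; exact: between_oo Ix Ix' Bt.
by rewrite -mulrA ler_wpM2l// mulrC ler_wpM2r.
Qed.

Lemma sol_vertical_bound (Z : R * R -> 'M[R]_(m, n)) x y y' :
  (forall t, between y y' t -> is_derive (x, t) diry Z (Z (x, t) *m A2 (x, t))) ->
  ball c r (x, y) -> ball c r (x, y') -> `|Z (x, y')| <= 2 * `|Z (x, y)|.
Proof.
case: gs => r0 M0 small HB HZ /square_itv[Ix Iy] /square_itv[_ Iy'].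
have := @short_gronwall _ _ _ (fun t => Z (x, t)) (fun t => Z (x, t) *m A2 (x, t)) y y'
  (n%:R * M) 0.
rewrite mulr0 addr0; apply=> //; first by rewrite mulr_ge0.
  rewrite mulrC; apply: le_trans small; apply: ler_wpM2l; first by rewrite mulr_ge0.
  by move: Iy Iy' => /andP[? ?] /andP[? ?]; rewrite ler_norml; apply/andP; split; lra.
move=> t Bt; split; first exact/is_derive_diry/HZ.
rewrite addr0; apply: le_trans (mx_norm_mul _ _) _.
have [_ _ H1 _ _] : [/\ Omega (x, t), `|A1 (x, t)| <= M, `|A2 (x, t)| <= M,
      `|A2x (x, t)| <= M & `|A2xx (x, t)| <= M].
  by apply/HB/ball_double/square_itv; split=> //; exact: between_oo Iy Iy' Bt.
by rewrite -mulrA ler_wpM2l// mulrC ler_wpM2r.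
Qed.

(** A difference of solutions solves the same system; it is carried horizontally
    and then vertically from [z], where it vanishes, to [w], and each step at most
    doubles its norm. *)
Lemma square_unique r' P Q z w : 0 < r' -> r' <= r ->
  (forall w, ball c r' w -> total_sol P w) ->
  (forall w, ball c r' w -> total_sol Q w) ->
  ball c r' z -> ball c r' w -> P z = Q z -> P w = Q w.
Proof.
move=> r'0 r'r sP sQ; case: z => x y; case: w => x' y' [Bx By] [Bx' By'] PQ.
have sub a b : ball c.1 r' a -> ball c.2 r' b -> ball c r (a, b).
  by move=> Ba Bb; apply: (le_ball r'r); split.
have bE (a b t : R) (d : R) : ball d r' a -> ball d r' b -> between a b t -> ball d r' t.
  rewrite /ball /= !ltr_distlC; exact: between_oo.
have Zx t : between x x' t ->
    is_derive (t, y) dirx (fun w => P w - Q w) ((P (t, y) - Q (t, y)) *m A1 (t, y)).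
  move=> Bt; have Bty : ball c r' (t, y) by split=> //; exact: bE Bx Bx' Bt.
  by rewrite mulmxBl; exact: (is_deriveB (sP _ Bty).1 (sQ _ Bty).1).
have Zy t : between y y' t ->
    is_derive (x', t) diry (fun w => P w - Q w) ((P (x', t) - Q (x', t)) *m A2 (x', t)).
  move=> Bt; have Bty : ball c r' (x', t) by split=> //; exact: bE By By' Bt.
  by rewrite mulmxBl; exact: (is_deriveB (sP _ Bty).2 (sQ _ Bty).2).
have Hx := sol_horizontal_bound Zx (sub _ _ Bx By) (sub _ _ Bx' By).
have Hy := sol_vertical_bound Zy (sub _ _ Bx' By) (sub _ _ Bx' By').
apply/eqP; rewrite -subr_eq0 -normr_eq0 eq_le normr_ge0 andbT.
by move: Hx Hy; rewrite PQ subrr normr0 mulr0 => Hx Hy; lra.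
Qed.

(** Partial derivatives alone do not give continuity; here they are bounded,
    because the solution is bounded along the horizontal and vertical segments
    that lead to a given point, and this gives a Lipschitz estimate. *)
Lemma square_continuous P : (forall w, ball c r w -> total_sol P w) ->
  {for c, continuous P}.
Proof.
case: (gs) => r0 M0 small HB sP.
have Bc : ball c r c by exact: ballxx.
pose L := n%:R * (4 * `|P c| * M); have L0 : 0 <= L by rewrite !mulr_ge0.
have bE (d a b t : R) : ball d r a -> ball d r b -> between a b t -> ball d r t.
  by rewrite /ball /= !ltr_distlC; exact: between_oo.
have lip x y : ball c r (x, y) -> `|P (x, y) - P c| <= L * (`|x - c.1| + `|y - c.2|).
  move=> [/= Bx By].
  have inB a b : ball c.1 r a -> ball c.2 r b -> ball c r (a, b) by [].
  have B1 : ball c.1 r c.1 by exact: ballxx.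
  have B2 : ball c.2 r c.2 by exact: ballxx.
  have PcE : P (c.1, c.2) = P c by rewrite -surjective_pairing.
  have bx t : between c.1 x t -> `|P (t, c.2)| <= 2 * `|P c|.
    move=> Bt; have Bct := bE _ _ _ _ B1 Bx Bt.
    rewrite -PcE; apply: sol_horizontal_bound; [|exact: inB|exact: inB].
    by move=> s Bs; apply: (sP _ _).1; apply: inB => //; exact: bE B1 Bct Bs.
  have bxy t : between c.2 y t -> `|P (x, t)| <= 4 * `|P c|.
    move=> Bt; have Bct := bE _ _ _ _ B2 By Bt.
    have H : `|P (x, t)| <= 2 * `|P (x, c.2)|.
      apply: sol_vertical_bound; [|exact: inB|exact: inB].
      by move=> s Bs; apply: (sP _ _).2; apply: inB => //; exact: bE B2 Bct Bs.
    by apply: le_trans H _; have := bx x (betweenr _ _); lra.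
  have stepx : `|P (x, c.2) - P (c.1, c.2)| <= L * `|x - c.1|.
    have := @mean_value_mx _ _ _ (fun t => P (t, c.2)) (fun t => P (t, c.2) *m A1 (t, c.2)) c.1 x 0 L L0.
    rewrite scaler0 subr0; apply=> t Bt; have Bct := inB _ _ (bE _ _ _ _ B1 Bx Bt) B2.
    split; first by apply/is_derive_dirx; exact: (sP _ Bct).1.
    rewrite subr0; apply: le_trans (mx_norm_mul _ _) _; rewrite ler_wpM2l//.
    have [_ b1 _ _ _] := HB _ (ball_double Bct).
    by apply: ler_pM => //; have := bx t Bt; have := normr_ge0 (P c); lra.
  have stepy : `|P (x, y) - P (x, c.2)| <= L * `|y - c.2|.
    have := @mean_value_mx _ _ _ (fun t => P (x, t)) (fun t => P (x, t) *m A2 (x, t)) c.2 y 0 L L0.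
    rewrite scaler0 subr0; apply=> t Bt; have Bct := inB _ _ Bx (bE _ _ _ _ B2 By Bt).
    split; first by apply/is_derive_diry; exact: (sP _ Bct).2.
    rewrite subr0; apply: le_trans (mx_norm_mul _ _) _; rewrite ler_wpM2l//.
    have [_ _ b2 _ _] := HB _ (ball_double Bct).
    by apply: ler_pM => //; exact: bxy.
  rewrite -PcE; have -> : P (x, y) - P (c.1, c.2) = (P (x, y) - P (x, c.2)) + (P (x, c.2) - P (c.1, c.2)).
    by rewrite addrA subrK.
  by apply: le_trans (ler_normD _ _) _; rewrite mulrDr addrC lerD.
apply/cvgrPdist_le => e e0.
have e1 : 0 < Num.min r (e / (2 * L + 1)) by rewrite lt_min r0 divr_gt0// ltr_wpDl// mulr_ge0.
apply: filterS (nbhsx_ballx c _ e1) => -[x y] [/= Bx By].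
have Bxy : ball c r (x, y).
  by split; [move: Bx|move: By]; apply: le_ball; rewrite ge_min lexx.
rewrite distrC; apply: le_trans (lip _ _ Bxy) _.
have hx : `|x - c.1| <= e / (2 * L + 1).
  by move: Bx; rewrite /ball /= distrC lt_min => /andP[_ /ltW].
have hy : `|y - c.2| <= e / (2 * L + 1).
  by move: By; rewrite /ball /= distrC lt_min => /andP[_ /ltW].
have L1 : 0 < 2 * L + 1 by rewrite ltr_wpDl// mulr_ge0.
apply: (@le_trans _ _ (L * (e / (2 * L + 1) + e / (2 * L + 1)))).
  by rewrite ler_wpM2l// lerD.
have -> : L * (e / (2 * L + 1) + e / (2 * L + 1)) = (2 * L) * e / (2 * L + 1) by ring.
by rewrite ler_pdivrMr// mulrDr mulr1 [e * (2 * L)]mulrC lerDl ltW.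
Qed.

(** The solution is obtained by integrating along the horizontal line through
    the base point and then along all vertical lines.  Its horizontal increment
    differs from the one prescribed by the system by an error which satisfies the
    vertical equation up to terms of second order, precisely because the form
    is flat; so the error stays negligible on every vertical line. *)
Lemma square_sol z (g : 'M[R]_(m, n)) : ball c r z ->
  exists2 P, (forall w, ball c r w -> total_sol P w) & P z = g.
Proof.
case: z => x1 y1 /[dup] Bz /square_itv[Ix1 Iy1]; case: (gs) => r0 M0 small HB.
have r2 : c.1 + r - (c.1 - r) = 2 * r by ring.
have r2' : c.2 + r - (c.2 - r) = 2 * r by ring.
have HB' x y : c.1 - r <= x <= c.1 + r -> c.2 - r <= y <= c.2 + r ->
    [/\ Omega (x, y), `|A1 (x, y)| <= M, `|A2 (x, y)| <= M,
      `|A2x (x, y)| <= M & `|A2xx (x, y)| <= M].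
  move=> /andP[? ?] /andP[? ?]; apply: HB.
  by rewrite /ball /= /prod_ball /ball /= !ltr_distlC; split; apply/andP; split; lra.
have cA1x x y : Omega (x, y) -> {for x, continuous (fun t => A1 (t, y))}.
  move=> Oxy; apply: (@cvg_comp _ _ _ (fun t => (t, y)) A1 _ _ _ _ (cA1 Oxy)).
  exact: slicex_continuous.
have cA2y x y : Omega (x, y) -> {for y, continuous (fun t => A2 (x, t))}.
  move=> Oxy; apply: (@cvg_comp _ _ _ (fun t => (x, t)) A2 _ _ _ _ (cA2 Oxy)).
  exact: slicey_continuous.
have lr1 : c.1 - r <= c.1 + r by lra.
have lr2 : c.2 - r <= c.2 + r by lra.
have cl1 t := @clamp_itv _ _ _ t lr1; have cl2 t := @clamp_itv _ _ _ t lr2.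
have [H Hx1 HH] : exists2 H : R -> 'M[R]_(m, n), H x1 = g &
    forall t, c.1 - r < t < c.1 + r -> is_derive t 1 H (H t *m A1 (t, y1)).
  have Iy1' : c.2 - r <= y1 <= c.2 + r by case/andP: Iy1 => *; rewrite !ltW.
  pose B t := A1 (clamp (c.1 - r) (c.1 + r) t, y1).
  have [||||W Wg HW] := @linear_ode _ m n B M (c.1 - r) (c.1 + r) x1 g.
  - move=> t; have [Ot _ _ _ _] := HB' _ _ (cl1 t) Iy1'.
    apply: (@cvg_comp _ _ _ (clamp (c.1 - r) (c.1 + r)) _ _ _ _ _ (cA1x _ _ Ot)).
    exact: clamp_continuous.
  - by move=> t; have [] := HB' _ _ (cl1 t) Iy1'.
  - exact: Ix1.
  - by rewrite r2.
  exists W => // t It; have := HW t It; rewrite /B clamp_id//.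
  by case/andP: It => *; rewrite !ltW.
have exV x : exists W : R -> 'M[R]_(m, n), c.1 - r < x < c.1 + r -> W y1 = H x /\
    forall t, c.2 - r < t < c.2 + r -> is_derive t 1 W (W t *m A2 (x, t)).
  have [Ix|] := boolP (c.1 - r < x < c.1 + r); last by exists (fun=> 0).
  have Ix' : c.1 - r <= x <= c.1 + r by case/andP: Ix => *; rewrite !ltW.
  pose B t := A2 (x, clamp (c.2 - r) (c.2 + r) t).
  have [||||W Wg HW] := @linear_ode _ m n B M (c.2 - r) (c.2 + r) y1 (H x).
  - move=> t; have [Ot _ _ _ _] := HB' _ _ Ix' (cl2 t).
    apply: (@cvg_comp _ _ _ (clamp (c.2 - r) (c.2 + r)) _ _ _ _ _ (cA2y _ _ Ot)).
    exact: clamp_continuous.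
  - by move=> t; have [] := HB' _ _ Ix' (cl2 t).
  - exact: Iy1.
  - by rewrite r2'.
  exists W => _; split=> // t It; have := HW t It; rewrite /B clamp_id//.
  by case/andP: It => *; rewrite !ltW.
pose P (z : R * R) := sval (cid (exV z.1)) z.2.
have Py1 x : c.1 - r < x < c.1 + r -> P (x, y1) = H x.
  by move=> Ix; have [] := svalP (cid (exV x)) Ix.
have dPy x y : c.1 - r < x < c.1 + r -> c.2 - r < y < c.2 + r ->
    is_derive (x, y) diry P (P (x, y) *m A2 (x, y)).
  move=> Ix Iy; apply/is_derive_diry.
  by have [_ /(_ y Iy)] := svalP (cid (exV x)) Ix.
exists P; last by rewrite Py1.
move=> [x y] /[dup] Bxy /square_itv[Ix Iy]; split; last exact: dPy.
apply/is_derive_dirx.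
have inB a b : c.1 - r < a < c.1 + r -> c.2 - r < b < c.2 + r -> ball c r (a, b).
  by move=> ? ?; apply/square_itv.
have itvy t : between y1 y t -> c.2 - r < t < c.2 + r by apply: between_oo.
have Pbound a t : c.1 - r < a < c.1 + r -> between y1 y t -> `|P (a, t)| <= 2 * `|H a|.
  move=> Ia Bt; rewrite -Py1//; apply: sol_vertical_bound.
  - move=> s Bs; apply: dPy => //.
    by apply: itvy; exact: between_trans Bt Bs.
  - exact: inB.
  - by apply: inB => //; exact: itvy.
pose D := n%:R * (2 * `|H x| * (M + n%:R * (M * M))).
have D0 : 0 <= D by rewrite !mulr_ge0// addr_ge0 ?mulr_ge0.
have key h : c.1 - r < x + h < c.1 + r ->
    `|P (x + h, y) - P (x, y) - h *: (P (x, y) *m A1 (x, y))| <=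
    2 * (`|H (x + h) - H x - h *: (H x *m A1 (x, y1))| + `|y - y1| * (D * (`|h| * `|h|))).
  move=> Ih.
  pose E t := P (x + h, t) - P (x, t) - h *: (P (x, t) *m A1 (x, t)).
  (* [E] measures the failure of the horizontal equation for the step [h] on the
     vertical line of height [t]; by flatness its derivative is [E A2] plus the
     term with [Br], which is of second order in [h]. *)
  pose Br t := (A2 (x + h, t) - A2 (x, t) - h *: A2x (x, t)) +
    h *: (A1 (x, t) *m (A2 (x + h, t) - A2 (x, t))).
  have dE t : between y1 y t ->
      is_derive t 1 E (E t *m A2 (x + h, t) + P (x, t) *m Br t).
    move=> Bt; have It := itvy t Bt.
    have Oxt : Omega (x, t) by have [] := HB _ (ball_double (inB _ _ Ix It)).
    have d1 : is_derive t 1 (fun t => P (x + h, t)) (P (x + h, t) *m A2 (x + h, t)).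
      exact/is_derive_diry/dPy.
    have d2 : is_derive t 1 (fun t => P (x, t)) (P (x, t) *m A2 (x, t)).
      exact/is_derive_diry/dPy.
    have d3 : is_derive t 1 (fun t => A1 (x, t)) (A1y (x, t)).
      exact/is_derive_diry/dA1.
    have d23 := is_derive_mulmx d2 d3.
    have d4 := is_deriveB (is_deriveB d1 d2) (@is_deriveZ _ _ _ _ h _ _ _ d23).
    apply: is_derive_eq d4 _.
    have -> : A1y (x, t) = A2x (x, t) +
        (A1 (x, t) *m A2 (x, t) - A2 (x, t) *m A1 (x, t)).
      apply/eqP; rewrite eq_sym -subr_eq0 -(fl Oxt); apply/eqP.
      by rewrite addrAC.
    rewrite /E /Br; move: (P (x + h, t)) (P (x, t)) (A2 (x + h, t)) (A1 (x, t))
      (A2 (x, t)) (A2x (x, t)) => p q a2 a1 b2 d.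
    rewrite !(mulmxBl, mulmxBr, mulmxDl, mulmxDr, mulmxN, mulNmx, =^~ scalemxAl, =^~ scalemxAr) !mulmxA.
    move: (p *m a2) (q *m b2) (q *m b2 *m a1) (q *m a1 *m b2) (q *m d) (q *m a2)
      (q *m a1 *m a2) => k1 k2 k3 k4 k5 k6 k7.
    apply/matrixP => i j; rewrite !mxE; ring.
  have bE t : between y1 y t ->
      `|E t *m A2 (x + h, t) + P (x, t) *m Br t| <= n%:R * M * `|E t| + D * (`|h| * `|h|).
    move=> Bt; have It := itvy t Bt.
    have [_ bA1 _ _ _] := HB _ (ball_double (inB _ _ Ix It)).
    have [_ _ bA2 _ _] := HB _ (ball_double (inB _ _ Ih It)).
    apply: le_trans (ler_normD _ _) _; apply: lerD.
      apply: le_trans (mx_norm_mul _ _) _.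
      by rewrite -mulrA ler_wpM2l// mulrC ler_wpM2r.
    have seg s : between x (x + h) s -> c.1 - r < s < c.1 + r by apply: between_oo.
    have inc1 s : between x (x + h) s -> `|A2 (s, t) - A2 (x, t)| <= M * `|h|.
      move=> Bs; have := @mean_value_mx _ _ _ (fun s => A2 (s, t)) (fun s => A2x (s, t)) x s 0 M M0.
      rewrite scaler0 subr0 => MV; apply: le_trans (MV _) _.
        move=> u Bu; have Iu := seg _ (between_trans Bs Bu).
        have [Ou _ _ b _] := HB _ (ball_double (inB _ _ Iu It)).
        rewrite subr0; split=> //.
        exact/is_derive_dirx/dA2.
      by rewrite ler_wpM2l//; have := between_norm Bs; rewrite [x + h]addrC addrK.
    have inc2 s : between x (x + h) s -> `|A2x (s, t) - A2x (x, t)| <= M * `|h|.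
      move=> Bs; have := @mean_value_mx _ _ _ (fun s => A2x (s, t)) (fun s => A2xx (s, t)) x s 0 M M0.
      rewrite scaler0 subr0 => MV; apply: le_trans (MV _) _.
        move=> u Bu; have Iu := seg _ (between_trans Bs Bu).
        have [Ou _ _ _ b] := HB _ (ball_double (inB _ _ Iu It)).
        rewrite subr0; split=> //.
        exact/is_derive_dirx/dA2x.
      by rewrite ler_wpM2l//; have := between_norm Bs; rewrite [x + h]addrC addrK.
    have Mh0 : 0 <= M * `|h| by rewrite mulr_ge0.
    have inc3 : `|A2 (x + h, t) - A2 (x, t) - h *: A2x (x, t)| <= M * `|h| * `|h|.
      have := @mean_value_mx _ _ _ (fun s => A2 (s, t)) (fun s => A2x (s, t)) x (x + h)
        (A2x (x, t)) _ Mh0.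
      have -> : x + h - x = h by rewrite addrC addKr.
      apply=> u Bu; have [Ou _ _ b _] := HB _ (ball_double (inB _ _ (seg _ Bu) It)).
      split; last exact: inc2.
      exact/is_derive_dirx/dA2.
    apply: le_trans (mx_norm_mul _ _) _; rewrite /D -2!mulrA ler_wpM2l//.
    rewrite [leRHS](_ : _ = (2 * `|H x|) * ((M + n%:R * (M * M)) * (`|h| * `|h|))); last by ring.
    apply: ler_pM => //; first exact: Pbound.
    apply: le_trans (ler_normD _ _) _; rewrite mulrDl; apply: lerD.
      by rewrite mulrA.
    rewrite normrZ; apply: (@le_trans _ _ (`|h| * (n%:R * (M * (M * `|h|))))).
      rewrite ler_wpM2l//; apply: le_trans (mx_norm_mul _ _) _.
      by rewrite ler_wpM2l// ler_pM//; apply: inc1; exact: betweenr.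
    by rewrite le_eqVlt; apply/orP; left; apply/eqP; ring.
  have := @short_gronwall _ _ _ E (fun t => E t *m A2 (x + h, t) + P (x, t) *m Br t) y1 y
    (n%:R * M) (D * (`|h| * `|h|)).
  have -> : E y1 = H (x + h) - H x - h *: (H x *m A1 (x, y1)) by rewrite /E !Py1.
  apply.
  - by rewrite mulr_ge0.
  - by rewrite mulr_ge0// mulr_ge0.
  - rewrite mulrC; apply: le_trans small; apply: ler_wpM2l; first by rewrite mulr_ge0.
    by move: Iy Iy1 => /andP[? ?] /andP[? ?]; rewrite ler_norml; apply/andP; split; lra.
  - by move=> t Bt; split; [exact: dE|exact: bE].
apply: is_derive_approx => e e0.
have e4 : 0 < e / 4 by rewrite divr_gt0.
have nH := is_derive_near_bound (HH x Ix) e4.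
pose K := `|y - y1| * D; have K0 : 0 <= K by rewrite mulr_ge0.
have nK : \forall s \near x, `|s - x| <= e / 4 / (K + 1).
  near=> s; rewrite distrC; near: s.
  apply: (@cvgr_dist_le _ _ _ (nbhs x) _ id x (@cvg_id _ _)).
  by rewrite divr_gt0// ltr_wpDl.
near=> s.
have Is : c.1 - r < s < c.1 + r.
  apply/andP; split; near: s; case/andP: Ix => ? ?; [exact: lt_nbhsr|exact: lt_nbhsl].
have xs : x + (s - x) = s by rewrite addrC subrK.
have := key (s - x); rewrite xs => /(_ Is) H1; apply: le_trans H1 _.
have H2 : `|H s - H x - (s - x) *: (H x *m A1 (x, y1))| <= e / 4 * `|s - x| by near: s.
have H3 : `|s - x| <= e / 4 / (K + 1) by near: s.
have H4 : K * `|s - x| <= e / 4.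
  apply: (@le_trans _ _ ((K + 1) * `|s - x|)); first by rewrite ler_wpM2r// lerDl.
  by rewrite mulrC -ler_pdivlMr// ltr_wpDl.
have H5 : K * `|s - x| * `|s - x| <= e / 4 * `|s - x| by rewrite ler_wpM2r.
have -> : `|y - y1| * (D * (`|s - x| * `|s - x|)) = K * `|s - x| * `|s - x| by rewrite /K; ring.
have -> : e * `|s - x| = 2 * (e / 4 * `|s - x| + e / 4 * `|s - x|) by field.
by rewrite ler_wpM2l// lerD.
Unshelve. all: by end_near. Qed.

End Square.

Lemma total_sol_local_system : local_system Omega total_sol.
Proof.
move=> c Oc; have [r [M gs]] := good_square_exists Oc.
have [r0 _ _ HB] := gs; exists r => //; split.
- by move=> z /(ball_double gs) /HB[].
- by move=> z g Bz; eapply square_sol; eassumption.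
- by move=> r' P Q z w; eapply square_unique; eassumption.
Qed.

Lemma total_sol_continuous P c : (forall z, Omega z -> total_sol P z) -> Omega c ->
  {for c, continuous P}.
Proof.
move=> sP Oc; have [r [M gs]] := good_square_exists Oc.
have [_ _ _ HB] := gs; apply: (square_continuous gs) => w /(ball_double gs) /HB[Ow _ _ _ _].
exact: sP.
Qed.

End LocalFrobenius.

(** * Smooth functions on the plane *)

Section SmoothCalculus.
Context {R : realType}.
Variable (Omega : set (R * R)).
Hypothesis Oo : open Omega.

Lemma near_open (T : Type) (f g : R * R -> T) z : (forall w, Omega w -> f w = g w) ->
  Omega z -> \forall w \near z, f w = g w.
Proof. by move=> fg Oz; apply: filterS fg _; exact: open_nbhs_nbhs. Qed.

Lemma Ck_ext (V : normedModType R) k (f g : R * R -> V) :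
  (forall z, Omega z -> f z = g z) -> Ck Omega k f -> Ck Omega k g.
Proof.
elim: k f g => [|k IH] f g fg /= [cf].
  move=> _; split=> // z Oz; rewrite /prop_for /continuous_at -(fg _ Oz).
  apply: cvg_trans (cf z Oz); apply: near_eq_cvg; exact: near_open.
move=> [df Cx Cy].
have cg z : Omega z -> {for z, continuous g}.
  move=> Oz; rewrite /prop_for /continuous_at -(fg _ Oz).
  apply: cvg_trans (cf z Oz); apply: near_eq_cvg; exact: near_open.
split=> //; split.
- move=> z Oz; have [d1 d2] := df z Oz.
  by split; [apply: near_eq_derivable d1|apply: near_eq_derivable d2]; exact: near_open.
- by apply: IH Cx => z Oz; apply: near_eq_derive; exact: near_open.
- by apply: IH Cy => z Oz; apply: near_eq_derive; exact: near_open.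
Qed.

Lemma Ck_continuous (V : normedModType R) k (f : R * R -> V) z :
  Ck Omega k f -> Omega z -> {for z, continuous f}.
Proof. by case: k => [|k] [cf _]; exact: cf. Qed.

Lemma Ck_intro (V : normedModType R) k (f fx fy : R * R -> V) :
  (forall z, Omega z -> {for z, continuous f}) ->
  (forall z, Omega z -> is_derive z dirx f (fx z) /\ is_derive z diry f (fy z)) ->
  Ck Omega k fx -> Ck Omega k fy -> Ck Omega k.+1 f.
Proof.
move=> cf df Cx Cy; split=> //; split.
- by move=> z /df[[? _] [? _]].
- by apply: Ck_ext Cx => z /df[[_ ->] _].
- by apply: Ck_ext Cy => z /df[_ [_ ->]].
Qed.

(** Derivatives are handled as functions satisfying [is_derive] on the open set,
    rather than through the total derivation operator, whose values outside are
    irrelevant. *)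
Lemma Ck_elim (V : normedModType R) k (f : R * R -> V) : Ck Omega k.+1 f ->
  exists fx fy : R * R -> V,
   [/\ forall z, Omega z -> is_derive z dirx f (fx z) /\ is_derive z diry f (fy z),
       Ck Omega k fx & Ck Omega k fy].
Proof.
move=> [cf [df Cx Cy]]; exists (fun z => 'D_dirx f z), (fun z => 'D_diry f z).
by split=> // z /df[? ?]; split; exact: derivableP.
Qed.

Lemma Ck_pred (V : normedModType R) k (f : R * R -> V) : Ck Omega k.+1 f -> Ck Omega k f.
Proof.
elim: k f => [|k IH] f H; first by split=> // z; exact: Ck_continuous H.
have [fx [fy [df Cx Cy]]] := Ck_elim H.
by apply: Ck_intro df (IH _ Cx) (IH _ Cy) => z; exact: Ck_continuous H.
Qed.

Lemma smooth_intro (V : normedModType R) (f fx fy : R * R -> V) :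
  (forall z, Omega z -> {for z, continuous f}) ->
  (forall z, Omega z -> is_derive z dirx f (fx z) /\ is_derive z diry f (fy z)) ->
  smooth Omega fx -> smooth Omega fy -> smooth Omega f.
Proof.
move=> cf df sx sy [|k]; first by split.
exact: Ck_intro cf df (sx k) (sy k).
Qed.

Lemma smooth_elim (V : normedModType R) (f : R * R -> V) : smooth Omega f ->
  exists fx fy : R * R -> V,
   [/\ forall z, Omega z -> is_derive z dirx f (fx z) /\ is_derive z diry f (fy z),
       smooth Omega fx & smooth Omega fy].
Proof.
move=> sf; exists (fun z => 'D_dirx f z), (fun z => 'D_diry f z); split.
- by have [_ [df _ _]] := sf 1%N => z /df[? ?]; split; exact: derivableP.
- by move=> k; have [_ [_ Cx _]] := sf k.+1.
- by move=> k; have [_ [_ _ Cy]] := sf k.+1.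
Qed.

Lemma smooth_continuous (V : normedModType R) (f : R * R -> V) z :
  smooth Omega f -> Omega z -> {for z, continuous f}.
Proof. by move=> /(_ 0%N); exact: Ck_continuous. Qed.

Lemma smooth_ext (V : normedModType R) (f g : R * R -> V) :
  (forall z, Omega z -> f z = g z) -> smooth Omega f -> smooth Omega g.
Proof. by move=> fg sf k; apply: Ck_ext fg _. Qed.

Lemma smooth_cst (V : normedModType R) (a : V) : smooth Omega (fun=> a).
Proof.
move=> k; elim: k a => [|k IH] a; first by split=> // z _; exact: cvg_cst.
apply: (@Ck_intro _ _ _ (fun=> 0) (fun=> 0)) => // z _; first exact: cvg_cst.
by split; exact: is_derive_cst.
Qed.

Lemma CkD (V : normedModType R) k (f g : R * R -> V) :
  Ck Omega k f -> Ck Omega k g -> Ck Omega k (fun z => f z + g z).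
Proof.
elim: k f g => [|k IH] f g Cf Cg.
  by split=> // z Oz; apply: cvgD; [exact: Ck_continuous Cf Oz|exact: Ck_continuous Cg Oz].
have [fx [fy [df Cfx Cfy]]] := Ck_elim Cf; have [gx [gy [dg Cgx Cgy]]] := Ck_elim Cg.
apply: (@Ck_intro _ _ _ (fun z => fx z + gx z) (fun z => fy z + gy z)).
- by move=> z Oz; apply: cvgD; [exact: Ck_continuous Cf Oz|exact: Ck_continuous Cg Oz].
- move=> z Oz; have [? ?] := df z Oz; have [? ?] := dg z Oz.
  by split; exact: is_deriveD.
- exact: IH.
- exact: IH.
Qed.

Lemma smoothD (V : normedModType R) (f g : R * R -> V) :
  smooth Omega f -> smooth Omega g -> smooth Omega (fun z => f z + g z).
Proof. by move=> sf sg k; exact: CkD. Qed.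

Lemma is_derive_lin (V W : normedModType R) (phi : V -> W) (f : R * R -> V) z v df :
  linear phi -> continuous phi -> is_derive z v f df ->
  is_derive z v (fun w => phi (f w)) (phi df).
Proof.
move=> lphi cphi [fd <-].
have phiZ a u : phi (a *: u) = a *: phi u.
  have phi0 : phi 0 = 0.
    by have := lphi 1 0 0; rewrite scaler0 addr0 scale1r => /esym/eqP; rewrite -subr_eq0 addrK => /eqP.
  by rewrite -[a *: u]addr0 lphi phi0 addr0.
have phiB u w : phi (u - w) = phi u - phi w.
  by rewrite -scaleN1r addrC lphi scaleN1r addrC.
have L : (fun h : R => h^-1 *: (((fun w => phi (f w)) \o shift z) (h *: v) - phi (f z))) @ 0^'
    --> phi ('D_v f z).
  have -> : (fun h : R => h^-1 *: (((fun w => phi (f w)) \o shift z) (h *: v) - phi (f z))) =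
      phi \o (fun h : R => h^-1 *: ((f \o shift z) (h *: v) - f z)).
    by apply/funext => h /=; rewrite phiZ phiB.
  apply: (@cvg_comp _ _ _ _ phi _ _ _ _ (cphi _)); exact: fd.
by split; [apply/cvg_ex; exists (phi ('D_v f z))|exact: cvg_lim].
Qed.

Lemma smooth_lin (V W : normedModType R) (phi : V -> W) (f : R * R -> V) :
  linear phi -> continuous phi -> smooth Omega f -> smooth Omega (fun z => phi (f z)).
Proof.
move=> lphi cphi sf k; move: (sf k); clear sf.
elim: k f => [|k IH] f Cf.
  by split=> // z Oz; apply: (@cvg_comp _ _ _ f phi _ _ _ (Ck_continuous Cf Oz)); exact: cphi.
have [fx [fy [df Cfx Cfy]]] := Ck_elim Cf.
apply: (@Ck_intro _ _ _ (fun z => phi (fx z)) (fun z => phi (fy z))); try exact: IH.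
  by move=> z Oz; apply: (@cvg_comp _ _ _ f phi _ _ _ (Ck_continuous Cf Oz)); exact: cphi.
by move=> z Oz; have [? ?] := df z Oz; split; exact: is_derive_lin.
Qed.

(** A linear map on matrices is a finite sum of multiples of coordinates. *)
Lemma linear_mx_continuous m n (W : normedModType R) (phi : 'M[R]_(m, n) -> W) :
  linear phi -> continuous phi.
Proof.
move=> lphi; pose Phi : {linear 'M[R]_(m, n) -> W} :=
  HB.pack phi (GRing.isLinear.Build _ _ _ _ phi lphi).
have E : phi = fun M => \sum_i \sum_j M i j *: phi (delta_mx i j).
  apply/funext => M; transitivity (Phi M) => //.
  rewrite {1}[M]matrix_sum_delta linear_sum; apply: eq_bigr => i _.
  by rewrite linear_sum; apply: eq_bigr => j _; rewrite linearZ.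
have csum (I : finType) (F : I -> 'M[R]_(m, n) -> W) M :
    (forall i, {for M, continuous (F i)}) -> {for M, continuous (fun M => \sum_i F i M)}.
  move=> cF; elim: (index_enum I) => [|i r IH].
    have -> : (fun M => \sum_(i <- [::]) F i M) = (fun=> 0).
      by apply/funext => N; rewrite big_nil.
    exact: (@cst_continuous _ _ (0 : W)).
  have -> : (fun M => \sum_(k <- i :: r) F k M) = (fun M => F i M + \sum_(k <- r) F k M).
    by apply/funext => N; rewrite big_cons.
  exact: (@cvgD _ _ _ _ _ (F i) (fun M => \sum_(k <- r) F k M) _ _ (cF i) IH).
suff cE : continuous (fun M : 'M[R]_(m, n) => \sum_i \sum_j M i j *: phi (delta_mx i j)) by rewrite E.
move=> M; apply: (csum _ (fun i (M : 'M[R]_(m, n)) => \sum_j M i j *: phi (delta_mx i j))) => i.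
apply: (csum _ (fun j (M : 'M[R]_(m, n)) => M i j *: phi (delta_mx i j))) => j.
exact: (@cvgZr_tmp _ _ _ _ _ (fun N : 'M[R]_(m, n) => N i j) (M i j) (phi (delta_mx i j))
  (@coord_continuous _ _ _ i j M)).
Qed.

Lemma smooth_mx_lin m n (W : normedModType R) (phi : 'M[R]_(m, n) -> W) f :
  linear phi -> smooth Omega f -> smooth Omega (fun z => phi (f z)).
Proof. by move=> lphi; apply: smooth_lin => //; exact: linear_mx_continuous. Qed.

(** The Leibniz rule for one derivative gives the one for all orders by induction,
    whatever the product. *)
Lemma Ck_bilin (U V W : normedModType R) (B : U -> V -> W) k
    (f : R * R -> U) (g : R * R -> V) :
  (forall (f : R * R -> U) (g : R * R -> V) z v df dg, is_derive z v f df ->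
    is_derive z v g dg ->
    is_derive z v (fun w => B (f w) (g w)) (B df (g z) + B (f z) dg)) ->
  (forall (f : R * R -> U) (g : R * R -> V) z, {for z, continuous f} ->
    {for z, continuous g} -> {for z, continuous (fun w => B (f w) (g w))}) ->
  Ck Omega k f -> Ck Omega k g -> Ck Omega k (fun z => B (f z) (g z)).
Proof.
move=> dB cB; elim: k f g => [|k IH] f g Cf Cg.
  by split=> // z Oz; apply: cB; [exact: Ck_continuous Cf Oz|exact: Ck_continuous Cg Oz].
have [fx [fy [df Cfx Cfy]]] := Ck_elim Cf; have [gx [gy [dg Cgx Cgy]]] := Ck_elim Cg.
apply: (@Ck_intro _ _ _ (fun z => B (fx z) (g z) + B (f z) (gx z))
  (fun z => B (fy z) (g z) + B (f z) (gy z))).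
- by move=> z Oz; apply: cB; [exact: Ck_continuous Cf Oz|exact: Ck_continuous Cg Oz].
- move=> z Oz; have [? ?] := df z Oz; have [? ?] := dg z Oz.
  by split; exact: dB.
- by apply: CkD; apply: IH => //; exact: Ck_pred.
- by apply: CkD; apply: IH => //; exact: Ck_pred.
Qed.

Lemma Ck_mulmx k m n p (f : R * R -> 'M[R]_(m, n)) (g : R * R -> 'M[R]_(n, p)) :
  Ck Omega k f -> Ck Omega k g -> Ck Omega k (fun z => f z *m g z).
Proof.
apply: Ck_bilin; first by move=> *; exact: is_derive_mulmx.
by move=> *; exact: continuous_mulmx.
Qed.

Lemma CkM k (f g : R * R -> R) :
  Ck Omega k f -> Ck Omega k g -> Ck Omega k (fun z => f z * g z).
Proof.
apply: (@Ck_bilin _ _ _ (fun x y : R => x * y)) => [{}f {}g z v df dg Hf Hg|{}f {}g z cf cg].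
  have H := is_deriveM Hf Hg; apply: is_derive_eq H _.
  by rewrite addrC /GRing.scale /= [df * _]mulrC.
exact: cvgM.
Qed.

Lemma smooth_mulmx m n p (f : R * R -> 'M[R]_(m, n)) (g : R * R -> 'M[R]_(n, p)) :
  smooth Omega f -> smooth Omega g -> smooth Omega (fun z => f z *m g z).
Proof. by move=> sf sg k; exact: Ck_mulmx. Qed.

Lemma smooth_scalel m n (f : R * R -> R) (M : 'M[R]_(m, n)) :
  smooth Omega f -> smooth Omega (fun z => f z *: M).
Proof.
apply: (@smooth_lin _ _ (fun x : R => x *: M)).
  by move=> a x y; rewrite scalerDl -scalerA.
by move=> x; apply: cvgZr_tmp; exact: cvg_id.
Qed.

Lemma smooth_scale m n (f : R * R -> R) (M : R * R -> 'M[R]_(m, n)) :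
  smooth Omega f -> smooth Omega M -> smooth Omega (fun z => f z *: M z).
Proof.
move=> sf sM; apply: (@smooth_ext _ (fun z => (f z *: 1%:M) *m M z)).
  by move=> z _; rewrite -scalemxAl mul1mx.
by apply: smooth_mulmx => //; exact: smooth_scalel.
Qed.

Lemma smooth_pair (V W : normedModType R) (f : R * R -> V) (g : R * R -> W) :
  smooth Omega f -> smooth Omega g -> smooth Omega (fun z => (f z, g z)).
Proof.
move=> sf sg.
have -> : (fun z => (f z, g z)) = (fun z => (f z, 0) + (0, g z)).
  by apply/funext => z; rewrite /GRing.add /= /add_pair /= addr0 add0r.
apply: smoothD.
  apply: (@smooth_lin _ _ (fun v : V => (v, 0 : W))) sf.
    by move=> a u v; congr (_, _); rewrite /= scaler0 addr0.
  move=> v U /nbhs_ballP[e /= e0 eU]; apply/nbhs_ballP; exists e => //= t Bt.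
  by apply: eU; split=> //; exact: ballxx.
apply: (@smooth_lin _ _ (fun v : W => (0 : V, v))) sg.
  by move=> a u v; congr (_, _); rewrite /= scaler0 addr0.
move=> v U /nbhs_ballP[e /= e0 eU]; apply/nbhs_ballP; exists e => //= t Bt.
by apply: eU; split=> //; exact: ballxx.
Qed.

Lemma smooth_fst (V W : normedModType R) (f : R * R -> V * W) :
  smooth Omega f -> smooth Omega (fun z => (f z).1).
Proof.
apply: (@smooth_lin _ _ (fun u : V * W => u.1)) => //; move=> u; exact: cvg_fst.
Qed.

Lemma smooth_snd (V W : normedModType R) (f : R * R -> V * W) :
  smooth Omega f -> smooth Omega (fun z => (f z).2).
Proof.
apply: (@smooth_lin _ _ (fun u : V * W => u.2)) => //; move=> u; exact: cvg_snd.
Qed.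

Lemma is_derive_chain (phi : R -> R) (f : R * R -> R) z v l df :
  is_derive (f z) 1 phi l -> is_derive z v f df ->
  (v = dirx \/ v = diry) -> is_derive z v (fun w => phi (f w)) (l * df).
Proof.
case: z => x y Hphi Hf [E|E]; rewrite E in Hf *.
  apply/is_derive_dirx; apply: (@is_derive1_comp _ phi (fun t => f (t, y))) => //.
  exact/is_derive_dirx.
apply/is_derive_diry; apply: (@is_derive1_comp _ phi (fun t => f (x, t))) => //.
exact/is_derive_diry.
Qed.

(** The family [phi] consists of the successive derivatives of [phi 0]. *)
Lemma smooth_chain (phi : nat -> R -> R) (f : R * R -> R) i :
  (forall i z, Omega z -> is_derive (f z) 1 (phi i) (phi i.+1 (f z))) ->
  smooth Omega f -> smooth Omega (fun z => phi i (f z)).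
Proof.
move=> dphi sf; have cphi j z : Omega z -> {for z, continuous (fun z => phi j (f z))}.
  move=> Oz; apply: (@cvg_comp _ _ _ f (phi j) _ _ _ (smooth_continuous sf Oz)).
  by have [/derivable1_diffP/differentiable_continuous] := dphi j z Oz.
have [fx [fy [df sx sy]]] := smooth_elim sf.
move=> k; elim: k i => [|k IH] i; first by split=> // z; exact: cphi.
apply: (@Ck_intro _ _ _ (fun z => phi i.+1 (f z) * fx z) (fun z => phi i.+1 (f z) * fy z)).
- by move=> z; exact: cphi.
- by move=> z Oz; have [? ?] := df z Oz; split;
    apply: is_derive_chain (dphi i z Oz) _ _ => //; [left|right].
- exact: CkM.
- exact: CkM.
Qed.

End SmoothCalculus.

(** * Symmetry of second derivatives, elementary functions *)

Section MixedPartials.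
Context {R : realType}.
Variable (Omega : set (R * R)).
Hypothesis Oo : open Omega.

(** Both mixed derivatives approximate the second difference quotient of [f]
    over the same small square. *)
Lemma mixed_partials m n (f fx fy fxy fyx : R * R -> 'M[R]_(m, n)) z :
  (forall w, Omega w -> is_derive w dirx f (fx w) /\ is_derive w diry f (fy w)) ->
  (forall w, Omega w -> is_derive w diry fx (fxy w)) ->
  (forall w, Omega w -> is_derive w dirx fy (fyx w)) ->
  {for z, continuous fxy} -> {for z, continuous fyx} -> Omega z ->
  fxy z = fyx z.
Proof.
move=> df dfx dfy cxy cyx Oz.
apply/eqP; rewrite -subr_eq0 -normr_eq0 eq_le normr_ge0 andbT.
apply/ler_addgt0Pl => e e0; rewrite addr0.
have e2 : 0 < e / 2 by rewrite divr_gt0.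
have near1 : \forall w \near z, `|fxy z - fxy w| <= e / 2.
  exact: ((@cvgrPdist_le _ _ _ _ _ _ _).1 cxy).
have near2 : \forall w \near z, `|fyx z - fyx w| <= e / 2.
  exact: ((@cvgrPdist_le _ _ _ _ _ _ _).1 cyx).
have : nbhs z [set w | [/\ Omega w, `|fxy z - fxy w| <= e / 2 & `|fyx z - fyx w| <= e / 2]].
  by apply: filterS3 (open_nbhs_nbhs (conj Oo Oz)) near1 near2.
move=> /nbhs_ballP[d /= d0 dB].
move: z Oz cxy cyx near1 near2 dB => [x y] Oz _ _ _ _ dB.
(* The second difference of [f] over a square of side [h] is h^2 times a mixed
   derivative, up to e / 2 times h^2, in either order. *)
pose h := d / 2; have h0 : 0 < h by rewrite divr_gt0.
have hd : h < d by rewrite /h; lra.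
have inB s t : between x (x + h) s -> between y (y + h) t ->
    [/\ Omega (s, t), `|fxy (s, t) - fxy (x, y)| <= e / 2 &
        `|fyx (s, t) - fyx (x, y)| <= e / 2].
  move=> /between_norm Bs /between_norm Bt.
  suff /dB[? ? ?] : ball (x, y) d (s, t) by split=> //; rewrite distrC.
  move: Bs Bt; rewrite ![_ + h]addrC !addrK [`|h|]gtr0_norm// => Bs Bt.
  by split; rewrite /ball /= distrC; [exact: le_lt_trans Bs hd|exact: le_lt_trans Bt hd].
have hE u : u + h - u = h by rewrite addrC addKr.
have eh0 : 0 <= e / 2 * h by rewrite mulr_ge0 ?ltW.
have Dx : `|(f (x + h, y + h) - f (x + h, y)) - (f (x, y + h) - f (x, y)) -
    h *: (h *: fxy (x, y))| <= e / 2 * h * h.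
  have := @mean_value_mx _ _ _ (fun s => f (s, y + h) - f (s, y))
    (fun s => fx (s, y + h) - fx (s, y)) x (x + h) (h *: fxy (x, y)) _ eh0.
  rewrite hE [`|h|]gtr0_norm//; apply=> s Bs.
  have [H1 _ _] := inB _ _ Bs (betweenl y (y + h)).
  have [H2 _ _] := inB _ _ Bs (betweenr y (y + h)).
  split.
    by apply: is_deriveB; apply/is_derive_dirx; apply: (df _ _).1.
  have := @mean_value_mx _ _ _ (fun t => fx (s, t)) (fun t => fxy (s, t)) y (y + h)
    (fxy (x, y)) _ (ltW e2).
  rewrite hE [`|h|]gtr0_norm//; apply=> t Bt; have [Hst H _] := inB _ _ Bs Bt.
  by split=> //; apply/is_derive_diry; exact: dfx.
have Dy : `|(f (x + h, y + h) - f (x, y + h)) - (f (x + h, y) - f (x, y)) -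
    h *: (h *: fyx (x, y))| <= e / 2 * h * h.
  have := @mean_value_mx _ _ _ (fun t => f (x + h, t) - f (x, t))
    (fun t => fy (x + h, t) - fy (x, t)) y (y + h) (h *: fyx (x, y)) _ eh0.
  rewrite hE [`|h|]gtr0_norm//; apply=> t Bt.
  have [H1 _ _] := inB _ _ (betweenl x (x + h)) Bt.
  have [H2 _ _] := inB _ _ (betweenr x (x + h)) Bt.
  split.
    by apply: is_deriveB; apply/is_derive_diry; apply: (df _ _).2.
  have := @mean_value_mx _ _ _ (fun s => fy (s, t)) (fun s => fyx (s, t)) x (x + h)
    (fyx (x, y)) _ (ltW e2).
  rewrite hE [`|h|]gtr0_norm//; apply=> s Bs; have [Hst _ H] := inB _ _ Bs Bt.
  by split=> //; apply/is_derive_dirx; exact: dfy.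
have hh : 0 < h * h by rewrite mulr_gt0.
rewrite -(ler_pM2l hh) -[X in X * _]gtr0_norm// -normrZ.
have -> : (h * h) *: (fxy (x, y) - fyx (x, y)) =
   ((f (x + h, y + h) - f (x, y + h)) - (f (x + h, y) - f (x, y)) - h *: (h *: fyx (x, y)))
   - ((f (x + h, y + h) - f (x + h, y)) - (f (x, y + h) - f (x, y)) - h *: (h *: fxy (x, y))).
  by apply/matrixP => i j; rewrite !mxE; ring.
apply: le_trans (ler_normB _ _) _; apply: le_trans (lerD Dy Dx) _.
by rewrite le_eqVlt; apply/orP; left; apply/eqP; field.
Qed.

Lemma smooth_mixed m n (f : R * R -> 'M[R]_(m, n)) : smooth Omega f ->
  exists fx fy fxy : R * R -> 'M[R]_(m, n),
  [/\ forall w, Omega w -> is_derive w dirx f (fx w) /\ is_derive w diry f (fy w),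
      forall w, Omega w -> is_derive w diry fx (fxy w) /\ is_derive w dirx fy (fxy w),
      smooth Omega fx, smooth Omega fy & smooth Omega fxy].
Proof.
move=> /smooth_elim[fx [fy [df sx sy]]].
have [fxx [fxy [dfx _ sxy]]] := smooth_elim sx.
have [fyx [fyy [dfy syx _]]] := smooth_elim sy.
exists fx, fy, fxy; split=> // w Ow; split; first exact: (dfx w Ow).2.
have -> : fxy w = fyx w; last exact: (dfy w Ow).1.
apply: (mixed_partials df) => //.
- by move=> v /dfx[].
- by move=> v /dfy[].
- exact: smooth_continuous sxy Ow.
- exact: smooth_continuous syx Ow.
Qed.

End MixedPartials.

Section Transcendental.
Context {R : realType}.
Variable (Omega : set (R * R)).
Hypothesis Oo : open Omega.

Lemma smooth_expR (f : R * R -> R) : smooth Omega f -> smooth Omega (fun z => expR (f z)).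
Proof.
by apply: (@smooth_chain _ Omega _ (fun=> expR) f 0%N).
Qed.

Lemma smooth_ln (f : R * R -> R) : (forall z, Omega z -> 0 < f z) ->
  smooth Omega f -> smooth Omega (fun z => ln (f z)).
Proof.
move=> f0 sf.
pose phi (i : nat) : R -> R := if i is j.+1 then
  fun t => ((-1) ^+ j * j`!%:R) * t^-1 ^+ j.+1 else @ln R.
apply: (@smooth_chain _ Omega _ phi f 0%N) => // i z Oz.
have fz := f0 z Oz; case: i => [|i] /=.
  by rewrite fact0 expr0 !mul1r expr1; exact: is_derive1_ln.
have dV : is_derive (f z) 1 (fun t : R => t^-1) (- (f z)^-1 ^+ 2).
  have f0' := lt0r_neq0 fz; have did := @derivable_id R R^o (f z) 1.
  split; first exact: (@derivableV _ _ id).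
  by rewrite (@deriveV _ _ id)// derive_id exprVn [LHS]mulr1.
have dX := is_deriveX i.+1 dV.
have H := @is_deriveZ _ _ _ _ ((-1) ^+ i * i`!%:R) _ _ _ dX.
have E : (fun t : R => (-1) ^+ i * i`!%:R * t^-1 ^+ i.+1) =
    ((-1) ^+ i * i`!%:R) \*: ((fun t : R => t^-1) ^+ i.+1).
  by apply/funext => t; rewrite /= exprfctE.
rewrite E; apply: is_derive_eq H _; rewrite /GRing.scale /=.
rewrite factS natrM [(-1) ^+ i.+1]exprS [_ ^+ i.+2]exprS [_ ^+ i.+1]exprS; ring.
Qed.

End Transcendental.

(** * Integration of flat forms on simply connected domains *)

Definition flat_pair {R : realType} n (Omega : set (R * R)) (A1 A2 : R * R -> 'M[R]_n) :=
  forall z, Omega z ->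
  'D_dirx A2 z - 'D_diry A1 z + (A1 z *m A2 z - A2 z *m A1 z) = 0.

Section Frobenius.
Context {R : realType} (m n : nat) (A1 A2 : R * R -> 'M[R]_n).
Variable (Omega : set (R * R)).
Hypotheses (Oo : open Omega) (sA1 : smooth Omega A1) (sA2 : smooth Omega A2).
Hypothesis fl : flat_pair Omega A1 A2.

Let smooth_data : exists A1y A2x A2xx : R * R -> 'M[R]_n,
  [/\ forall z, Omega z -> [/\ {for z, continuous A1}, {for z, continuous A2},
        {for z, continuous A2x} & {for z, continuous A2xx}],
      forall z, Omega z -> is_derive z diry A1 (A1y z),
      forall z, Omega z -> is_derive z dirx A2 (A2x z),
      forall z, Omega z -> is_derive z dirx A2x (A2xx z) &
      forall z, Omega z -> A2x z - A1y z + (A1 z *m A2 z - A2 z *m A1 z) = 0].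
Proof.
have [A1x [A1y [d1 _ _]]] := smooth_elim sA1.
have [A2x [A2y [d2 s2x _]]] := smooth_elim sA2.
have [A2xx [A2xy [d3 s2xx _]]] := smooth_elim s2x.
exists A1y, A2x, A2xx; split.
- by move=> z Oz; split; exact: smooth_continuous Oz.
- by move=> z /d1[].
- by move=> z /d2[].
- by move=> z /d3[].
- move=> z Oz; rewrite -(fl Oz).
  by have [_ [_ ->]] := d1 z Oz; have [[_ ->] _] := d2 z Oz.
Qed.

Lemma frobenius_local_system : local_system Omega (@total_sol R m n A1 A2).
Proof.
have [A1y [A2x [A2xx [c d1 d2 d3 f]]]] := smooth_data.
have c1 z : Omega z -> {for z, continuous A1} by move=> /c[].
have c2 z : Omega z -> {for z, continuous A2} by move=> /c[].
have c3 z : Omega z -> {for z, continuous A2x} by move=> /c[].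
have c4 z : Omega z -> {for z, continuous A2xx} by move=> /c[].
exact: (total_sol_local_system m Oo c1 c2 c3 c4 d1 d2 d3 f).
Qed.

(** Local primitives exist on small squares by flatness and are determined by one
    value, so the monodromy principle applies. *)
Theorem frobenius z0 (g : 'M[R]_(m, n)) : simply_connected Omega -> Omega z0 ->
  exists2 P, (forall z, Omega z -> total_sol A1 A2 P z) & P z0 = g.
Proof.
move=> sc Oz0; apply: (monodromy frobenius_local_system sc g Oz0).
exact: total_sol_near.
Qed.

Lemma total_sol_unique z0 (P Q : R * R -> 'M[R]_(m, n)) : connected Omega -> Omega z0 ->
  (forall z, Omega z -> total_sol A1 A2 P z) ->
  (forall z, Omega z -> total_sol A1 A2 Q z) -> P z0 = Q z0 ->
  forall z, Omega z -> P z = Q z.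
Proof.
move=> cO Oz0 sP sQ PQ z Oz.
apply: (connected_locally_const (P := fun z => P z = Q z) cO _ Oz0 Oz PQ) => c Oc.
have nO : \forall w \near c, Omega w by exact: open_nbhs_nbhs.
have [V cV HV] := sol_eq_near frobenius_local_system Oc (filterS sP nO) (filterS sQ nO).
by exists V => // u v Vu Vv _ _; exact: HV.
Qed.

(** The derivatives of a solution are products of the solution with smooth
    coefficients, so each order of differentiability yields the next. *)
Lemma total_sol_smooth (P : R * R -> 'M[R]_(m, n)) :
  (forall z, Omega z -> total_sol A1 A2 P z) -> smooth Omega P.
Proof.
move=> sP; have cP z : Omega z -> {for z, continuous P}.
  have [A1y [A2x [A2xx [c d1 d2 d3 f]]]] := smooth_data.
  have c1 w : Omega w -> {for w, continuous A1} by move=> /c[].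
  have c2 w : Omega w -> {for w, continuous A2} by move=> /c[].
  have c3 w : Omega w -> {for w, continuous A2x} by move=> /c[].
  have c4 w : Omega w -> {for w, continuous A2xx} by move=> /c[].
  exact: (total_sol_continuous Oo c1 c2 c3 c4 sP).
elim=> [|k IH]; first by split.
by apply: (Ck_intro Oo cP sP); exact: Ck_mulmx.
Qed.

End Frobenius.

(** * Quaternionic matrices *)

Notation i0 := (inord 0 : 'I_4).
Notation i1 := (inord 1 : 'I_4).
Notation i2 := (inord 2 : 'I_4).
Notation i3 := (inord 3 : 'I_4).

Lemma ord4_ind (P : 'I_4 -> Prop) : P i0 -> P i1 -> P i2 -> P i3 -> forall i, P i.
Proof.
move=> P0 P1 P2 P3 i; rewrite -(inord_val i).
by case: i => -[|[|[|[|//]]]] /=.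
Qed.

Lemma sum4 (V : nmodType) (F : 'I_4 -> V) : \sum_i F i = F i0 + F i1 + F i2 + F i3.
Proof.
rewrite !big_ord_recl big_ord0 addr0 !addrA.
by congr (F _ + F _ + F _ + F _); apply/val_inj; rewrite /= inordK.
Qed.

Lemma eq_ord4 : ((i0 == i1) = false) * ((i0 == i2) = false) * ((i0 == i3) = false) *
  ((i1 == i0) = false) * ((i1 == i2) = false) * ((i1 == i3) = false) *
  ((i2 == i0) = false) * ((i2 == i1) = false) * ((i2 == i3) = false) *
  ((i3 == i0) = false) * ((i3 == i1) = false) * ((i3 == i2) = false).
Proof. by do !split; rewrite -val_eqE /= !inordK. Qed.

Lemma ordE : (nat_of_ord i0 = 0%N) * (nat_of_ord i1 = 1%N) *
  (nat_of_ord i2 = 2%N) * (nat_of_ord i3 = 3%N).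
Proof. by rewrite !inordK. Qed.

Section QuaternionEntries.
Variable K : comNzRingType.
Implicit Types (p q t u v : 'cV[K]_4) (M : 'M[K]_4).

Lemma col4P u v : u i0 0 = v i0 0 -> u i1 0 = v i1 0 -> u i2 0 = v i2 0 ->
  u i3 0 = v i3 0 -> u = v.
Proof.
move=> e0 e1 e2 e3; apply/matrixP => r c; rewrite [c]ord1.
by elim/ord4_ind: r.
Qed.

Lemma LqE p r c : Lq p r c = nth 0 (nth [::]
  [:: [:: p i0 0; - p i1 0; - p i2 0; - p i3 0];
      [:: p i1 0; p i0 0; - p i3 0; p i2 0];
      [:: p i2 0; p i3 0; p i0 0; - p i1 0];
      [:: p i3 0; - p i2 0; p i1 0; p i0 0]] r) c.
Proof.
rewrite /Lq mxE /qmul !mxE.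
by elim/ord4_ind: r; elim/ord4_ind: c; rewrite !ordE /= ?eqxx ?eq_ord4 /=; ring.
Qed.

Lemma RqE p r c : Rq p r c = nth 0 (nth [::]
  [:: [:: p i0 0; - p i1 0; - p i2 0; - p i3 0];
      [:: p i1 0; p i0 0; p i3 0; - p i2 0];
      [:: p i2 0; - p i3 0; p i0 0; p i1 0];
      [:: p i3 0; p i2 0; - p i1 0; p i0 0]] r) c.
Proof.
rewrite /Rq mxE /qmul !mxE.
by elim/ord4_ind: r; elim/ord4_ind: c; rewrite !ordE /= ?eqxx ?eq_ord4 /=; ring.
Qed.

Lemma qiE r : (qi : 'cV[K]_4) r 0 = nth 0 [:: 0; 1; 0; 0] r.
Proof. by rewrite mxE; elim/ord4_ind: r; rewrite ?ordE ?eqxx ?eq_ord4. Qed.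

Lemma qjE r : (qj : 'cV[K]_4) r 0 = nth 0 [:: 0; 0; 1; 0] r.
Proof. by rewrite mxE; elim/ord4_ind: r; rewrite ?ordE ?eqxx ?eq_ord4. Qed.

Lemma qkE r : (qk : 'cV[K]_4) r 0 = nth 0 [:: 0; 0; 0; 1] r.
Proof. by rewrite mxE; elim/ord4_ind: r; rewrite ?ordE ?eqxx ?eq_ord4. Qed.

Lemma mulmx4E m n (A : 'M[K]_(m, 4)) (B : 'M[K]_(4, n)) i j :
  (A *m B) i j = A i i0 * B i0 j + A i i1 * B i1 j + A i i2 * B i2 j + A i i3 * B i3 j.
Proof. by rewrite mxE sum4. Qed.

Lemma addmxE m n (A B : 'M[K]_(m, n)) i j : (A + B) i j = A i j + B i j.
Proof. by rewrite mxE. Qed.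

Lemma oppmxE m n (A : 'M[K]_(m, n)) i j : (- A) i j = - A i j.
Proof. by rewrite mxE. Qed.

Lemma scalemxE m n a (A : 'M[K]_(m, n)) i j : (a *: A) i j = a * A i j.
Proof. by rewrite mxE. Qed.

Lemma trmxE m n (A : 'M[K]_(m, n)) i j : A^T i j = A j i.
Proof. by rewrite mxE. Qed.

Lemma scalar4E n (a : K) (i j : 'I_n) : (a%:M : 'M[K]_n) i j = a *+ (i == j).
Proof. by rewrite mxE. Qed.

Lemma delta4E n (a b : 'I_n) : (delta_mx a 0 : 'cV[K]_n) b 0 = (b == a)%:R.
Proof. by rewrite mxE eqxx andbT. Qed.

Definition quatE := (mulmx4E, addmxE, oppmxE, scalemxE, trmxE, scalar4E, delta4E, LqE, RqE, qiE, qjE, qkE,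
  eq_ord4, eqxx, ordE).

End QuaternionEntries.

(* The formulas for the entries are applied once to generic indices. *)
Ltac quat_entries :=
  let r := fresh "r" in let c := fresh "c" in
  apply/matrixP => r c; rewrite !quatE; elim/ord4_ind: r; elim/ord4_ind: c;
  rewrite ?(ordE, eq_ord4, eqxx) /=; try ring.

Ltac quat_column :=
  let r := fresh "r" in let c := fresh "c" in
  apply/matrixP => r c; rewrite [c]ord1 !quatE; elim/ord4_ind: r;
  rewrite ?(ordE, eq_ord4, eqxx) /=.

Section QuaternionAlgebra.
Variable K : comNzRingType.
Implicit Types (p q t u v : 'cV[K]_4) (M : 'M[K]_4).

Lemma Lq_Rq_comm p q : Lq p *m Rq q = Rq q *m Lq p.
Proof. by quat_entries. Qed.

Lemma Lqi_sqr : Lq qi *m Lq qi = - 1%:M :> 'M[K]_4.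
Proof. by quat_entries. Qed.

Lemma Lqj_sqr : Lq qj *m Lq qj = - 1%:M :> 'M[K]_4.
Proof. by quat_entries. Qed.

Lemma Lqj_Lqi : Lq qj *m Lq qi = - (Lq qi *m Lq qj) :> 'M[K]_4.
Proof. by quat_entries. Qed.

Lemma tr_Lqi : (Lq qi)^T = - Lq qi :> 'M[K]_4.
Proof. by quat_entries. Qed.

Lemma Rq_linear (a : K) u v : Rq (a *: u + v) = a *: Rq u + Rq v.
Proof. by quat_entries. Qed.

Lemma Rq_basis u : Rq u = u i0 0 *: 1%:M + u i1 0 *: Rq qi + u i2 0 *: Rq qj + u i3 0 *: Rq qk.
Proof. by quat_entries. Qed.

Lemma tr_Rq u : u i0 0 = 0 -> (Rq u)^T = - Rq u.
Proof. by move=> u0; quat_entries; rewrite u0; ring. Qed.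

Lemma tr_Rq_conj u : (Rq u)^T = Rq ((2 * u i0 0) *: delta_mx i0 0 - u).
Proof. by quat_entries. Qed.

Definition qnorm u : K := (u^T *m u) 0 0.

Lemma qnormE u : qnorm u = u i0 0 ^+ 2 + u i1 0 ^+ 2 + u i2 0 ^+ 2 + u i3 0 ^+ 2.
Proof. by rewrite /qnorm mxE sum4 !mxE !expr2. Qed.

Lemma Rq_trmx_mul u : (Rq u)^T *m Rq u = (qnorm u)%:M.
Proof. by rewrite qnormE; quat_entries. Qed.

Lemma Rq_mul_trmx u : Rq u *m (Rq u)^T = (qnorm u)%:M.
Proof. by rewrite qnormE; quat_entries. Qed.

Lemma Rq_one u : Rq u *m delta_mx i0 0 = u.
Proof. by quat_column; ring. Qed.

(** R_u j = j u = L_j (R_u 1), which turns the frame equation along d/dy into a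
    relation with the one along d/dx. *)
Lemma Rq_qj u : Rq u *m delta_mx i2 0 = Lq qj *m u.
Proof. by quat_column; ring. Qed.

Lemma trace_Lqi_Rq u : \tr (Lq qi *m Rq u) = 0.
Proof. by rewrite /mxtrace; under eq_bigr do rewrite !quatE; rewrite sum4 !ordE /=; ring. Qed.

Lemma trace_Lqi_Lqi : \tr (Lq qi *m Lq qi) = - 4%:R :> K.
Proof. by rewrite Lqi_sqr linearN /= mxtrace1. Qed.

(** A matrix commuting with left multiplications is determined by its value at the
    quaternion 1, as the quaternions i, j, k are obtained from 1 by left
    multiplications. *)
Lemma commute_Rq M : M *m Lq qi = Lq qi *m M -> M *m Lq qj = Lq qj *m M ->
  M = Rq (M *m delta_mx i0 0).
Proof.
move=> Mi Mj; set u := M *m delta_mx i0 0.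
have e1 : M *m delta_mx i1 0 = Rq u *m delta_mx i1 0 :> 'cV[K]_4.
  have -> : delta_mx i1 0 = Lq qi *m delta_mx i0 0 :> 'cV[K]_4.
    by quat_column; ring.
  by rewrite !mulmxA Mi -Lq_Rq_comm -!mulmxA Rq_one.
have e2 : M *m delta_mx i2 0 = Rq u *m delta_mx i2 0 :> 'cV[K]_4.
  have -> : delta_mx i2 0 = Lq qj *m delta_mx i0 0 :> 'cV[K]_4.
    by quat_column; ring.
  by rewrite !mulmxA Mj -Lq_Rq_comm -!mulmxA Rq_one.
have e3 : M *m delta_mx i3 0 = Rq u *m delta_mx i3 0 :> 'cV[K]_4.
  have -> : delta_mx i3 0 = Lq qi *m (Lq qj *m delta_mx i0 0) :> 'cV[K]_4.
    have -> : Lq qj *m delta_mx i0 0 = delta_mx i2 0 :> 'cV[K]_4 by quat_column; ring.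
    by quat_column; ring.
  by rewrite !mulmxA Mi -[Lq qi *m M *m _]mulmxA Mj -!Lq_Rq_comm
    -[Lq qi *m Rq u *m _]mulmxA -Lq_Rq_comm -!mulmxA Rq_one.
have e0 : M *m delta_mx i0 0 = Rq u *m delta_mx i0 0 :> 'cV[K]_4 by rewrite Rq_one.
apply/matrixP => r c.
have entry (N : 'M[K]_4) : N r c = (N *m (delta_mx c 0 : 'cV_4)) r 0.
  by rewrite -colE mxE.
by rewrite !entry; elim/ord4_ind: c {entry}; rewrite ?e0 ?e1 ?e2 ?e3.
Qed.

End QuaternionAlgebra.

(** * The grading *)

Section Splitting.
Variable K : numFieldType.
Implicit Types (b u t : 'cV[K]_4) (M : 'M[K]_4).

(** The trace form: right multiplications are orthogonal to [Lq qi], and the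
    square of [Lq qi] has trace -4. *)
Definition Lcoef M : K := - 4^-1 * \tr (Lq qi *m M).

Lemma Lcoef_linear : linear_for *%R Lcoef.
Proof.
move=> a M N; rewrite /Lcoef mulmxDr -scalemxAr mxtraceD mxtraceZ; ring.
Qed.

Lemma Lcoef_Rq u : Lcoef (Rq u) = 0.
Proof. by rewrite /Lcoef trace_Lqi_Rq mulr0. Qed.

Lemma Lcoef_qi : Lcoef (Lq qi) = 1.
Proof. by rewrite /Lcoef trace_Lqi_Lqi mulrN mulNr opprK mulVf// pnatr_eq0. Qed.

Lemma LcoefE a u : Lcoef (a *: Lq qi + Rq u) = a.
Proof. by rewrite Lcoef_linear Lcoef_qi Lcoef_Rq mulr1 addr0. Qed.

Lemma emb_alg_linear a (e1 e2 : 'M[K]_4) t1 t2 :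
  a *: emb_alg e1 t1 + emb_alg e2 t2 = emb_alg (a *: e1 + e2) (a *: t1 + t2).
Proof. by rewrite /emb_alg scale_block_mx add_block_mx !scaler0 !addr0. Qed.

Lemma emb_algD (e1 e2 : 'M[K]_4) t1 t2 :
  emb_alg e1 t1 + emb_alg e2 t2 = emb_alg (e1 + e2) (t1 + t2).
Proof. by rewrite /emb_alg add_block_mx !addr0. Qed.

Lemma emb_algZ a (e : 'M[K]_4) t : a *: emb_alg e t = emb_alg (a *: e) (a *: t).
Proof. by rewrite /emb_alg scale_block_mx !scaler0. Qed.

Lemma emb_alg_eq0 (e : 'M[K]_4) t : emb_alg e t = 0 <-> e = 0 /\ t = 0.
Proof.
split=> [H|[-> ->]]; last by rewrite /emb_alg block_mx0.
have : block_mx e t 0 0 = block_mx 0 0 0 0 :> 'M[K]_(4 + 1, 4 + 1).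
  by rewrite block_mx0.
by case/eq_block_mx => -> ->.
Qed.

Lemma RqD (u v : 'cV[K]_4) : Rq (u + v) = Rq u + Rq v.
Proof. by rewrite -[u in LHS]scale1r Rq_linear !scale1r. Qed.

Lemma Rq0 : Rq 0 = 0 :> 'M[K]_4.
Proof. by have := Rq_linear (-1) (0 : 'cV[K]_4) 0; rewrite scaler0 addr0 scaleN1r addNr. Qed.

Lemma RqZ a (u : 'cV[K]_4) : Rq (a *: u) = a *: Rq u.
Proof. by rewrite -[a *: u]addr0 Rq_linear Rq0 addr0. Qed.

Lemma emb_alg0 : emb_alg 0 0 = 0 :> 'M[K]_(4 + 1).
Proof. exact/emb_alg_eq0. Qed.

Lemma Lcoef0 : Lcoef (0 : 'M[K]_4) = 0.
Proof. by rewrite /Lcoef mulmx0 linear0 mulr0. Qed.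

Lemma LcoefZ a : Lcoef (a *: Lq qi : 'M[K]_4) = a.
Proof. by rewrite -[a *: _]addr0 Lcoef_linear Lcoef_qi Lcoef0 mulr1 addr0. Qed.

(** The two translational degrees are the eigenspaces of [Lq qj] for the two
    square roots of -1; these are the projections onto them. *)
Section Eigen.
Variable iota : K.
Hypothesis ii : iota * iota = -1.

Definition pminus t : 'cV[K]_4 := 2^-1 *: (t - iota *: (Lq qj *m t)).
Definition pplus t : 'cV[K]_4 := 2^-1 *: (t + iota *: (Lq qj *m t)).

Let two_neq0 : (2 : K) != 0.
Proof. by rewrite pnatr_eq0. Qed.

Lemma pminus_linear : linear pminus.
Proof.
move=> a u v; rewrite /pminus mulmxDr -scalemxAr.
move: (Lq qj *m u) (Lq qj *m v) => u' v'.
apply/matrixP => r c; rewrite !(addmxE, oppmxE, scalemxE).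
by move: (u r c) (u' r c) (v r c) (v' r c) => *; ring.
Qed.

Lemma pplus_linear : linear pplus.
Proof.
move=> a u v; rewrite /pplus mulmxDr -scalemxAr.
move: (Lq qj *m u) (Lq qj *m v) => u' v'.
apply/matrixP => r c; rewrite !(addmxE, oppmxE, scalemxE).
by move: (u r c) (u' r c) (v r c) (v' r c) => *; ring.
Qed.

Lemma pminus_eigen t : Lq qj *m t = iota *: t -> pminus t = t /\ pplus t = 0.
Proof.
move=> E; rewrite /pminus /pplus E scalerA ii scaleN1r opprK subrr scaler0.
by rewrite -mulr2n -[t *+ 2]scaler_nat scalerA mulVf ?two_neq0// scale1r.
Qed.

Lemma pplus_eigen t : Lq qj *m t = - iota *: t -> pplus t = t /\ pminus t = 0.
Proof.
move=> E; rewrite /pminus /pplus E scalerA mulrN ii opprK scale1r subrr scaler0.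
by rewrite -mulr2n -[t *+ 2]scaler_nat scalerA mulVf ?two_neq0// scale1r.
Qed.

Lemma pminusDpplus t : pminus t + pplus t = t.
Proof.
rewrite /pminus /pplus -scalerDr addrACA addNr addr0.
by rewrite -mulr2n -[t *+ 2]scaler_nat scalerA mulVf ?two_neq0// scale1r.
Qed.

Lemma pminus0 : pminus 0 = 0.
Proof. by rewrite /pminus mulmx0 scaler0 subrr scaler0. Qed.

Lemma pplus0 : pplus 0 = 0.
Proof. by rewrite /pplus mulmx0 scaler0 addr0 scaler0. Qed.

Let e : 'cV[K]_4 := 2^-1 *: (delta_mx i0 0 - iota *: delta_mx i2 0).
Let ebar : 'cV[K]_4 := 2^-1 *: (delta_mx i0 0 + iota *: delta_mx i2 0).

Lemma eps_eigen : Lq qj *m e = iota *: e.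
Proof. by rewrite /e; quat_column; ring: ii. Qed.

Lemma epsbar_eigen : Lq qj *m ebar = - iota *: ebar.
Proof. by rewrite /ebar; quat_column; ring: ii. Qed.

Lemma Lqi_eigen (k : K) t : Lq qj *m t = k *: t -> Lq qj *m (Lq qi *m t) = - k *: (Lq qi *m t).
Proof. by move=> E; rewrite mulmxA Lqj_Lqi mulNmx -mulmxA E -scalemxAr scaleNr. Qed.

Lemma Lqi_ebar_eigen : Lq qj *m (Lq qi *m ebar) = iota *: (Lq qi *m ebar).
Proof. by rewrite (Lqi_eigen epsbar_eigen) opprK. Qed.

Lemma eigen_comb (k a c : K) t u : Lq qj *m t = k *: t -> Lq qj *m u = k *: u ->
  Lq qj *m (a *: t + c *: u) = k *: (a *: t + c *: u).
Proof.
move=> Et Eu; rewrite mulmxDr -!scalemxAr Et Eu scalerDr !scalerA.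
by rewrite [a * k]mulrC [c * k]mulrC.
Qed.

Lemma pminusE t : pminus t =
  (t i0 0 + iota * t i2 0) *: e + (t i1 0 - iota * t i3 0) *: (Lq qi *m ebar).
Proof. by rewrite /pminus /e /ebar; quat_column; ring: ii. Qed.

Lemma pplusE t : pplus t =
  (t i0 0 - iota * t i2 0) *: ebar + (t i1 0 + iota * t i3 0) *: (Lq qi *m e).
Proof. by rewrite /pplus /e /ebar; quat_column; ring: ii. Qed.

(** The grading over any field with a square root of -1; that of the complexified
    symmetry algebra is the instance of the imaginary unit. *)
Definition gG (k : 'Z_4) : {vspace 'M[K]_(4 + 1)} :=
  match val k with
  | 0 => <<[:: emb_alg (Rq qi) 0; emb_alg (Rq qj) 0; emb_alg (Rq qk) 0]>>%VS
  | 1 => <<[:: emb_alg 0 ebar; emb_alg 0 (Lq qi *m e)]>>%VS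
  | 2 => <<[:: emb_alg (Lq qi) 0]>>%VS
  | _ => <<[:: emb_alg 0 e; emb_alg 0 (Lq qi *m ebar)]>>%VS
  end.

Definition gpart (k : 'Z_4) : 'M[K]_(4 + 1) -> 'M[K]_(4 + 1) :=
  sumv_pi (\sum_(l : 'Z_4) gG l)%VS k.

(** The closed form of [gpart]. Unlike [gpart] it is seen to be linear on all
    matrices without knowing the sum of the graded parts. *)
Definition grproj (k : 'Z_4) (A : 'M[K]_(4 + 1)) : 'M[K]_(4 + 1) :=
  let eta := ulsubmx A in let t := ursubmx A in
  match val k with
  | 0 => emb_alg (eta - Lcoef eta *: Lq qi) 0
  | 1 => emb_alg 0 (pplus t)
  | 2 => emb_alg (Lcoef eta *: Lq qi) 0
  | _ => emb_alg 0 (pminus t)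
  end.

Lemma grproj_emb k (eta : 'M[K]_4) t : grproj k (emb_alg eta t) =
  match val k with
  | 0 => emb_alg (eta - Lcoef eta *: Lq qi) 0
  | 1 => emb_alg 0 (pplus t)
  | 2 => emb_alg (Lcoef eta *: Lq qi) 0
  | _ => emb_alg 0 (pminus t)
  end.
Proof. by rewrite /grproj /emb_alg block_mxKul block_mxKur. Qed.

Lemma grproj_linear k : linear (grproj k).
Proof.
move=> a A B; rewrite /grproj.
have -> : ulsubmx (a *: A + B) = a *: ulsubmx A + ulsubmx B.
  by apply/matrixP => r c; rewrite !mxE.
have -> : ursubmx (a *: A + B) = a *: ursubmx A + ursubmx B.
  by apply/matrixP => r c; rewrite !mxE.
rewrite Lcoef_linear.
case: (val k) => [|[|[|j]]]; rewrite ?pplus_linear ?pminus_linear emb_alg_linear ?scaler0 ?addr0 //.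
- by congr emb_alg; rewrite scalerDl -scalerA scalerBr opprD addrACA.
- by congr emb_alg; rewrite scalerDl -scalerA.
Qed.

Lemma span2P (V : vectType K) (x y v : V) : v \in <<[:: x; y]>>%VS ->
  exists a b0 : K, v = a *: x + b0 *: y.
Proof.
rewrite span_cons span_seq1 => /memv_addP[u /vlineP[a ->] [w /vlineP[b ->] ->]].
by exists a, b.
Qed.

Lemma span3P (V : vectType K) (x y z v : V) : v \in <<[:: x; y; z]>>%VS ->
  exists a b0 c : K, v = a *: x + b0 *: y + c *: z.
Proof.
rewrite span_cons => /memv_addP[u /vlineP[a ->] [w /span2P[b [c ->]] ->]].
by exists a, b, c; rewrite addrA.
Qed.

Lemma gG_forms (k : 'Z_4) v : v \in gG k ->
  match val k with
  | 0 => exists b, v = emb_alg (Rq b) 0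
  | 1 => exists2 t, Lq qj *m t = - iota *: t & v = emb_alg 0 t
  | 2 => exists a, v = emb_alg (a *: Lq qi) 0
  | _ => exists2 t, Lq qj *m t = iota *: t & v = emb_alg 0 t
  end.
Proof.
rewrite /gG; case: (val k) => [|[|[|j]]].
- move=> /span3P[a [b [c ->]]]; exists (a *: qi + b *: qj + c *: qk).
  rewrite !emb_algZ !emb_algD !scaler0 !addr0; congr emb_alg.
  by rewrite !RqD !RqZ.
- move=> /span2P[a [b ->]]; exists (a *: ebar + b *: (Lq qi *m e)).
    exact: eigen_comb epsbar_eigen (Lqi_eigen eps_eigen).
  by rewrite !emb_algZ !emb_algD !scaler0 addr0.
- rewrite span_seq1 => /vlineP[a ->]; exists a.
  by rewrite emb_algZ scaler0.
- move=> /span2P[a [b ->]]; exists (a *: e + b *: (Lq qi *m ebar)).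
    exact: eigen_comb eps_eigen Lqi_ebar_eigen.
  by rewrite !emb_algZ !emb_algD !scaler0 addr0.
Qed.

(** A finite verification: the two isotropy degrees are separated by [Lcoef] and
    the two translational ones by the eigenvalue of [Lq qj]. *)
Lemma grproj_gG k l v : v \in gG l -> grproj k v = if k == l then v else 0.
Proof.
move=> /gG_forms; rewrite -val_eqE.
case: l => -[|[|[|[|//]]]] /= _; case: k => -[|[|[|[|//]]]] /= lk.
all: first [move=> [x E ->]|move=> [x ->]]; rewrite grproj_emb /=.
all: rewrite ?Lcoef0 ?pminus0 ?pplus0 ?Lcoef_Rq ?scale0r ?subr0 ?emb_alg0 //.
all: try by have [H1 H2] := pminus_eigen E; rewrite ?H1 ?H2 ?emb_alg0.
all: try by have [H1 H2] := pplus_eigen E; rewrite ?H1 ?H2 ?emb_alg0.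
all: by rewrite LcoefZ ?subrr ?emb_alg0.
Qed.

(** Decompose [A] into its graded parts: the closed form keeps the part of degree
    [k] and kills the others. *)
Lemma gcomp_grproj k A : A \in (\sum_(l : 'Z_4) gG l)%VS ->
  gpart k A = grproj k A.
Proof.
move=> AV; have AE : \sum_(l : 'Z_4) gpart l A = A.
  exact: (sumv_pi_sum (erefl (\sum_(l : 'Z_4) gG l)%VS) AV).
pose G : {linear 'M[K]_(4 + 1) -> 'M[K]_(4 + 1)} :=
  HB.pack (grproj k) (GRing.isLinear.Build _ _ _ _ (grproj k) (grproj_linear k)).
transitivity (G A) => //; rewrite -[in RHS]AE linear_sum.
rewrite (bigD1 k) //= big1 ?addr0.
  rewrite -[RHS]/(grproj k (gpart k A)) (@grproj_gG k k) ?eqxx//.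
  exact: memv_sum_pi.
move=> l lk; rewrite -[LHS]/(grproj k (gpart l A)) (@grproj_gG k l).
  by rewrite eq_sym (negbTE lk).
exact: memv_sum_pi.
Qed.

Lemma grproj_mem k (a : K) b t : b i0 0 = 0 ->
  grproj k (emb_alg (a *: Lq qi + Rq b) t) \in gG k.
Proof.
move=> b0; rewrite grproj_emb LcoefE addrAC subrr add0r /gG.
case: (val k) => [|[|[|j]]].
- have -> : emb_alg (Rq b) 0 = b i1 0 *: emb_alg (Rq qi) 0 + b i2 0 *: emb_alg (Rq qj) 0 +
      b i3 0 *: emb_alg (Rq qk) 0 :> 'M[K]_(4 + 1).
    by rewrite !emb_algZ !emb_algD !scaler0 !addr0 {1}Rq_basis b0 scale0r add0r.
  by rewrite !rpredD// rpredZ// memv_span// !inE eqxx ?orbT.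
- have -> : emb_alg 0 (pplus t) = (t i0 0 - iota * t i2 0) *: emb_alg 0 ebar +
      (t i1 0 + iota * t i3 0) *: emb_alg 0 (Lq qi *m e) :> 'M[K]_(4 + 1).
    by rewrite !emb_algZ !emb_algD !scaler0 !addr0 pplusE.
  by rewrite !rpredD// rpredZ// memv_span// !inE eqxx ?orbT.
- have -> : emb_alg (a *: Lq qi) 0 = a *: emb_alg (Lq qi) 0 :> 'M[K]_(4 + 1).
    by rewrite !emb_algZ scaler0.
  by rewrite rpredZ// memv_span// inE eqxx.
- have -> : emb_alg 0 (pminus t) = (t i0 0 + iota * t i2 0) *: emb_alg 0 e +
      (t i1 0 - iota * t i3 0) *: emb_alg 0 (Lq qi *m ebar) :> 'M[K]_(4 + 1).
    by rewrite !emb_algZ !emb_algD !scaler0 !addr0 pminusE.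
  by rewrite !rpredD// rpredZ// memv_span// !inE eqxx ?orbT.
Qed.

Lemma gcompE_gen k (a : K) b t : b i0 0 = 0 ->
  gpart k (emb_alg (a *: Lq qi + Rq b) t) =
  match val k with
  | 0 => emb_alg (Rq b) 0
  | 1 => emb_alg 0 (pplus t)
  | 2 => emb_alg (a *: Lq qi) 0
  | _ => emb_alg 0 (pminus t)
  end.
Proof.
move=> b0; set A := emb_alg _ _.
have AV : A \in (\sum_(l : 'Z_4) gG l)%VS.
  have -> : A = \sum_(l : 'Z_4) grproj l A.
    rewrite /A !big_ord_recl big_ord0 addr0 !grproj_emb /=.
    rewrite !emb_algD !(addr0, add0r) subrK; congr emb_alg.
    by rewrite addrC pminusDpplus.
  by apply: memv_sumr => l _; exact: grproj_mem.
by rewrite (gcomp_grproj k AV) grproj_emb LcoefE addrAC subrr add0r.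
Qed.

End Eigen.
End Splitting.

Section Grading.
Context {R : realType}.
Local Notation C := R[i].
Implicit Types (t : 'cV[C]_4) (b : 'cV[C]_4).
Local Notation pminus := (pminus ('i : C)).
Local Notation pplus := (pplus ('i : C)).

Lemma ii : 'i * 'i = -1 :> C.
Proof. by rewrite -expr2 sqr_i. Qed.

Lemma gcompE k (a : C) b t : b i0 0 = 0 ->
  gcomp k (emb_alg (a *: Lq qi + Rq b) t) =
  match val k with
  | 0 => emb_alg (Rq b) 0
  | 1 => emb_alg 0 (pplus t)
  | 2 => emb_alg (a *: Lq qi) 0
  | _ => emb_alg 0 (pminus t)
  end.
Proof. exact: gcompE_gen ii k a b t. Qed.

End Grading.

(** * The type conditions and the extended form at a point *)

Section CovectorAlgebra.
Variables (K : numFieldType) (iota : K).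
Hypothesis ii : iota * iota = -1.
Implicit Types (t u : 'cV[K]_4).
Local Notation pminus := (pminus iota).
Local Notation pplus := (pplus iota).

Lemma Lqj_LqjK t : Lq qj *m (Lq qj *m t) = - t.
Proof. by rewrite mulmxA Lqj_sqr mulNmx mul1mx. Qed.

Let two_neq0 : (2 : K) != 0.
Proof. by rewrite pnatr_eq0. Qed.

Lemma pminus_dzbar t u : pminus t + iota *: pminus u =
  2^-1 *: ((t + Lq qj *m u) + iota *: (u - Lq qj *m t)).
Proof.
rewrite /pminus; move: (Lq qj *m u) (Lq qj *m t) => u' t'.
apply/matrixP => r c; rewrite !(addmxE, oppmxE, scalemxE).
by move: (t r c) (u r c) (t' r c) (u' r c) => *; ring: ii.
Qed.

Lemma pplus_dz t u : pplus t - iota *: pplus u =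
  2^-1 *: ((t + Lq qj *m u) - iota *: (u - Lq qj *m t)).
Proof.
rewrite /pplus; move: (Lq qj *m u) (Lq qj *m t) => u' t'.
apply/matrixP => r c; rewrite !(addmxE, oppmxE, scalemxE).
by move: (t r c) (u r c) (t' r c) (u' r c) => *; ring: ii.
Qed.

Lemma pminus_dz t : pminus t - iota *: pminus (Lq qj *m t) = t - iota *: (Lq qj *m t).
Proof.
rewrite /pminus Lqj_LqjK; move: (Lq qj *m t) => t'.
apply/matrixP => r c; rewrite !(addmxE, oppmxE, scalemxE).
by move: (t r c) (t' r c) => *; field: ii.
Qed.

Lemma pplus_dzbar t : pplus t + iota *: pplus (Lq qj *m t) = t + iota *: (Lq qj *m t).
Proof.
rewrite /pplus Lqj_LqjK; move: (Lq qj *m t) => t'.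
apply/matrixP => r c; rewrite !(addmxE, oppmxE, scalemxE).
by move: (t r c) (t' r c) => *; field: ii.
Qed.

(** With [c] and [s] playing the role of the cosine and sine of a complex angle,
    the spectral parameter turns the degree 1 and -1 parts by that angle and the
    degree 2 part by twice that angle. *)
Lemma flat_rotated (c s a1 a2 a1y a2x da : K) (B1 B2 dB : 'M[K]_4) t tx ty :
  c * c + s * s = 1 ->
  B1 *m Lq qi = Lq qi *m B1 -> B2 *m Lq qi = Lq qi *m B2 ->
  B1 *m Lq qj = Lq qj *m B1 -> B2 *m Lq qj = Lq qj *m B2 ->
  a2x = a1y -> dB + (B1 *m B2 - B2 *m B1) = 0 ->
  Lq qj *m tx - ty + (a1 *: Lq qi + B1) *m (Lq qj *m t) - (a2 *: Lq qi + B2) *m t = 0 ->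
  let C := c * c - s * s in let S := 2 * c * s in
  let a1' := C * a1 - S * a2 in let a2' := S * a1 + C * a2 in
  ((S * da + C * (a2x - a1y)) *: Lq qi + dB) +
    ((a1' *: Lq qi + B1) *m (a2' *: Lq qi + B2) - (a2' *: Lq qi + B2) *m (a1' *: Lq qi + B1))
    = (S * da) *: Lq qi /\
  (s *: tx + c *: (Lq qj *m tx)) - (c *: ty - s *: (Lq qj *m ty)) +
    ((a1' *: Lq qi + B1) *m (s *: t + c *: (Lq qj *m t))
     - (a2' *: Lq qi + B2) *m (c *: t - s *: (Lq qj *m t))) = 0.
Proof.
move=> cs B1i B2i B1j B2j -> HB Ht C S a1' a2'; split.
  rewrite subrr mulr0 addr0 !mulmxDl !mulmxDr -!scalemxAl -!scalemxAr B1i B2i.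
  move/eqP: HB; rewrite addr_eq0 => /eqP ->.
  move: (B1 *m B2) (B2 *m B1) (Lq qi *m B1) (Lq qi *m B2) (Lq qi *m Lq qi) => *.
  by apply/matrixP => r cc; rewrite !(addmxE, oppmxE, scalemxE); ring.
have jB1 : Lq qj *m (B1 *m t) = B1 *m (Lq qj *m t) by rewrite !mulmxA B1j.
have jB2 : Lq qj *m (B2 *m t) = B2 *m (Lq qj *m t) by rewrite !mulmxA B2j.
pose w := Lq qi *m t; pose v := Lq qi *m (Lq qj *m t).
have jw : Lq qj *m w = - v by rewrite /w mulmxA Lqj_Lqi mulNmx -mulmxA.
have jv : Lq qj *m v = w.
  by rewrite /v mulmxA Lqj_Lqi mulNmx -mulmxA Lqj_LqjK mulmxN opprK.
have E : ty = Lq qj *m tx + (a1 *: v + B1 *m (Lq qj *m t)) - (a2 *: w + B2 *m t).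
  apply/eqP; rewrite -subr_eq0 -oppr_eq0; apply/eqP; rewrite -Ht.
  rewrite !mulmxDl -!scalemxAl -/w -/v.
  move: (Lq qj *m tx) (B1 *m _) (B2 *m _) => *.
  by apply/matrixP => r cc; rewrite !(addmxE, oppmxE, scalemxE); ring.
have jE : Lq qj *m ty = - tx + (a1 *: w - B1 *m t) - (- (a2 *: v) + B2 *m (Lq qj *m t)).
  have jjB1 : Lq qj *m (B1 *m (Lq qj *m t)) = - (B1 *m t).
    by rewrite mulmxA -B1j -mulmxA Lqj_LqjK mulmxN.
  by rewrite E !(mulmxDr, mulmxN) -!scalemxAr jw jv Lqj_LqjK jB2 jjB1 scalerN.
rewrite jE E !mulmxDl !mulmxDr -!scalemxAl !mulmxN -!scalemxAr -/w -/v /a1' /a2' /C /S.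
move: (Lq qj *m tx) (B1 *m t) (B2 *m t) (B1 *m (Lq qj *m t)) (B2 *m (Lq qj *m t)) w v {jw jv E jE}.
move=> k1 k2 k3 k4 k5 w v.
apply/matrixP => r cc; rewrite !(addmxE, oppmxE, scalemxE) [RHS]mxE.
move: (k1 r cc) (k2 r cc) (k3 r cc) (k4 r cc) (k5 r cc) (w r cc) (v r cc) (tx r cc) => x1 x2 x3 x4 x5 x6 x7 x8.
have cc2 : c * c = 1 - s * s by rewrite -cs addrK.
by ring: cc2.
Qed.

(** The two identities of [flat_rotated] in the form in which the curvature of the
    extended form presents itself. *)
Lemma rotated_curvature (c s a1 a2 p q r v : K) (B1 B2 Bx By : 'M[K]_4) t tx ty :
  c * c + s * s = 1 ->
  B1 *m Lq qi = Lq qi *m B1 -> B2 *m Lq qi = Lq qi *m B2 ->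
  B1 *m Lq qj = Lq qj *m B1 -> B2 *m Lq qj = Lq qj *m B2 ->
  q = r -> Bx - By + (B1 *m B2 - B2 *m B1) = 0 ->
  Lq qj *m tx - ty + ((a1 *: Lq qi + B1) *m (Lq qj *m t) - (a2 *: Lq qi + B2) *m t) = 0 ->
  let C := c * c - s * s in let S := 2 * c * s in
  let e1 := (C * a1 + - S * a2) *: Lq qi + 1 *: B1 in
  let e2 := (S * a1 + C * a2) *: Lq qi + 1 *: B2 in
  emb_alg ((S * p + C * q) *: Lq qi + 1 *: Bx - ((C * r + - S * v) *: Lq qi + 1 *: By)
      + (e1 *m e2 - e2 *m e1))
    (s *: tx + c *: (Lq qj *m tx) - (c *: ty + - s *: (Lq qj *m ty))
      + (e1 *m (s *: t + c *: (Lq qj *m t)) - e2 *m (c *: t + - s *: (Lq qj *m t)))) =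
  emb_alg ((S * (p + v)) *: Lq qi) 0.
Proof.
move=> cs B1i B2i B1j B2j qr HB Ht C S e1 e2.
have Ht' : Lq qj *m tx - ty + (a1 *: Lq qi + B1) *m (Lq qj *m t)
    - (a2 *: Lq qi + B2) *m t = 0 by rewrite -[RHS]Ht addrA.
have [E1 E2] := flat_rotated (p + v) cs B1i B2i B1j B2j qr HB Ht'.
have -> : e1 = (C * a1 - S * a2) *: Lq qi + B1 by rewrite /e1 scale1r mulNr.
have -> : e2 = (S * a1 + C * a2) *: Lq qi + B2 by rewrite /e2 scale1r.
rewrite !scale1r !scaleNr E2 -E1; congr (emb_alg (_ + _) _).
apply/matrixP => i j; rewrite !(addmxE, oppmxE, scalemxE) /C /S.
by move: (Bx i j) (By i j) (Lq qi i j) => *; ring.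
Qed.

(** The combination of components that defines the extended form, for [l] the
    inverse of [lambda] and an unspecified square root of -1: it turns the
    translation by the angle of [lambda] and the degree 2 part by twice that
    angle. *)
Lemma extended_pair (l lambda a1 a2 : K) (B1 B2 : 'M[K]_4) t
    (c := 2^-1 * (l + lambda)) (s := 2^-1 * (iota * (l - lambda)))
    (t' := Lq qj *m t) (X1 := emb_alg (a1 *: Lq qi) 0) (X2 := emb_alg (a2 *: Lq qi) 0)
    (P1 := emb_alg 0 (pminus t)) (P2 := emb_alg 0 (pminus t'))
    (Q1 := emb_alg 0 (pplus t)) (Q2 := emb_alg 0 (pplus t')) :
  l ^+ 2 *: (2^-1 *: (X1 - iota *: X2)) + l *: (2^-1 *: (P1 - iota *: P2))
    + emb_alg B1 0 + lambda *: (2^-1 *: (Q1 + iota *: Q2))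
    + lambda ^+ 2 *: (2^-1 *: (X1 + iota *: X2)) =
  emb_alg (((c * c - s * s) * a1 - (2 * c * s) * a2) *: Lq qi + B1) (c *: t - s *: t') /\
  l ^+ 2 *: (iota *: (2^-1 *: (X1 - iota *: X2))) + l *: (iota *: (2^-1 *: (P1 - iota *: P2)))
    + emb_alg B2 0 + lambda *: (- iota *: (2^-1 *: (Q1 + iota *: Q2)))
    + lambda ^+ 2 *: (- iota *: (2^-1 *: (X1 + iota *: X2))) =
  emb_alg (((2 * c * s) * a1 + (c * c - s * s) * a2) *: Lq qi + B2) (s *: t + c *: t').
Proof.
have EP : P1 - iota *: P2 = emb_alg 0 (t - iota *: t').
  by rewrite /P1 /P2 -scaleNr emb_algZ emb_algD scaler0 addr0 scaleNr pminus_dz.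
have EQ : Q1 + iota *: Q2 = emb_alg 0 (t + iota *: t').
  by rewrite /Q1 /Q2 emb_algZ emb_algD scaler0 addr0 pplus_dzbar.
have EX1 : X1 - iota *: X2 = emb_alg ((a1 - iota * a2) *: Lq qi) 0.
  by rewrite /X1 /X2 -scaleNr emb_algZ emb_algD scaler0 addr0 scalerA -scalerDl mulNr.
have EX2 : X1 + iota *: X2 = emb_alg ((a1 + iota * a2) *: Lq qi) 0.
  by rewrite /X1 /X2 emb_algZ emb_algD scaler0 addr0 scalerA -scalerDl.
rewrite EP EQ EX1 EX2 !emb_algZ !emb_algD !(scaler0, addr0, add0r); split; congr emb_alg.
- apply/matrixP => i j; rewrite !(addmxE, oppmxE, scalemxE) /s /c.
  by move: (Lq qi i j) (B1 i j) => *; field: ii.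
- apply/matrixP => i j; rewrite !(addmxE, oppmxE, scalemxE) /s /c.
  by move: (t i j) (t' i j) => *; field: ii.
- apply/matrixP => i j; rewrite !(addmxE, oppmxE, scalemxE) /s /c.
  by move: (Lq qi i j) (B2 i j) => *; field: ii.
- apply/matrixP => i j; rewrite !(addmxE, oppmxE, scalemxE) /s /c.
  by move: (t i j) (t' i j) => *; field: ii.
Qed.

End CovectorAlgebra.

Section Complexification.
Context {R : realType}.
Local Notation C := R[i].

Lemma cplxD m n (A B : 'M[R]_(m, n)) : cplx (A + B) = cplx A + cplx B.
Proof. exact: map_mxD. Qed.

Lemma cplxB m n (A B : 'M[R]_(m, n)) : cplx (A - B) = cplx A - cplx B.
Proof. exact: map_mxB. Qed.

Lemma cplxM m n p (A : 'M[R]_(m, n)) (B : 'M[R]_(n, p)) :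
  cplx (A *m B) = cplx A *m cplx B.
Proof. exact: map_mxM. Qed.

Lemma cplxZ m n a (A : 'M[R]_(m, n)) : cplx (a *: A) = a%:C *: cplx A.
Proof. exact: map_mxZ. Qed.

Lemma cplx0 m n : cplx (0 : 'M[R]_(m, n)) = 0.
Proof. exact: map_mx0. Qed.

Lemma map_Lq (K L : comNzRingType) (f : {rmorphism K -> L}) (p : 'cV[K]_4) :
  map_mx f (Lq p) = Lq (map_mx f p).
Proof.
have mE (m n : nat) (A : 'M[K]_(m, n)) i j : (map_mx f A) i j = f (A i j) by rewrite mxE.
apply/matrixP => r c; rewrite !(mE, quatE).
by elim/ord4_ind: r; elim/ord4_ind: c; rewrite !ordE /= ?rmorphN.
Qed.

Lemma map_Rq (K L : comNzRingType) (f : {rmorphism K -> L}) (p : 'cV[K]_4) :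
  map_mx f (Rq p) = Rq (map_mx f p).
Proof.
have mE (m n : nat) (A : 'M[K]_(m, n)) i j : (map_mx f A) i j = f (A i j) by rewrite mxE.
apply/matrixP => r c; rewrite !(mE, quatE).
by elim/ord4_ind: r; elim/ord4_ind: c; rewrite !ordE /= ?rmorphN.
Qed.

Lemma cplx_Lqi : cplx (Lq qi : 'M[R]_4) = Lq qi.
Proof. by rewrite /cplx map_Lq map_delta_mx. Qed.

Lemma cplx_Lqj : cplx (Lq qj : 'M[R]_4) = Lq qj.
Proof. by rewrite /cplx map_Lq map_delta_mx. Qed.

Lemma cplx_Rq u : cplx (Rq u : 'M[R]_4) = Rq (cplx u).
Proof. exact: map_Rq. Qed.

Lemma cplx_emb (eta : 'M[R]_4) t : cplx (emb_alg eta t) = emb_alg (cplx eta) (cplx t).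
Proof. by rewrite /cplx /emb_alg map_block_mx !map_mx0. Qed.

Lemma cplx_inj m n : injective (@cplx R m n).
Proof. by apply: map_mx_inj; exact: complexI. Qed.

(** The complex equations expressing the type conditions have real coefficients
    [A] and [B], hence split into two real ones. *)
Lemma re_im_eq0 m n (A B : 'M[R]_(m, n)) (e : C) :
  e = 'i \/ e = - 'i ->
  cplx A + e *: cplx B = 0 -> A = 0 /\ B = 0.
Proof.
move=> He H; have E r c : A r c = 0 /\ B r c = 0.
  have := congr1 (fun M : 'M[C]_(m, n) => M r c) H; rewrite !mxE.
  case: He => ->; move/eqP; rewrite eq_complex /=; simpc; case/andP=> /eqP h1 /eqP h2.
    by split; [exact: h1|exact: h2].
  by split=> //; apply/eqP; rewrite -oppr_eq0; exact/eqP.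
by split; apply/matrixP => r c; rewrite mxE; have [] := E r c.
Qed.

Lemma cplx_bracket n (B1 B2 Bx By : 'M[R]_n) : Bx - By + (B1 *m B2 - B2 *m B1) = 0 ->
  cplx Bx - cplx By + (cplx B1 *m cplx B2 - cplx B2 *m cplx B1) = 0.
Proof. by move=> H; rewrite -!cplxM -!cplxB -cplxD H cplx0. Qed.

Lemma cplx_moving n (a1 a2 : R) (L J B1 B2 : 'M[R]_n) (t tx ty : 'cV[R]_n) :
  L *m tx - ty + ((a1 *: J + B1) *m (L *m t) - (a2 *: J + B2) *m t) = 0 ->
  cplx L *m cplx tx - cplx ty + ((a1%:C *: cplx J + cplx B1) *m (cplx L *m cplx t)
    - (a2%:C *: cplx J + cplx B2) *m cplx t) = 0.
Proof.
by move=> H; rewrite -!cplxZ -!cplxD -!cplxM -!cplxB -cplxD H cplx0.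
Qed.

(** [ga], [gb] and [gt] are the coordinates a, b, t of (a L_i + R_b, t); the
    quaternion b is the value of R_b at the quaternion 1. *)
Definition ga (A : 'M[R]_(4 + 1)) : R := Lcoef (ulsubmx A).
Definition gb (A : 'M[R]_(4 + 1)) : 'cV[R]_4 :=
  (ulsubmx A - ga A *: Lq qi) *m delta_mx i0 0.
Definition gt (A : 'M[R]_(4 + 1)) : 'cV[R]_4 := ursubmx A.

Lemma gE a (b : 'cV[R]_4) t (A := emb_alg (a *: Lq qi + Rq b) t) :
  [/\ ga A = a, gb A = b & gt A = t].
Proof.
have aE : ga A = a by rewrite /ga /A /emb_alg block_mxKul LcoefE.
split=> //; last by rewrite /gt /A /emb_alg block_mxKur.
by rewrite /gb aE /A /emb_alg block_mxKul addrAC subrr add0r Rq_one.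
Qed.

Lemma in_gP A : in_g A ->
  A = emb_alg (ga A *: Lq qi + Rq (gb A)) (gt A) /\ gb A i0 0 = 0.
Proof.
move=> [a [b1 [b2 [b3 [t AE]]]]].
pose b : 'cV[R]_4 := b1 *: qi + b2 *: qj + b3 *: qk.
have {}AE : A = emb_alg (a *: Lq qi + Rq b) t.
  by rewrite AE /b !RqD !RqZ !addrA.
have [ea eb et] := gE a b t; rewrite -AE in ea eb et.
by rewrite ea eb et; split=> //; rewrite /b !quatE /=; ring.
Qed.

Lemma cplx_in_g A : in_g A -> cplx A =
  emb_alg ((ga A)%:C *: Lq qi + Rq (cplx (gb A))) (cplx (gt A)) /\ cplx (gb A) i0 0 = 0.
Proof.
move=> /in_gP[AE b0]; split; last by rewrite mxE b0.
by rewrite {1}AE cplx_emb cplxD cplxZ cplx_Lqi cplx_Rq.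
Qed.

Section Covector.
Variable a : 'M[R]_(4 + 1) * 'M[R]_(4 + 1).
Hypotheses (g1 : in_g a.1) (g2 : in_g a.2).

Lemma cov_comp_m1 : cov_comp (-1) a =
  (emb_alg 0 (pminus 'i (cplx (gt a.1))), emb_alg 0 (pminus 'i (cplx (gt a.2)))).
Proof.
have [E1 b1] := cplx_in_g g1; have [E2 b2] := cplx_in_g g2.
by rewrite /cov_comp /cov_cplx /= E1 E2 !gcompE.
Qed.

Lemma cov_comp_0 : cov_comp 0 a =
  (emb_alg (Rq (cplx (gb a.1))) 0, emb_alg (Rq (cplx (gb a.2))) 0).
Proof.
have [E1 b1] := cplx_in_g g1; have [E2 b2] := cplx_in_g g2.
by rewrite /cov_comp /cov_cplx /= E1 E2 !gcompE.
Qed.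

Lemma cov_comp_1 : cov_comp 1 a =
  (emb_alg 0 (pplus 'i (cplx (gt a.1))), emb_alg 0 (pplus 'i (cplx (gt a.2)))).
Proof.
have [E1 b1] := cplx_in_g g1; have [E2 b2] := cplx_in_g g2.
by rewrite /cov_comp /cov_cplx /= E1 E2 !gcompE.
Qed.

Lemma cov_comp_2 : cov_comp 2 a =
  (emb_alg ((ga a.1)%:C *: Lq qi) 0, emb_alg ((ga a.2)%:C *: Lq qi) 0).
Proof.
have [E1 b1] := cplx_in_g g1; have [E2 b2] := cplx_in_g g2.
by rewrite /cov_comp /cov_cplx /= E1 E2 !gcompE.
Qed.

Lemma on_dzbar_emb (p q : 'cV[C]_4) :
  on_dzbar (emb_alg 0 p, emb_alg 0 q) = emb_alg 0 (2^-1 *: (p + 'i *: q)).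
Proof. by rewrite /on_dzbar /= !emb_algZ emb_algD emb_algZ !(scaler0, addr0). Qed.

Lemma on_dz_emb (p q : 'cV[C]_4) :
  on_dz (emb_alg 0 p, emb_alg 0 q) = emb_alg 0 (2^-1 *: (p - 'i *: q)).
Proof.
by rewrite /on_dz /= emb_algZ -scaleN1r emb_algZ emb_algD emb_algZ !(scaler0, addr0) scaleN1r.
Qed.

Lemma half_eq0 (p : 'cV[C]_4) : 2^-1 *: p = 0 -> p = 0.
Proof.
by move=> /eqP; rewrite scaler_eq0 invr_eq0 pnatr_eq0 /= => /eqP.
Qed.

(** The part of type (0,1) in degree -1 is a multiple of w + i w' for the real
    vectors w = t(d/dx) + L_j t(d/dy) and w' = t(d/dy) - L_j t(d/dx), so that its
    vanishing is a real condition. *)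
Lemma type_cond : part01 (cov_comp (-1) a) = 0 -> gt a.2 = Lq qj *m gt a.1.
Proof.
rewrite cov_comp_m1 /part01 on_dzbar_emb /dzbar => /(congr1 fst) /= /emb_alg_eq0[_].
rewrite (pminus_dzbar ii) -cplx_Lqj -!cplxM -cplxD -cplxB => /half_eq0/half_eq0 H.
by have [|_ /eqP] := re_im_eq0 _ H; [left|rewrite subr_eq0 => /eqP].
Qed.

Section Typed.
Hypothesis tE : gt a.2 = Lq qj *m gt a.1.

Lemma type_cond_conv : part01 (cov_comp (-1) a) = 0 /\ part10 (cov_comp 1 a) = 0.
Proof.
have h : cplx (gt a.1) + Lq qj *m cplx (gt a.2) = 0.
  by rewrite tE cplxM cplx_Lqj Lqj_LqjK subrr.
have h' : cplx (gt a.2) - Lq qj *m cplx (gt a.1) = 0.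
  by rewrite tE cplxM cplx_Lqj subrr.
split.
  rewrite cov_comp_m1 /part01 on_dzbar_emb (pminus_dzbar ii) h h' !(scaler0, addr0).
  by rewrite emb_alg0 /dzbar scaler0.
rewrite cov_comp_1 /part10 on_dz_emb (pplus_dz ii) h h' !(scaler0, subr0).
by rewrite emb_alg0 /dz scaler0.
Qed.

Lemma dz_m1E : part10 (cov_comp (-1) a) =
  dz (emb_alg 0 (2^-1 *: (cplx (gt a.1) - 'i *: cplx (Lq qj *m gt a.1)))).
Proof. by rewrite cov_comp_m1 /part10 on_dz_emb tE cplxM cplx_Lqj (pminus_dz ii). Qed.

Lemma dzbar_1E : part01 (cov_comp 1 a) =
  dzbar (emb_alg 0 (2^-1 *: (cplx (gt a.1) + 'i *: cplx (Lq qj *m gt a.1)))).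
Proof. by rewrite cov_comp_1 /part01 on_dzbar_emb tE cplxM cplx_Lqj (pplus_dzbar ii). Qed.

Lemma immersion_cond : part10 (cov_comp (-1) a) <> 0 -> gt a.1 != 0.
Proof.
move=> H; apply/eqP => t0; apply: H.
by rewrite dz_m1E t0 mulmx0 cplx0 scaler0 subr0 scaler0 emb_alg0 /dz scaler0.
Qed.

(** For a form of the right type both parts are multiples of u - i L_j u and u + i
    L_j u with u = t(d/dx) real. *)
Lemma immersion_cond_conv : gt a.1 != 0 ->
  part10 (cov_comp (-1) a) <> 0 /\ part01 (cov_comp 1 a) <> 0.
Proof.
move=> /eqP t0; split.
  rewrite dz_m1E => /(congr1 fst) /= /emb_alg_eq0[_] /half_eq0.
  by rewrite -scaleNr => H; have [|/t0//] := re_im_eq0 _ H; right.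
rewrite dzbar_1E => /(congr1 fst) /= /emb_alg_eq0[_] /half_eq0 H.
by have [|/t0//] := re_im_eq0 _ H; left.
Qed.

End Typed.
End Covector.

Section Extended.
Variable alpha : R * R -> 'M[R]_(4 + 1) * 'M[R]_(4 + 1).
Variables (lambda : C) (z : R * R).
Hypotheses (g1 : in_g (alpha z).1) (g2 : in_g (alpha z).2).
Hypothesis tE : gt (alpha z).2 = Lq qj *m gt (alpha z).1.

(** For lambda = e^(i theta) the functions [lcos], [lsin], [lcos2] and [lsin2] are
    the cosines and sines of theta and 2 theta; they make sense for every nonzero
    lambda. *)
Definition lcos : C := 2^-1 * (lambda^-1 + lambda).
Definition lsin : C := 2^-1 * ('i * (lambda^-1 - lambda)).
Definition lcos2 : C := lcos * lcos - lsin * lsin.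
Definition lsin2 : C := 2 * lcos * lsin.

Lemma extended_formE : extended_form alpha lambda z =
  (emb_alg ((lcos2 * (ga (alpha z).1)%:C - lsin2 * (ga (alpha z).2)%:C) *: Lq qi
      + Rq (cplx (gb (alpha z).1)))
    (lcos *: cplx (gt (alpha z).1) - lsin *: (Lq qj *m cplx (gt (alpha z).1))),
   emb_alg ((lsin2 * (ga (alpha z).1)%:C + lcos2 * (ga (alpha z).2)%:C) *: Lq qi
      + Rq (cplx (gb (alpha z).2)))
    (lsin *: cplx (gt (alpha z).1) + lcos *: (Lq qj *m cplx (gt (alpha z).1)))).
Proof.
have [E1 E2] := extended_pair ii lambda^-1 lambda (ga (alpha z).1)%:C (ga (alpha z).2)%:C
  (Rq (cplx (gb (alpha z).1))) (Rq (cplx (gb (alpha z).2))) (cplx (gt (alpha z).1)).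
rewrite /extended_form cov_comp_m1// cov_comp_0// cov_comp_1// cov_comp_2//.
rewrite tE cplxM cplx_Lqj -exprVn.
exact: (f_equal2 pair E1 E2).
Qed.

Lemma lcos_lsin : lambda != 0 -> lcos * lcos + lsin * lsin = 1.
Proof.
move=> l0; have H := @ii R; rewrite /lcos /lsin.
by move: l0 H; move: ('i : C) => iota l0 H; field: H.
Qed.

End Extended.
End Complexification.

(** * Rotations, angles and frames *)

Section Frames.
Context {R : realType}.

(** The powers of a square root [J] of -1 have period 4, so that the exponential
    series splits into the series of the cosine and of the sine. *)
Lemma expmx_rotation n (J : 'M[R]_n.+1) t : J *m J = - 1%:M ->
  expmx (t *: J) = cos t *: 1%:M + sin t *: J.
Proof.
move=> JJ; have JX k : J ^+ k = (~~ odd k)%:R * (-1) ^+ k./2 *: 1%:M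
    + (odd k)%:R * (-1) ^+ k.-1./2 *: J.
  elim/ltn_ind: k => -[|[|k]] IH.
  - by rewrite expr0 mul1r mul0r scale0r addr0 scale1r.
  - by rewrite expr1 mul0r mul1r scale0r add0r scale1r.
  - have -> : J ^+ k.+2 = - J ^+ k.
      by rewrite 2!exprS mulrA (_ : J * J = -1)// mulN1r.
    rewrite IH//; case: k {IH} => [|k]; apply/matrixP => r c.
      by rewrite !mxE /= !expr0 expr1; ring.
    by rewrite !mxE /= !negbK; case: (odd k) => /=; rewrite !exprS; ring.
apply/matrixP => i j; rewrite [LHS]mxE addmxE !scalemxE.
have -> : (fun k => ((t *: J) ^+ k) i j / k`!%:R) =
    (fun k => cos_coeff t k * (1%:M : 'M[R]_n.+1) i j + sin_coeff t k * J i j).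
  apply/funext => k; rewrite exprZn JX !mxE /cos_coeff /sin_coeff /=.
  by rewrite -exprnP; move: (k`!%:R^-1) => x; ring.
have -> : series (fun k => cos_coeff t k * (1%:M : 'M[R]_n.+1) i j + sin_coeff t k * J i j) =
    (fun k => series (cos_coeff t) k * (1%:M : 'M[R]_n.+1) i j + series (sin_coeff t) k * J i j).
  by apply/funext => k; rewrite /series /= big_split /= !mulr_suml.
apply/cvg_lim => //; rewrite cos.unlock sin.unlock.
apply: cvgD; (apply: cvgM; last exact: cvg_cst).
  exact: is_cvg_series_cos_coeff.
exact: is_cvg_series_sin_coeff.
Qed.

Lemma trmx_comb n (a b : R) (M : 'M[R]_n) : (a *: 1%:M + b *: M)^T = a *: 1%:M + b *: M^T.
Proof.
by apply/matrixP => i j; rewrite !(trmxE, addmxE, scalemxE, scalar4E) eq_sym.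
Qed.

Definition rot (t : R) : 'M[R]_4 := cos t *: 1%:M + sin t *: Lq qi.

Lemma expmx_Lqi t : expmx (t *: Lq qi) = rot t.
Proof. by rewrite expmx_rotation// Lqi_sqr. Qed.

Lemma rot0 : rot 0 = 1%:M.
Proof. by rewrite /rot cos0 sin0 scale1r scale0r addr0. Qed.

Lemma rot_Lqi t : rot t *m Lq qi = Lq qi *m rot t.
Proof. by rewrite /rot mulmxDl mulmxDr -!scalemxAl -!scalemxAr mul1mx mulmx1. Qed.

Lemma rot_mul s t : rot s *m rot t = rot (s + t).
Proof.
rewrite /rot !mulmxDl !mulmxDr -!scalemxAl -!scalemxAr !mulmx1 !mul1mx Lqi_sqr cosD sinD.
by apply/matrixP => i j; rewrite !(addmxE, oppmxE, scalemxE); ring.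
Qed.

Lemma rot_trmx t : (rot t)^T = rot (- t).
Proof. by rewrite /rot trmx_comb tr_Lqi cosN sinN scaleNr scalerN. Qed.

Lemma rotV t : (rot t)^T *m rot t = 1%:M.
Proof. by rewrite rot_trmx rot_mul addNr rot0. Qed.

Lemma G0P (M : 'M[R]_4) : G0 M <-> exists2 u, qnorm u = 1 & M = Rq u.
Proof.
split=> [[q1 [q2 [q3 [q4 [qn ->]]]]]|[u un ->]].
  exists (q1 *: delta_mx i0 0 - q2 *: qi - q3 *: qj - q4 *: qk).
    by rewrite qnormE !quatE -[RHS]qn /=; ring.
  rewrite [RHS]Rq_basis !quatE /= !(mulr1, mulr0, subr0, sub0r, addr0, add0r, oppr0).
  by rewrite !scaleNr.
exists (u i0 0), (- u i1 0), (- u i2 0), (- u i3 0); split.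
  by rewrite !sqrrN -qnormE.
by rewrite {1}Rq_basis !scaleNr !opprK.
Qed.

(** The two factors are the right multiplication by a unit quaternion and a
    rotation, both orthogonal. *)
Lemma Gvec_unit (M : 'M[R]_4) : Gvec M -> M^T *m M = 1%:M.
Proof.
move=> [A [B [/G0P[u un ->] [p1 [p2 [pn BE]]] ->]]].
have {}BE : B = p1 *: 1%:M + p2 *: Lq qi := BE.
rewrite trmx_mul mulmxA -[_ *m (Rq u)^T *m _]mulmxA Rq_trmx_mul un mulmx1 BE.
rewrite trmx_comb tr_Lqi.
rewrite mulmxDl !mulmxDr -!scalemxAl -!scalemxAr !mulmx1 !mul1mx mulNmx Lqi_sqr opprK.
apply/matrixP => i j; rewrite !(addmxE, oppmxE, scalemxE).
by rewrite -[RHS]mul1r -pn; ring.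
Qed.

Variable (Omega : set (R * R)).
Hypothesis Oo : open Omega.

Lemma is_derive_scalel m n (f : R * R -> R) (M : 'M[R]_(m, n)) z v df :
  is_derive z v f df -> is_derive z v (fun w => f w *: M) (df *: M).
Proof.
apply: (@is_derive_lin _ _ _ (fun x : R => x *: M)).
  by move=> a x y; rewrite scalerDl -scalerA.
by move=> x; apply: cvgZr_tmp; exact: cvg_id.
Qed.

Lemma is_derive_rot (th : R * R -> R) z v a : v = dirx \/ v = diry ->
  is_derive z v th a -> is_derive z v (fun w => rot (th w)) (a *: (Lq qi *m rot (th z))).
Proof.
move=> Hv dth.
have dc := is_derive_chain (is_derive_cos (th z)) dth Hv.
have ds := is_derive_chain (is_derive_sin (th z)) dth Hv.
have H := is_deriveD (is_derive_scalel 1%:M dc) (is_derive_scalel (Lq qi) ds).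
apply: is_derive_eq H _.
rewrite /rot mulmxDr -!scalemxAr mulmx1 Lqi_sqr.
by apply/matrixP => i j; rewrite !(addmxE, oppmxE, scalemxE); ring.
Qed.

Hypothesis cO : connected Omega.
Variable z0 : R * R.
Hypothesis Oz0 : Omega z0.

(** A function with vanishing derivatives solves the total differential system
    with zero coefficients, as constants do. *)
Lemma derive0_const m n (f : R * R -> 'M[R]_(m, n)) :
  (forall z, Omega z -> is_derive z dirx f 0 /\ is_derive z diry f 0) ->
  forall z, Omega z -> f z = f z0.
Proof.
move=> df; pose A (_ : R * R) : 'M[R]_n := 0.
have sA : smooth Omega A by exact: smooth_cst.
have flA : flat_pair Omega A A.
  by move=> z _; rewrite /A !derive_cst mulmx0 !subrr addr0.
apply: (total_sol_unique Oo sA sA flA cO Oz0 _ _ (erefl (f z0))) => z Oz.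
  by split; rewrite /A mulmx0; have [] := df z Oz.
by split; rewrite /A mulmx0; exact: is_derive_cst.
Qed.

(** Since [J] is invertible with inverse [- J], the claim is that conjugation by
    [J] fixes the solution; both sides solve the same system with the same initial
    value. *)
Lemma sol_commute n (B1 B2 M : R * R -> 'M[R]_n) (J : 'M[R]_n) :
  smooth Omega B1 -> smooth Omega B2 -> flat_pair Omega B1 B2 ->
  (forall z, Omega z -> total_sol B1 B2 M z) -> M z0 = 1%:M ->
  J *m J = - 1%:M ->
  (forall z, Omega z -> B1 z *m J = J *m B1 z /\ B2 z *m J = J *m B2 z) ->
  forall z, Omega z -> M z *m J = J *m M z.
Proof.
move=> s1 s2 fl sM M0 JJ BJ z Oz.
have linJ : linear (fun N : 'M[R]_n => - (J *m N *m J)).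
  by move=> a N P; rewrite mulmxDr mulmxDl -scalemxAr -scalemxAl opprD scalerN.
have E : M z = - (J *m M z *m J).
  apply: (total_sol_unique (Q := fun w => - (J *m M w *m J)) Oo s1 s2 fl cO Oz0 sM _ _ Oz) => [w Ow|].
    have [dx dy] := sM w Ow; have [J1 J2] := BJ w Ow.
    split.
      apply: is_derive_eq (is_derive_lin linJ (linear_mx_continuous linJ) dx) _.
      by rewrite mulNmx -!mulmxA J1.
    apply: is_derive_eq (is_derive_lin linJ (linear_mx_continuous linJ) dy) _.
    by rewrite mulNmx -!mulmxA J2.
  by rewrite M0 mulmx1 JJ opprK.
by rewrite {1}E mulNmx -!mulmxA JJ !mulmxN mulmx1 opprK.
Qed.

(** The derivative of the product is M (B + B^T) M^T = 0. *)
Lemma sol_orthogonal n (B1 B2 M : R * R -> 'M[R]_n) :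
  (forall z, Omega z -> total_sol B1 B2 M z) -> M z0 = 1%:M ->
  (forall z, Omega z -> (B1 z)^T = - B1 z /\ (B2 z)^T = - B2 z) ->
  forall z, Omega z -> M z *m (M z)^T = 1%:M.
Proof.
move=> sM M0 BT z Oz.
have linT : linear (fun N : 'M[R]_n => N^T) by move=> a N P; rewrite linearP.
have dT w v d : is_derive w v M d -> is_derive w v (fun w => (M w)^T) d^T.
  by move=> dM; exact: (is_derive_lin linT (linear_mx_continuous linT) dM).
rewrite -[RHS](_ : M z0 *m (M z0)^T = 1%:M); last by rewrite M0 trmx1 mulmx1.
apply: (derive0_const (f := fun w => M w *m (M w)^T)) => // w Ow.
have [dx dy] := sM w Ow; have [T1 T2] := BT w Ow; split.
  apply: is_derive_eq (is_derive_mulmx dx (dT _ _ _ dx)) _.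
  by rewrite trmx_mul T1 mulmxA mulmxN mulNmx subrr.
apply: is_derive_eq (is_derive_mulmx dy (dT _ _ _ dy)) _.
by rewrite trmx_mul T2 mulmxA mulmxN mulNmx subrr.
Qed.

End Frames.

Section Angle.
Context {R : realType}.
Variable (Omega : set (R * R)) (z0 : R * R).
Hypotheses (Oo : open Omega) (sc : simply_connected Omega) (Oz0 : Omega z0).

(** A closed real form is integrated as the flat form with values in the strictly
    upper triangular matrices. *)
Lemma primitive (a1 a2 : R * R -> R) : smooth Omega a1 -> smooth Omega a2 ->
  (forall z, Omega z -> 'D_dirx a2 z = 'D_diry a1 z) ->
  exists th : R * R -> R, [/\ smooth Omega th, th z0 = 0 &
    forall z, Omega z -> is_derive z dirx th (a1 z) /\ is_derive z diry th (a2 z)].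
Proof.
move=> s1 s2 fl; pose N : 'M[R]_2 := delta_mx 0 1.
have sA1 : smooth Omega (fun z => a1 z *: N) by exact: smooth_scalel.
have sA2 : smooth Omega (fun z => a2 z *: N) by exact: smooth_scalel.
have flA : flat_pair Omega (fun z => a1 z *: N) (fun z => a2 z *: N).
  move=> z Oz.
  have [a1x [a1y [d1 _ _]]] := smooth_elim s1; have [a2x [a2y [d2 _ _]]] := smooth_elim s2.
  have [_ d1y] := d1 z Oz; have [d2x _] := d2 z Oz.
  have [_ ->] := is_derive_scalel N d2x; have [_ ->] := is_derive_scalel N d1y.
  move: (fl z Oz); have [_ ->] := d2x; have [_ ->] := d1y => ->.
  by rewrite -!scalemxAl -!scalemxAr !scalerA [a2 z * _]mulrC !subrr addr0.
have [y sy yz0] := frobenius Oo sA1 sA2 flA (delta_mx 0 0 : 'rV[R]_2) sc Oz0.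
have N0 : N *m (delta_mx 0 0 : 'cV[R]_2) = 0.
  by rewrite /N mul_delta_mx_0.
(* The solution is the row (1, th); its first entry is constant because [N] has
   square 0. *)
have y0 z : Omega z -> y z 0 0 = 1.
  have lin0 : linear (fun M : 'rV[R]_2 => M *m (delta_mx 0 0 : 'cV[R]_2)).
    by move=> k M P; rewrite mulmxDl -scalemxAl.
  move=> Oz; have E : y z *m (delta_mx 0 0 : 'cV[R]_2) = y z0 *m (delta_mx 0 0 : 'cV[R]_2).
    apply: (derive0_const Oo sc.1 Oz0 (f := fun z => y z *m (delta_mx 0 0 : 'cV[R]_2))) => // w Ow.
    have [dx dy] := sy w Ow; have cl := linear_mx_continuous lin0; split.
      apply: is_derive_eq (is_derive_lin lin0 cl dx) _.
      by rewrite -mulmxA -scalemxAl N0 scaler0 mulmx0.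
    apply: is_derive_eq (is_derive_lin lin0 cl dy) _.
    by rewrite -mulmxA -scalemxAl N0 scaler0 mulmx0.
  by have := congr1 (fun M : 'M[R]_1 => M 0 0) E; rewrite yz0 -!colE !mxE.
have dth z : Omega z -> is_derive z dirx (fun z => y z 0 1) (a1 z) /\
    is_derive z diry (fun z => y z 0 1) (a2 z).
  move=> Oz; have [/is_derive_mxP dx /is_derive_mxP dy] := sy z Oz.
  have E (k : R) : (y z *m (k *: N)) 0 1 = k.
    by rewrite -scalemxAr !mxE big_ord_recl big_ord_recl big_ord0 !mxE /= y0// mul1r mulr0 !addr0 mulr1.
  by split; [rewrite -[X in is_derive _ _ _ X](E (a1 z))|rewrite -[X in is_derive _ _ _ X](E (a2 z))].
exists (fun z => y z 0 1); split=> //.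
  apply: (smooth_intro Oo _ dth) => // z Oz.
  have /continuous_mxP cy := smooth_continuous (total_sol_smooth Oo sA1 sA2 flA sy) Oz.
  exact: cy.
by rewrite yz0 mxE.
Qed.

Variables (a1 a2 : R * R -> R) (b1 b2 : R * R -> 'cV[R]_4) (F : R * R -> 'M[R]_4).
Hypotheses (s1 : smooth Omega a1) (s2 : smooth Omega a2).
Hypotheses (sb1 : smooth Omega b1) (sb2 : smooth Omega b2).
Hypothesis (bi : forall z, Omega z -> b1 z i0 0 = 0 /\ b2 z i0 0 = 0).
Hypothesis fla : forall z, Omega z -> 'D_dirx a2 z = 'D_diry a1 z.
Hypothesis flb : flat_pair Omega (fun z => Rq (b1 z)) (fun z => Rq (b2 z)).
Hypothesis solF : forall z, Omega z -> total_sol (fun z => a1 z *: Lq qi + Rq (b1 z))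
  (fun z => a2 z *: Lq qi + Rq (b2 z)) F z.
Hypothesis F0 : F z0 = 1%:M.

(** Turning the frame back by half the angle removes the degree 2 part of its
    logarithmic derivative.  What remains commutes with all left multiplications,
    so by uniqueness the turned frame does too: it is a right multiplication,
    and by a unit quaternion since its logarithmic derivative is antisymmetric. *)
Lemma angle_exists : exists (beta : R * R -> R) (M0 : R * R -> 'M[R]_4),
  [/\ smooth Omega beta, beta z0 = 0,
      forall z, Omega z -> is_derive z dirx beta (2 * a1 z) /\ is_derive z diry beta (2 * a2 z),
      smooth Omega M0 &
      forall z, Omega z -> G0 (M0 z) /\ F z = rot (beta z / 2) *m M0 z].
Proof.
have [th [sth th0 dth]] := primitive s1 s2 fla.
have linR : linear (@Rq R) by move=> k u v; exact: Rq_linear.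
have sB1 : smooth Omega (fun z => Rq (b1 z)) by exact: smooth_mx_lin.
have sB2 : smooth Omega (fun z => Rq (b2 z)) by exact: smooth_mx_lin.
(* [rot] commutes with the solution, so that it may be removed on the right. *)
pose M0 z := F z *m rot (- th z).
have solM z : Omega z -> total_sol (fun z => Rq (b1 z)) (fun z => Rq (b2 z)) M0 z.
  move=> Oz; have [Fx Fy] := solF Oz; have [tx ty] := dth z Oz.
  have alg (a : R) (B : 'M[R]_4) : B *m Lq qi = Lq qi *m B ->
      (F z *m (a *: Lq qi + B)) *m rot (- th z) + F z *m (- a *: (Lq qi *m rot (- th z)))
      = M0 z *m B.
    move=> BL; have Br : B *m rot (- th z) = rot (- th z) *m B.
      by rewrite /rot mulmxDr mulmxDl -!scalemxAr -!scalemxAl mulmx1 mul1mx BL.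
    rewrite /M0; move: (rot (- th z)) (F z) Br => r f Br.
    rewrite mulmxDr mulmxDl -!mulmxA Br -!scalemxAl -!scalemxAr scaleNr.
    by rewrite addrAC subrr add0r.
  have comm u : Rq u *m Lq qi = Lq qi *m Rq u :> 'M[R]_4 by rewrite Lq_Rq_comm.
  split.
    have dr := is_derive_rot (or_introl erefl) (is_deriveN tx).
    apply: is_derive_eq (is_derive_mulmx Fx dr) _; exact: alg.
  have dr := is_derive_rot (or_intror erefl) (is_deriveN ty).
  apply: is_derive_eq (is_derive_mulmx Fy dr) _; exact: alg.
have M00 : M0 z0 = 1%:M by rewrite /M0 F0 th0 oppr0 rot0 mulmx1.
have cL (p : 'cV[R]_4) z : Rq (b1 z) *m Lq p = Lq p *m Rq (b1 z) /\
    Rq (b2 z) *m Lq p = Lq p *m Rq (b2 z) by split; exact: (esym (Lq_Rq_comm _ _)).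
have Mi := sol_commute Oo sc.1 Oz0 sB1 sB2 flb solM M00 (Lqi_sqr R) (fun z _ => cL qi z).
have Mj := sol_commute Oo sc.1 Oz0 sB1 sB2 flb solM M00 (Lqj_sqr R) (fun z _ => cL qj z).
have Mo : forall z, Omega z -> M0 z *m (M0 z)^T = 1%:M.
  apply: (sol_orthogonal Oo sc.1 Oz0 solM M00) => z Oz.
  by have [h1 h2] := bi Oz; rewrite !tr_Rq.
exists (fun z => 2 * th z), M0; split.
- have -> : (fun z => 2 * th z) = (fun z => th z + th z).
    by apply/funext => z; rewrite mulr_natl mulr2n.
  exact: smoothD.
- by rewrite th0 mulr0.
- by move=> z Oz; have [tx ty] := dth z Oz; split; exact: (is_deriveZ 2).
- exact: total_sol_smooth solM.
- move=> z Oz; have E := commute_Rq (Mi z Oz) (Mj z Oz); split.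
    apply/G0P; exists (M0 z *m delta_mx i0 0) => //.
    have := Mo z Oz; rewrite {1 2}E Rq_mul_trmx => /matrixP/(_ i0 i0).
    by rewrite !scalar4E eqxx.
  have -> : 2 * th z / 2 = th z by field.
  have rM : rot (th z) *m M0 z = M0 z *m rot (th z).
    by rewrite /rot mulmxDl mulmxDr -!scalemxAl -!scalemxAr mulmx1 mul1mx Mi.
  by rewrite rM /M0 -mulmxA rot_mul addNr rot0 mulmx1.
Qed.

End Angle.

(** * The Maurer-Cartan form of a frame *)

Section FormParts.
Context {R : realType}.
Local Notation C := R[i].

Lemma ulsubmx_linear : linear (fun A : 'M[R]_(4 + 1) => ulsubmx A).
Proof. by move=> a A B; apply/matrixP => r c; rewrite !mxE. Qed.

Lemma gt_linear : linear (@gt R).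
Proof. by move=> a A B; apply/matrixP => r c; rewrite !mxE. Qed.

Lemma ga_linear : linear (@ga R).
Proof. by move=> a A B; rewrite /ga ulsubmx_linear Lcoef_linear. Qed.

Lemma gb_linear : linear (@gb R).
Proof.
move=> a A B; rewrite /gb ga_linear ulsubmx_linear scalemxAl -mulmxDl; congr (_ *m _).
by move: (ga A) (ga B) => x y; rewrite scalerBr scalerDl opprD addrACA scalerA.
Qed.

(** Up to the real part of [gb], membership in the symmetry algebra is the linear
    equation [A = gproj A], which passes to derivatives. *)
Definition gproj (A : 'M[R]_(4 + 1)) := emb_alg (ga A *: Lq qi + Rq (gb A)) (gt A).

Lemma gproj_linear : linear gproj.
Proof.
move=> a A B; rewrite /gproj emb_alg_linear ga_linear gb_linear gt_linear Rq_linear.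
congr emb_alg; move: (ga A) (ga B) => x y.
by rewrite [a *: (_ + _)]scalerDr scalerDl !scalerA addrACA.
Qed.

Lemma emb_algB (K : comNzRingType) (e1 e2 : 'M[K]_4) t1 t2 :
  emb_alg e1 t1 - emb_alg e2 t2 = emb_alg (e1 - e2) (t1 - t2).
Proof. by rewrite /emb_alg opp_block_mx add_block_mx !subr0. Qed.

Lemma emb_alg_mul (K : comNzRingType) (e1 e2 : 'M[K]_4) t1 t2 :
  emb_alg e1 t1 *m emb_alg e2 t2 = emb_alg (e1 *m e2) (e1 *m t2).
Proof. by rewrite /emb_alg mulmx_block !mul0mx !mulmx0 !addr0. Qed.

Lemma emb_grp_alg_mul (K : comNzRingType) (e1 e2 : 'M[K]_4) t1 t2 :
  emb_grp e1 t1 *m emb_alg e2 t2 = emb_alg (e1 *m e2) (e1 *m t2).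
Proof. by rewrite /emb_alg /emb_grp mulmx_block !mul0mx !mulmx0 !addr0. Qed.

Lemma Rq_mul (p q : 'cV[R]_4) : Rq p *m Rq q = Rq (Rq p *m q).
Proof.
have Ci : (Rq p *m Rq q) *m Lq qi = Lq qi *m (Rq p *m Rq q).
  by rewrite -mulmxA -Lq_Rq_comm mulmxA -Lq_Rq_comm mulmxA.
have Cj : (Rq p *m Rq q) *m Lq qj = Lq qj *m (Rq p *m Rq q).
  by rewrite -mulmxA -Lq_Rq_comm mulmxA -Lq_Rq_comm mulmxA.
by rewrite (commute_Rq Ci Cj) -mulmxA Rq_one.
Qed.

Lemma RqN (u : 'cV[R]_4) : Rq (- u) = - Rq u.
Proof. by rewrite -scaleN1r RqZ scaleN1r. Qed.

(** The isotropy algebra is the direct sum of the multiples of [Lq qi], which are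
    central, and of right multiplications, which are closed under products; so the
    degree 2 part has no quadratic term. *)
Lemma flat_components (a1 a2 ay ax : R) (b1 b2 by_ bx t1 t2 ty tx : 'cV[R]_4) :
  emb_alg (ax *: Lq qi + Rq bx) tx - emb_alg (ay *: Lq qi + Rq by_) ty +
    (emb_alg (a1 *: Lq qi + Rq b1) t1 *m emb_alg (a2 *: Lq qi + Rq b2) t2
     - emb_alg (a2 *: Lq qi + Rq b2) t2 *m emb_alg (a1 *: Lq qi + Rq b1) t1) = 0 ->
  [/\ ax = ay, Rq bx - Rq by_ + (Rq b1 *m Rq b2 - Rq b2 *m Rq b1) = 0 &
      tx - ty + ((a1 *: Lq qi + Rq b1) *m t2 - (a2 *: Lq qi + Rq b2) *m t1) = 0].
Proof.
rewrite !emb_alg_mul !emb_algB emb_algD => /emb_alg_eq0[Heta Ht].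
have c1 : Rq b1 *m Lq qi = Lq qi *m Rq b1 by rewrite Lq_Rq_comm.
have c2 : Rq b2 *m Lq qi = Lq qi *m Rq b2 by rewrite Lq_Rq_comm.
have {}Heta : (ax - ay) *: Lq qi + (Rq bx - Rq by_
    + (Rq b1 *m Rq b2 - Rq b2 *m Rq b1)) = 0.
  rewrite -[RHS]Heta; move: (Rq b1) (Rq b2) (Rq bx) (Rq by_) (Lq qi) c1 c2 => B1 B2 Bx By L c1 c2.
  rewrite !mulmxDl !mulmxDr -!scalemxAl -!scalemxAr c1 c2.
  move: (B1 *m B2) (B2 *m B1) (L *m B1) (L *m B2) (L *m L) => k1 k2 k3 k4 k5.
  apply/matrixP => i j; rewrite !(addmxE, oppmxE, scalemxE).
  by move: (k1 i j) (k2 i j) (k3 i j) (k4 i j) (k5 i j) (Bx i j) (By i j) (L i j) => *; ring.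
have E : ax = ay.
  have := congr1 (@Lcoef R) Heta; rewrite Lcoef_linear Lcoef_qi Lcoef0 mulr1.
  rewrite !Rq_mul -!RqN -!RqD Lcoef_Rq addr0 => /eqP.
  by rewrite subr_eq0 => /eqP.
by split=> //; move: Heta; rewrite E subrr scale0r add0r.
Qed.

Lemma flat_gproj (A1 A2 Ay Ax : 'M[R]_(4 + 1)) :
  gproj Ax - gproj Ay + (gproj A1 *m gproj A2 - gproj A2 *m gproj A1) = 0 ->
  [/\ ga Ax = ga Ay,
      Rq (gb Ax) - Rq (gb Ay) + (Rq (gb A1) *m Rq (gb A2) - Rq (gb A2) *m Rq (gb A1)) = 0 &
      gt Ax - gt Ay + ((ga A1 *: Lq qi + Rq (gb A1)) *m gt A2
        - (ga A2 *: Lq qi + Rq (gb A2)) *m gt A1) = 0].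
Proof. exact: flat_components. Qed.

Variables (Omega : set (R * R)).
Hypothesis Oo : open Omega.

Lemma gproj_derive (A : R * R -> 'M[R]_(4 + 1)) dA z v :
  (forall w, Omega w -> A w = gproj (A w)) -> Omega z ->
  is_derive z v A dA -> dA = gproj dA.
Proof.
move=> AE Oz dAz.
have d2 := is_derive_lin gproj_linear (linear_mx_continuous gproj_linear) dAz.
have nE : \forall w \near z, gproj (A w) = A w.
  by apply: (near_open Oo) => // w Ow; rewrite -AE.
have [_ <-] := near_eq_is_derive nE d2.
by have [_ <-] := dAz.
Qed.

Lemma gt_derive_rel (A1 A2 : R * R -> 'M[R]_(4 + 1)) d1 d2 z v :
  (forall w, Omega w -> gt (A2 w) = Lq qj *m gt (A1 w)) -> Omega z ->
  is_derive z v A1 d1 -> is_derive z v A2 d2 -> gt d2 = Lq qj *m gt d1.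
Proof.
move=> tE Oz D1 D2.
have lin : linear (fun A : 'M[R]_(4 + 1) => Lq qj *m gt A).
  by move=> a A B; rewrite gt_linear mulmxDr scalemxAr.
have e1 := is_derive_lin lin (linear_mx_continuous lin) D1.
have e2 := is_derive_lin gt_linear (linear_mx_continuous gt_linear) D2.
have nE : \forall w \near z, Lq qj *m gt (A1 w) = gt (A2 w).
  by apply: (near_open Oo) => // w Ow; rewrite tE.
by have [_ <-] := near_eq_is_derive nE e1; have [_ <-] := e2.
Qed.

(** Through real and imaginary parts, as in the definition of the exterior
    derivative of complex forms. *)
Definition is_deriveC n (z v : R * R) (f : R * R -> 'M[C]_n) (df : 'M[C]_n) : Prop :=
  is_derive z v (fun w => map_mx (@complex.Re R) (f w)) (map_mx (@complex.Re R) df) /\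
  is_derive z v (fun w => map_mx (@complex.Im R) (f w)) (map_mx (@complex.Im R) df).

Lemma re_cplx n k (f : 'M[R]_n) :
  map_mx (@complex.Re R) (k *: cplx f) = complex.Re k *: f.
Proof.
by apply/matrixP => i j; rewrite !mxE; case: k => a b /=; rewrite mulr0 subr0.
Qed.

Lemma im_cplx n k (f : 'M[R]_n) :
  map_mx (@complex.Im R) (k *: cplx f) = complex.Im k *: f.
Proof.
by apply/matrixP => i j; rewrite !mxE; case: k => a b /=; rewrite mulr0 add0r.
Qed.

Lemma is_deriveC_cplx n (k : C) (f : R * R -> 'M[R]_n) df z v :
  is_derive z v f df -> is_deriveC z v (fun w => k *: cplx (f w)) (k *: cplx df).
Proof.
move=> d; split.
  have -> : (fun w => map_mx (@complex.Re R) (k *: cplx (f w))) = (fun w => complex.Re k *: f w).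
    by apply/funext => w; rewrite re_cplx.
  by rewrite re_cplx; exact: is_deriveZ.
have -> : (fun w => map_mx (@complex.Im R) (k *: cplx (f w))) = (fun w => complex.Im k *: f w).
  by apply/funext => w; rewrite im_cplx.
by rewrite im_cplx; exact: is_deriveZ.
Qed.

Lemma re_add n (f g : 'M[C]_n) : map_mx (@complex.Re R) (f + g) =
  map_mx (@complex.Re R) f + map_mx (@complex.Re R) g.
Proof. by apply/matrixP => i j; rewrite !mxE; case: (f i j) (g i j) => ? ? []. Qed.

Lemma im_add n (f g : 'M[C]_n) : map_mx (@complex.Im R) (f + g) =
  map_mx (@complex.Im R) f + map_mx (@complex.Im R) g.
Proof. by apply/matrixP => i j; rewrite !mxE; case: (f i j) (g i j) => ? ? []. Qed.

Lemma is_deriveC_add n (f g : R * R -> 'M[C]_n) df dg z v :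
  is_deriveC z v f df -> is_deriveC z v g dg ->
  is_deriveC z v (fun w => f w + g w) (df + dg).
Proof.
move=> [rf jf] [rg jg]; split.
  have -> : (fun w => map_mx (@complex.Re R) (f w + g w)) =
      (fun w => map_mx (@complex.Re R) (f w) + map_mx (@complex.Re R) (g w)).
    by apply/funext => w; rewrite re_add.
  by rewrite re_add; exact: is_deriveD.
have -> : (fun w => map_mx (@complex.Im R) (f w + g w)) =
    (fun w => map_mx (@complex.Im R) (f w) + map_mx (@complex.Im R) (g w)).
  by apply/funext => w; rewrite im_add.
by rewrite im_add; exact: is_deriveD.
Qed.

Lemma is_deriveC_near n (f g : R * R -> 'M[C]_n) df z v :
  (\forall w \near z, f w = g w) -> is_deriveC z v f df -> is_deriveC z v g df.
Proof.
move=> fg [rf jf]; split.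
  by apply: near_eq_is_derive rf; apply: filterS fg => w ->.
by apply: near_eq_is_derive jf; apply: filterS fg => w ->.
Qed.

Lemma ext_dCE n (a : R * R -> 'M[C]_n * 'M[C]_n) z dx dy :
  is_deriveC z dirx (fun w => (a w).2) dx -> is_deriveC z diry (fun w => (a w).1) dy ->
  ext_dC a z = dx - dy.
Proof.
move=> [rx ix] [ry iy]; rewrite /ext_dC /ext_d /=.
have [_ ->] := rx; have [_ ->] := ix; have [_ ->] := ry; have [_ ->] := iy.
apply/matrixP => i j; rewrite !mxE.
case: (dx i j) (dy i j) => p q [r s] /=; apply/eqP; rewrite eq_complex /=.
by rewrite !(mul0r, mulr0, mul1r, subr0, addr0, add0r) !eqxx.
Qed.

End FormParts.

(** * The frame equation and the curvature of the extended form *)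

Section FrameEquation.
Context {R : realType}.
Local Notation C := R[i].

Lemma eps_sum (K : numFieldType) (iota : K) (d0 d2 : 'cV[K]_4) : iota * iota = -1 ->
  2^-1 *: (d0 - iota *: d2) + 2^-1 *: (d0 + iota *: d2) = d0 /\
  iota *: (2^-1 *: (d0 - iota *: d2)) + - iota *: (2^-1 *: (d0 + iota *: d2)) = d2.
Proof.
move=> ii; split; apply/matrixP => r c; rewrite !(addmxE, oppmxE, scalemxE).
  by move: (d0 r c) (d2 r c) => *; field.
by move: (d0 r c) (d2 r c) => *; field: ii.
Qed.

(** The sum of [eps] and [epsbar] is the quaternion 1 and i (eps - epsbar) is the
    quaternion j, so that the complex equation is real. *)
Lemma frame_equation (K : 'M[R]_4) (e : R) (t1 t2 : 'cV[R]_4) :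
  cov_cplx (t1, t2) = e%:C *: (dz (cplx K *m eps) + dzbar (cplx K *m epsbar)) <->
  t1 = e *: (K *m delta_mx i0 0) /\ t2 = e *: (K *m delta_mx i2 0).
Proof.
have [e1 e2] : (eps : 'cV[C]_4) + epsbar = delta_mx i0 0 /\
    'i *: (eps : 'cV[C]_4) + - 'i *: epsbar = delta_mx i2 0 := eps_sum _ _ (@ii R).
have dE i : delta_mx i 0 = cplx (delta_mx i 0) :> 'cV[C]_4.
  by rewrite /cplx map_delta_mx.
have E1 : e%:C *: (cplx K *m eps + cplx K *m epsbar) = cplx (e *: (K *m delta_mx i0 0)).
  by rewrite -mulmxDr e1 dE -cplxM; exact: (esym (cplxZ e (K *m delta_mx i0 0))).
have E2 : e%:C *: ('i *: (cplx K *m eps) + - 'i *: (cplx K *m epsbar)) =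
    cplx (e *: (K *m delta_mx i2 0)).
  have E2' : 'i *: (cplx K *m eps) + - 'i *: (cplx K *m epsbar) = cplx (K *m delta_mx i2 0).
    by rewrite !scalemxAr -mulmxDr e2 dE -cplxM.
  by rewrite E2'; exact: (esym (cplxZ e (K *m delta_mx i2 0))).
split=> [H|[-> ->]].
  by split; apply: (@cplx_inj R); [rewrite -E1; exact: (congr1 fst H)|
    rewrite -E2; exact: (congr1 snd H)].
by rewrite /cov_cplx /= -E1 -E2.
Qed.

Lemma emb_grp_unit (F : 'M[R]_4) X : F^T *m F = 1%:M -> emb_grp F X \in unitmx.
Proof.
move=> FF; rewrite unitmxE /emb_grp det_ublock det1 mulr1 -unitmxE.
by have [] := mulmx1_unit FF.
Qed.

Lemma invmx_orthogonal (F : 'M[R]_4) (t : 'cV[R]_4) : F^T *m F = 1%:M ->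
  invmx F *m (F *m t) = t.
Proof. by move=> FF; have [_ Fu] := mulmx1_unit FF; rewrite mulKmx. Qed.

End FrameEquation.

Section Curvature.
Context {R : realType}.
Variables (Omega : set (R * R)).
Hypothesis Oo : open Omega.
Variable alpha : R * R -> 'M[R]_(4 + 1) * 'M[R]_(4 + 1).
Hypothesis alpha_smooth : smooth Omega alpha.
Hypothesis alpha_g : forall z, Omega z -> in_g (alpha z).1 /\ in_g (alpha z).2.
Local Notation alpha1 := (fun z => (alpha z).1).
Local Notation alpha2 := (fun z => (alpha z).2).
Local Notation C := R[i].

Lemma alpha_gproj z : Omega z -> [/\ (alpha z).1 = gproj (alpha z).1,
  (alpha z).2 = gproj (alpha z).2, gb (alpha z).1 i0 0 = 0 & gb (alpha z).2 i0 0 = 0].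
Proof.
by move=> Oz; have [/in_gP[? ?] /in_gP[? ?]] := alpha_g Oz.
Qed.

Lemma alpha_derivatives : exists a1x a1y a2x a2y : R * R -> 'M[R]_(4 + 1),
  [/\ smooth Omega alpha1, smooth Omega alpha2,
    forall z, Omega z -> is_derive z dirx alpha1 (a1x z) /\ is_derive z diry alpha1 (a1y z),
    forall z, Omega z -> is_derive z dirx alpha2 (a2x z) /\ is_derive z diry alpha2 (a2y z) &
    forall z, Omega z -> [/\ a1x z = gproj (a1x z), a1y z = gproj (a1y z),
      a2x z = gproj (a2x z) & a2y z = gproj (a2y z)]].
Proof.
have s1 : smooth Omega alpha1 by exact: smooth_fst.
have s2 : smooth Omega alpha2 by exact: smooth_snd.
have [a1x [a1y [d1 _ _]]] := smooth_elim s1; have [a2x [a2y [d2 _ _]]] := smooth_elim s2.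
exists a1x, a1y, a2x, a2y; split=> // z Oz.
have [d1x d1y] := d1 z Oz; have [d2x d2y] := d2 z Oz.
have g1 w : Omega w -> (alpha w).1 = gproj (alpha w).1 by move=> /alpha_gproj[].
have g2 w : Omega w -> (alpha w).2 = gproj (alpha w).2 by move=> /alpha_gproj[].
split; [exact: gproj_derive g1 Oz d1x|exact: gproj_derive g1 Oz d1y|
  exact: gproj_derive g2 Oz d2x|exact: gproj_derive g2 Oz d2y].
Qed.

Lemma flat_alpha_components z a1y a2x : flat Omega alpha -> Omega z ->
  is_derive z diry alpha1 a1y -> is_derive z dirx alpha2 a2x ->
  a1y = gproj a1y -> a2x = gproj a2x ->
  [/\ ga a2x = ga a1y,
      Rq (gb a2x) - Rq (gb a1y) + (Rq (gb (alpha z).1) *m Rq (gb (alpha z).2)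
        - Rq (gb (alpha z).2) *m Rq (gb (alpha z).1)) = 0 &
      gt a2x - gt a1y + ((ga (alpha z).1 *: Lq qi + Rq (gb (alpha z).1)) *m gt (alpha z).2
        - (ga (alpha z).2 *: Lq qi + Rq (gb (alpha z).2)) *m gt (alpha z).1) = 0].
Proof.
move=> fl Oz [_ d1] [_ d2] E1 E2; apply: flat_gproj.
have [<- <- _ _] := alpha_gproj Oz; rewrite -E1 -E2.
by have := fl z Oz; rewrite /ext_d /wedge d1 d2.
Qed.

(** In degrees -1, 0 and 1 the curvature vanishes with that of the form itself. In
    degree 2 the form is turned by an angle, which mixes its exterior derivative,
    equal to 0, with its divergence. *)
Lemma extended_curvature z a1x a2y lambda : flat Omega alpha ->
  (forall w, Omega w -> gt (alpha w).2 = Lq qj *m gt (alpha w).1) -> Omega z ->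
  is_derive z dirx alpha1 a1x -> is_derive z diry alpha2 a2y -> lambda != 0 ->
  ext_dC (extended_form alpha lambda) z +
    wedge (extended_form alpha lambda z) (extended_form alpha lambda z) =
  emb_alg ((lsin2 lambda * (ga a1x + ga a2y)%:C) *: Lq qi) 0.
Proof.
move=> fl tE Oz D1x D2y l0.
have [a1x' [a1y [a2x [a2y' [s1 s2 d1 d2 dg]]]]] := alpha_derivatives.
have [_ D1y] := d1 z Oz; have [D2x _] := d2 z Oz; have [_ P1y P2x _] := dg z Oz.
have [fa fb ft] := flat_alpha_components fl Oz D1y D2x P1y P2x.
have t2x := gt_derive_rel Oo tE Oz D1x D2x.
pose fa_ (A : 'M[R]_(4 + 1)) := emb_alg (ga A *: Lq qi) 0.
pose fb_ (A : 'M[R]_(4 + 1)) := emb_alg (Rq (gb A)) 0.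
pose ft_ (A : 'M[R]_(4 + 1)) := emb_alg 0 (gt A).
pose fj_ (A : 'M[R]_(4 + 1)) := emb_alg 0 (Lq qj *m gt A).
have la : linear fa_.
  move=> a A B; rewrite /fa_ emb_alg_linear ga_linear scaler0 addr0.
  by move: (ga A) (ga B) => x y; rewrite scalerDl !scalerA.
have lb : linear fb_.
  by move=> a A B; rewrite /fb_ emb_alg_linear gb_linear Rq_linear scaler0 addr0.
have lt_ : linear ft_.
  by move=> a A B; rewrite /ft_ emb_alg_linear gt_linear scaler0 addr0.
have lj : linear fj_.
  by move=> a A B; rewrite /fj_ emb_alg_linear gt_linear mulmxDr scalemxAr scaler0 addr0.
have dl (f : 'M[R]_(4 + 1) -> 'M[R]_(4 + 1)) (A : R * R -> 'M[R]_(4 + 1)) dA v (k : C) :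
    linear f -> is_derive z v A dA -> is_deriveC z v (fun w => k *: cplx (f (A w))) (k *: cplx (f dA)).
  by move=> lf dA_; apply: is_deriveC_cplx; exact: (is_derive_lin lf (linear_mx_continuous lf) dA_).
pose c := lcos lambda; pose s := lsin lambda.
pose C2 := lcos2 lambda; pose S2 := lsin2 lambda.
have sumE (k1 k2 k3 k4 k5 : C) (A1 A2 A3 A4 : 'M[R]_(4 + 1)) :
    k1 *: cplx (fa_ A1) + k2 *: cplx (fa_ A2) + k3 *: cplx (fb_ A3) + k4 *: cplx (ft_ A4)
      + k5 *: cplx (fj_ A4) =
    emb_alg ((k1 * (ga A1)%:C + k2 * (ga A2)%:C) *: Lq qi + k3 *: Rq (cplx (gb A3)))
      (k4 *: cplx (gt A4) + k5 *: (Lq qj *m cplx (gt A4))).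
  rewrite /fa_ /fb_ /ft_ /fj_ !cplx_emb !cplx0 cplxM cplx_Lqj !cplxZ cplx_Lqi cplx_Rq.
  by rewrite !emb_algZ !emb_algD !scaler0 !addr0 !add0r !scalerA -scalerDl.
have form w : Omega w -> extended_form alpha lambda w =
   (C2 *: cplx (fa_ (alpha w).1) + (- S2) *: cplx (fa_ (alpha w).2) + 1 *: cplx (fb_ (alpha w).1)
      + c *: cplx (ft_ (alpha w).1) + (- s) *: cplx (fj_ (alpha w).1),
    S2 *: cplx (fa_ (alpha w).1) + C2 *: cplx (fa_ (alpha w).2) + 1 *: cplx (fb_ (alpha w).2)
      + s *: cplx (ft_ (alpha w).1) + c *: cplx (fj_ (alpha w).1)).
  move=> Ow; have [g1 g2] := alpha_g Ow; rewrite extended_formE//; last exact: tE.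
  by rewrite !sumE !mulNr !scaleNr !scale1r.
have D2 : is_deriveC z dirx (fun w => (extended_form alpha lambda w).2)
   (S2 *: cplx (fa_ a1x) + C2 *: cplx (fa_ (a2x z)) + 1 *: cplx (fb_ (a2x z))
      + s *: cplx (ft_ a1x) + c *: cplx (fj_ a1x)).
  apply: is_deriveC_near; last first.
    apply: is_deriveC_add; last exact: dl lj D1x.
    apply: is_deriveC_add; last exact: dl lt_ D1x.
    apply: is_deriveC_add; last exact: dl lb D2x.
    by apply: is_deriveC_add; [exact: dl la D1x|exact: dl la D2x].
  by apply: (near_open Oo) => // w Ow; rewrite form.
have D1 : is_deriveC z diry (fun w => (extended_form alpha lambda w).1)
   (C2 *: cplx (fa_ (a1y z)) + (- S2) *: cplx (fa_ a2y) + 1 *: cplx (fb_ (a1y z))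
      + c *: cplx (ft_ (a1y z)) + (- s) *: cplx (fj_ (a1y z))).
  apply: is_deriveC_near; last first.
    apply: is_deriveC_add; last exact: dl lj D1y.
    apply: is_deriveC_add; last exact: dl lt_ D1y.
    apply: is_deriveC_add; last exact: dl lb D1y.
    by apply: is_deriveC_add; [exact: dl la D1y|exact: dl la D2y].
  by apply: (near_open Oo) => // w Ow; rewrite form.
rewrite (ext_dCE D2 D1) (form z Oz) !sumE.
rewrite /wedge /= !emb_alg_mul !emb_algB !emb_algD.
have -> : (ga a1x + ga a2y)%:C = (ga a1x)%:C + (ga a2y)%:C by exact: rmorphD.
have Rc (u : 'cV[C]_4) p : Rq u *m Lq p = Lq p *m Rq u by rewrite Lq_Rq_comm.
apply: rotated_curvature; try exact: Rc.
- exact: lcos_lsin.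
- by rewrite fa.
- by rewrite -!cplx_Rq; exact: cplx_bracket fb.
- rewrite -!cplx_Rq -cplx_Lqj -cplx_Lqi; apply: cplx_moving.
  by rewrite -t2x -tE.
Qed.

End Curvature.
(** * Frames with a given Maurer-Cartan form *)

Section FrameForm.
Context {R : realType}.
Variables (Omega : set (R * R)).
Hypothesis Oo : open Omega.

Lemma smooth_emb_grp (F : R * R -> 'M[R]_4) (X : R * R -> 'cV[R]_4) :
  smooth Omega F -> smooth Omega X -> smooth Omega (fun z => emb_grp (F z) (X z)).
Proof.
move=> sF sX.
have -> : (fun z => emb_grp (F z) (X z)) =
    (fun z => emb_alg (F z) 0 + emb_alg 0 (X z) + emb_grp 0 0).
  apply/funext => z; rewrite /emb_grp /emb_alg !add_block_mx.
  by rewrite !(addr0, add0r).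
apply: smoothD => //; last exact: smooth_cst.
apply: smoothD => //.
  apply: (smooth_mx_lin Oo (phi := fun M : 'M[R]_4 => emb_alg M 0)) => // a M N.
  by rewrite emb_alg_linear scaler0 addr0.
apply: (smooth_mx_lin Oo (phi := fun t : 'cV[R]_4 => emb_alg 0 t)) => // a M N.
by rewrite emb_alg_linear scaler0 addr0.
Qed.

Lemma log_derivative n (P A1 A2 : R * R -> 'M[R]_n) z dx dy : P z \in unitmx ->
  is_derive z dirx P dx -> is_derive z diry P dy ->
  A1 z = invmx (P z) *m 'D_dirx P z -> A2 z = invmx (P z) *m 'D_diry P z ->
  total_sol A1 A2 P z.
Proof.
move=> uP [Dx Ex] [Dy Ey] E1 E2.
by split; [rewrite E1 Ex mulKVmx|rewrite E2 Ey mulKVmx].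
Qed.

(** The logarithmic derivative of an invertible solution is flat, by the symmetry
    of the second derivatives of the solution. *)
Lemma total_sol_flat n (A1 A2 P : R * R -> 'M[R]_n) :
  smooth Omega A1 -> smooth Omega A2 -> smooth Omega P ->
  (forall z, Omega z -> P z \in unitmx) ->
  (forall z, Omega z -> total_sol A1 A2 P z) -> flat_pair Omega A1 A2.
Proof.
move=> s1 s2 sP uP solP z Oz.
have [Px [Py [Pxy [dP dPxy _ _ _]]]] := smooth_mixed Oo sP.
have [a1x [a1y [d1 _ _]]] := smooth_elim s1; have [a2x [a2y [d2 _ _]]] := smooth_elim s2.
have [_ D1] := d1 z Oz; have [D2 _] := d2 z Oz.
have [SX SY] := solP z Oz; have [Dxy Dyx] := dPxy z Oz.
have PxE w : Omega w -> Px w = P w *m A1 w.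
  move=> Ow; have [[_ <-] _] := dP w Ow; by have [[_ <-] _] := solP w Ow.
have PyE w : Omega w -> Py w = P w *m A2 w.
  move=> Ow; have [_ [_ <-]] := dP w Ow; by have [_ [_ <-]] := solP w Ow.
have E1 : Pxy z = P z *m A2 z *m A1 z + P z *m a1y z.
  have [_ <-] := near_eq_is_derive (near_open Oo PxE Oz) Dxy.
  by have [_ <-] := is_derive_mulmx SY D1.
have E2 : Pxy z = P z *m A1 z *m A2 z + P z *m a2x z.
  have [_ <-] := near_eq_is_derive (near_open Oo PyE Oz) Dyx.
  by have [_ <-] := is_derive_mulmx SX D2.
have [_ ->] := D1; have [_ ->] := D2.
apply: (can_inj (mulKmx (uP z Oz))); rewrite mulmx0 !mulmxDr !mulmxN !mulmxA.
apply/eqP; rewrite addrACA [- _ - _]addrC [P z *m a2x z + _]addrC.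
by rewrite -E2 -opprD -E1 subrr.
Qed.

Variable A : R * R -> 'M[R]_(4 + 1) * 'M[R]_(4 + 1).
Local Notation A1 := (fun z => (A z).1).
Local Notation A2 := (fun z => (A z).2).
Local Notation eta1 := (fun z => ga (A z).1 *: Lq qi + Rq (gb (A z).1)).
Local Notation eta2 := (fun z => ga (A z).2 *: Lq qi + Rq (gb (A z).2)).

Lemma frame_components (F : R * R -> 'M[R]_4) (X : R * R -> 'cV[R]_4) z :
  (A z).1 = gproj (A z).1 -> (A z).2 = gproj (A z).2 ->
  total_sol A1 A2 (fun w => emb_grp (F w) (X w)) z ->
  total_sol eta1 eta2 F z /\
  is_derive z dirx X (F z *m gt (A z).1) /\ is_derive z diry X (F z *m gt (A z).2).
Proof.
move=> E1 E2 [dx dy].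
have FE : (fun w => ulsubmx (emb_grp (F w) (X w))) = F.
  by apply/funext => w; rewrite /emb_grp block_mxKul.
have XE : (fun w => ursubmx (emb_grp (F w) (X w))) = X.
  by apply/funext => w; rewrite /emb_grp block_mxKur.
have lu := @ulsubmx_linear R.
have lr : linear (fun M : 'M[R]_(4 + 1) => ursubmx M : 'cV[R]_4) by exact: gt_linear.
have cu := linear_mx_continuous lu; have cr := linear_mx_continuous lr.
have M B : B = gproj B -> ulsubmx (emb_grp (F z) (X z) *m B) = F z *m (ga B *: Lq qi + Rq (gb B)) /\
    ursubmx (emb_grp (F z) (X z) *m B) = F z *m gt B.
  move=> BE; rewrite {1 4}BE /gproj emb_grp_alg_mul /emb_alg.
  by rewrite block_mxKul block_mxKur.
have [M1 N1] := M _ E1; have [M2 N2] := M _ E2.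
have ux := is_derive_lin lu cu dx; have uy := is_derive_lin lu cu dy.
have rx := is_derive_lin lr cr dx; have ry := is_derive_lin lr cr dy.
rewrite FE M1 in ux; rewrite FE M2 in uy; rewrite XE N1 in rx; rewrite XE N2 in ry.
by split; [split|split].
Qed.

Lemma MC_total_sol U : smooth Omega U ->
  (forall z, Omega z -> (U z).1^T *m (U z).1 = 1%:M) -> is_MC_form_of Omega A U ->
  smooth Omega (fun w => emb_grp (U w).1 (U w).2) /\
  forall z, Omega z -> total_sol A1 A2 (fun w => emb_grp (U w).1 (U w).2) z.
Proof.
move=> sU oU AE.
have sG : smooth Omega (fun w => emb_grp (U w).1 (U w).2).
  by apply: smooth_emb_grp; [exact: smooth_fst|exact: smooth_snd].
split=> // z Oz; have [gx [gy [dG _ _]]] := smooth_elim sG; have [dx dy] := dG z Oz.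
apply: log_derivative (emb_grp_unit (U z).2 (oU z Oz)) dx dy _ _.
  exact: (congr1 fst (AE z Oz)).
exact: (congr1 snd (AE z Oz)).
Qed.

End FrameForm.
Section FrameOfForm.
Context {R : realType}.
Variables (Omega : set (R * R)) (z0 : R * R).
Hypotheses (Oo : open Omega) (sc : simply_connected Omega) (Oz0 : Omega z0).
Variable alpha : R * R -> 'M[R]_(4 + 1) * 'M[R]_(4 + 1).
Hypothesis alpha_smooth : smooth Omega alpha.
Hypothesis alpha_g : forall z, Omega z -> in_g (alpha z).1 /\ in_g (alpha z).2.
Local Notation alpha1 := (fun z => (alpha z).1).
Local Notation alpha2 := (fun z => (alpha z).2).
Local Notation a1 := (fun z => ga (alpha z).1).
Local Notation a2 := (fun z => ga (alpha z).2).
Local Notation b1 := (fun z => gb (alpha z).1).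
Local Notation b2 := (fun z => gb (alpha z).2).
Local Notation t1 := (fun z => gt (alpha z).1).
Local Notation t2 := (fun z => gt (alpha z).2).
Local Notation eta1 := (fun z => a1 z *: Lq qi + Rq (b1 z)).
Local Notation eta2 := (fun z => a2 z *: Lq qi + Rq (b2 z)).

Lemma smooth_alpha1 : smooth Omega alpha1. Proof. exact: smooth_fst. Qed.
Lemma smooth_alpha2 : smooth Omega alpha2. Proof. exact: smooth_snd. Qed.
Let s1 := smooth_alpha1.
Let s2 := smooth_alpha2.

Lemma smooth_a1 : smooth Omega a1.
Proof. exact: (smooth_mx_lin Oo (@ga_linear R) s1). Qed.
Lemma smooth_a2 : smooth Omega a2.
Proof. exact: (smooth_mx_lin Oo (@ga_linear R) s2). Qed.
Lemma smooth_b1 : smooth Omega b1.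
Proof. exact: (smooth_mx_lin Oo (@gb_linear R) s1). Qed.
Lemma smooth_b2 : smooth Omega b2.
Proof. exact: (smooth_mx_lin Oo (@gb_linear R) s2). Qed.
Lemma smooth_t1 : smooth Omega t1.
Proof. exact: (smooth_mx_lin Oo (@gt_linear R) s1). Qed.

Lemma flat_pair_alpha : flat Omega alpha <-> flat_pair Omega alpha1 alpha2.
Proof. by []. Qed.

Lemma LCLI_orthogonal U z : LCLI Omega z0 U -> Omega z -> (U z).1^T *m (U z).1 = 1%:M.
Proof. by move=> [_ gU _ _] Oz; apply: Gvec_unit; exact: gU. Qed.

Lemma LCLI_solution U : LCLI Omega z0 U -> is_MC_form_of Omega alpha U ->
  flat Omega alpha /\ forall z, Omega z ->
    total_sol eta1 eta2 (fun w => (U w).1) z /\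
    is_derive z dirx (fun w => (U w).2) ((U z).1 *m t1 z) /\
    is_derive z diry (fun w => (U w).2) ((U z).1 *m t2 z).
Proof.
move=> lU mc; have [sU _ _ _] := lU; have oU z := @LCLI_orthogonal U z lU.
have [sG solG] := MC_total_sol Oo sU oU mc; split.
  apply/flat_pair_alpha; apply: (total_sol_flat Oo s1 s2 sG _ solG) => z Oz.
  exact: emb_grp_unit (oU z Oz).
move=> z Oz; have [E1 E2 _ _] := alpha_gproj alpha_g Oz.
exact: frame_components (solG z Oz).
Qed.

Lemma qnorm_neq0 (u : 'cV[R]_4) : qnorm u = 1 -> u != 0.
Proof.
move=> un; apply/eqP => u0; move/eqP: un.
by rewrite u0 /qnorm mulmx0 mxE eq_sym oner_eq0.
Qed.

(** The equation of an immersion gives F^-1 dX = (e^f u, e^f L_j u) when K is the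
    right multiplication by the unit quaternion u. *)
Lemma LCLI_translation U z : LCLI Omega z0 U -> is_MC_form_of Omega alpha U -> Omega z ->
  t2 z = Lq qj *m t1 z /\ t1 z != 0.
Proof.
move=> lU mc Oz; have oU := LCLI_orthogonal lU Oz.
have [_ /(_ z Oz) [_ [[_ dx] [_ dy]]]] := LCLI_solution lU mc.
have [_ _ _ [K [f [_ gK _ eqn]]]] := lU.
have := eqn z Oz; rewrite /FinvdX dx dy !(invmx_orthogonal _ oU).
move=> /frame_equation; have /G0P[u un ->] := gK z Oz.
rewrite Rq_one Rq_qj => -[-> ->]; split; first by rewrite scalemxAr.
by rewrite scaler_eq0 negb_or qnorm_neq0// andbT gt_eqF ?expR_gt0.
Qed.

(** Any rotation part of a primitive splits off its angle, whether it comes from a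
    given immersion or from the integration of a form. *)
Lemma alpha_angle (F : R * R -> 'M[R]_4) : flat Omega alpha ->
  (forall z, Omega z -> total_sol eta1 eta2 F z) -> F z0 = 1%:M ->
  exists (beta : R * R -> R) (M0 : R * R -> 'M[R]_4),
  [/\ smooth Omega beta, beta z0 = 0,
      forall z, Omega z -> is_derive z dirx beta (2 * a1 z) /\ is_derive z diry beta (2 * a2 z),
      smooth Omega M0 &
      forall z, Omega z -> G0 (M0 z) /\ F z = rot (beta z / 2) *m M0 z].
Proof.
move=> fl solF F0.
have [a1x [a1y [a2x [a2y [_ _ d1 d2 dg]]]]] := alpha_derivatives Oo alpha_smooth alpha_g.
apply: (angle_exists Oo sc Oz0 smooth_a1 smooth_a2 smooth_b1 smooth_b2 _ _ _ solF F0).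
- by move=> z Oz; have [] := alpha_gproj alpha_g Oz.
- move=> z Oz; have [_ D1] := d1 z Oz; have [D2 _] := d2 z Oz; have [_ P1 P2 _] := dg z Oz.
  have [fa _ _] := flat_alpha_components alpha_g fl Oz D1 D2 P1 P2.
  have [_ ->] := is_derive_lin (@ga_linear R) (linear_mx_continuous (@ga_linear R)) D1.
  by have [_ ->] := is_derive_lin (@ga_linear R) (linear_mx_continuous (@ga_linear R)) D2.
- move=> z Oz; have [_ D1] := d1 z Oz; have [D2 _] := d2 z Oz; have [_ P1 P2 _] := dg z Oz.
  have [_ fb _] := flat_alpha_components alpha_g fl Oz D1 D2 P1 P2.
  have lin : linear (fun A : 'M[R]_(4 + 1) => Rq (gb A)).
    by move=> a A B; rewrite gb_linear Rq_linear.
  have [_ ->] := is_derive_lin lin (linear_mx_continuous lin) D1.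
  have [_ ->] := is_derive_lin lin (linear_mx_continuous lin) D2.
  exact: fb.
Qed.

End FrameOfForm.
(** * Existence of the immersion and harmonicity of its angle *)

Section Immersions.
Context {R : realType}.
Variables (Omega : set (R * R)) (z0 : R * R).
Hypotheses (Oo : open Omega) (sc : simply_connected Omega) (Oz0 : Omega z0).
Variable alpha : R * R -> 'M[R]_(4 + 1) * 'M[R]_(4 + 1).
Hypothesis alpha_smooth : smooth Omega alpha.
Hypothesis alpha_g : forall z, Omega z -> in_g (alpha z).1 /\ in_g (alpha z).2.
Local Notation alpha1 := (fun z => (alpha z).1).
Local Notation alpha2 := (fun z => (alpha z).2).
Local Notation a1 := (fun z => ga (alpha z).1).
Local Notation a2 := (fun z => ga (alpha z).2).
Local Notation b1 := (fun z => gb (alpha z).1).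
Local Notation b2 := (fun z => gb (alpha z).2).
Local Notation t1 := (fun z => gt (alpha z).1).
Local Notation t2 := (fun z => gt (alpha z).2).
Local Notation eta1 := (fun z => a1 z *: Lq qi + Rq (b1 z)).
Local Notation eta2 := (fun z => a2 z *: Lq qi + Rq (b2 z)).
Local Notation C := R[i].
Let s1 := smooth_alpha1 Oo alpha_smooth.
Let s2 := smooth_alpha2 Oo alpha_smooth.

Lemma rot_Rq_Gvec th M : G0 M -> Gvec (rot th *m M : 'M[R]_4).
Proof.
move=> gM; exists M, (rot th); split=> //.
  by exists (cos th), (sin th); split; first exact: cos2Dsin2.
have /G0P[u _ ->] := gM.
by rewrite /rot mulmxDl mulmxDr -!scalemxAl -!scalemxAr mul1mx mulmx1 Lq_Rq_comm.
Qed.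

(** The bottom row of the form is 0, so that of a primitive is constant by
    uniqueness. *)
Lemma emb_group_solution (P : R * R -> 'M[R]_(4 + 1)) : flat Omega alpha ->
  (forall z, Omega z -> total_sol alpha1 alpha2 P z) -> P z0 = 1%:M ->
  forall z, Omega z -> P z = emb_grp (ulsubmx (P z)) (ursubmx (P z)).
Proof.
move=> fl solP P0.
have bottom z : Omega z -> dsubmx (P z) = row_mx 0 1%:M :> 'M[R]_(1, 4 + 1).
  apply: (total_sol_unique (P := fun w => dsubmx (P w)) (Q := fun=> row_mx 0 1%:M)
    Oo s1 s2 fl sc.1 Oz0) => [w Ow|w Ow|].
  - have lin : linear (fun M : 'M[R]_(4 + 1) => dsubmx M : 'M[R]_(1, 4 + 1)).
      by move=> a A B; apply/matrixP => i j; rewrite !mxE.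
    have [dx dy] := solP w Ow; rewrite /total_sol !mul_dsub_mx.
    by split; exact: (is_derive_lin lin (linear_mx_continuous lin)).
  - have E B : B = gproj B -> (row_mx 0 1%:M : 'M[R]_(1, 4 + 1)) *m B = 0.
      move=> ->; rewrite /gproj /emb_alg mul_row_block !mul0mx !mulmx0 !addr0.
      exact: row_mx0.
    have [E1 E2 _ _] := alpha_gproj alpha_g Ow.
    by rewrite /total_sol (E _ E1) (E _ E2); split; exact: is_derive_cst.
  - by rewrite P0 scalar_mx_block /block_mx col_mxKd.
move=> z Oz; rewrite -[LHS]submxK /emb_grp; congr block_mx.
  by rewrite /dlsubmx bottom// row_mxKl.
by rewrite /drsubmx bottom// row_mxKr.
Qed.

Lemma log_derivative_eq n (P A1 A2 : R * R -> 'M[R]_n) z : P z \in unitmx ->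
  total_sol A1 A2 P z ->
  A1 z = invmx (P z) *m 'D_dirx P z /\ A2 z = invmx (P z) *m 'D_diry P z.
Proof. by move=> uP [[_ ->] [_ ->]]; rewrite !mulKmx. Qed.

Lemma smooth_qnorm (t : R * R -> 'cV[R]_4) : smooth Omega t ->
  smooth Omega (fun z => qnorm (t z)).
Proof.
move=> st; rewrite /qnorm.
apply: (smooth_mx_lin Oo (phi := fun M : 'M[R]_1 => M 0 0)).
  by move=> a A B; rewrite !mxE.
apply: smooth_mulmx => //; apply: (smooth_mx_lin Oo (phi := fun u : 'cV[R]_4 => u^T)) => //.
by move=> a A B; apply/matrixP => i j; rewrite !mxE.
Qed.

Lemma qnorm_gt0 (u : 'cV[R]_4) : u != 0 -> 0 < qnorm u.
Proof.
move=> u0; rewrite lt_neqAle eq_sym qnormE !addr_ge0 ?sqr_ge0// andbT.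
apply: contraNneq u0 => E; apply/eqP.
have [E0 E1 E2 E3] : [/\ u i0 0 ^+ 2 = 0, u i1 0 ^+ 2 = 0, u i2 0 ^+ 2 = 0 & u i3 0 ^+ 2 = 0].
  move: E (sqr_ge0 (u i0 0)) (sqr_ge0 (u i1 0)) (sqr_ge0 (u i2 0)) (sqr_ge0 (u i3 0)).
  by move: (_ ^+ 2) (_ ^+ 2) (_ ^+ 2) (_ ^+ 2) => *; split; lra.
by apply: col4P; rewrite [RHS]mxE; apply/eqP; rewrite -sqrf_eq0; apply/eqP.
Qed.

(** With u = t(d/dx), the frame equation forces e^f = |u| and K = R_(u / |u|),
    hence f = ln (|u|^2) / 2. *)
Lemma LCLI_exists : flat Omega alpha ->
  (forall z, Omega z -> t2 z = Lq qj *m t1 z) -> (forall z, Omega z -> t1 z != 0) ->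
  exists U, LCLI Omega z0 U /\ is_MC_form_of Omega alpha U.
Proof.
move=> fl tE tN; have [P solP P0] := frobenius Oo s1 s2 fl (1%:M : 'M[R]_(4 + 1)) sc Oz0.
pose F z := ulsubmx (P z); pose X z := ursubmx (P z) : 'cV[R]_4.
have PE z : Omega z -> P z = emb_grp (F z) (X z) by exact: emb_group_solution.
have solG z : Omega z -> total_sol alpha1 alpha2 (fun w => emb_grp (F w) (X w)) z.
  by move=> Oz; exact: (total_sol_near (near_open Oo PE Oz)) (solP z Oz).
have solFX z (Oz : Omega z) : total_sol eta1 eta2 F z /\
    is_derive z dirx X (F z *m t1 z) /\ is_derive z diry X (F z *m t2 z).
  have [E1 E2 _ _] := alpha_gproj alpha_g Oz.
  exact: frame_components E1 E2 (solG z Oz).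
have sP := total_sol_smooth Oo s1 s2 fl solP.
have sF : smooth Omega F by exact: (smooth_mx_lin Oo (@ulsubmx_linear R)).
have sX : smooth Omega X by exact: (smooth_mx_lin Oo (@gt_linear R)).
have F0 : F z0 = 1%:M by rewrite /F P0 scalar_mx_block block_mxKul.
have X0 : X z0 = 0 by rewrite /X P0 scalar_mx_block block_mxKur.
have [beta [M0 [_ _ _ _ FM]]] := alpha_angle Oo sc Oz0 alpha_smooth alpha_g fl
  (fun z Oz => (solFX z Oz).1) F0.
have gF z : Omega z -> Gvec (F z).
  by move=> Oz; have [gM ->] := FM z Oz; exact: rot_Rq_Gvec.
have st1 := smooth_t1 Oo alpha_smooth.
have q0 z : Omega z -> 0 < qnorm (t1 z) by move=> Oz; apply: qnorm_gt0; exact: tN.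
(* The logarithm of the norm of t(d/dx), written without a square root. *)
pose f z := 2^-1 * ln (qnorm (t1 z)).
have sf : smooth Omega f.
  by move=> k; apply: CkM => //; [exact: smooth_cst|exact: (smooth_ln Oo q0 (smooth_qnorm st1))].
pose K z := Rq (expR (- f z) *: t1 z).
exists (fun z => (F z, X z)); split.
  split=> //; [exact: smooth_pair|by rewrite F0 X0|].
  exists K, f; split=> //.
  - apply: (smooth_mx_lin Oo (phi := @Rq R)); first by move=> *; exact: Rq_linear.
    apply: smooth_scale => //; apply: smooth_expR => //.
    have -> : (fun z => - f z) = (fun z => -1 * f z) by apply/funext => z; rewrite mulN1r.
    by move=> k; apply: CkM => //; exact: smooth_cst.
  - move=> z Oz; apply/G0P; exists (expR (- f z) *: t1 z) => //.
    rewrite qnormE !scalemxE !exprMn -!mulrDr -qnormE expr2 -expRD.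
    rewrite (_ : - f z - f z = - ln (qnorm (t1 z))); last by rewrite /f; field.
    by rewrite expRN lnK ?posrE ?q0// mulVf// gt_eqF ?q0.
  - move=> z Oz; have [_ [[_ dx] [_ dy]]] := solFX z Oz.
    have oF := Gvec_unit (gF z Oz).
    rewrite /FinvdX /= dx dy !(invmx_orthogonal _ oF).
    apply/frame_equation; rewrite Rq_one Rq_qj -scalemxAr !scalerA -expRD subrr expR0 !scale1r.
    by split=> //; exact: tE.
move=> z Oz; have oF := Gvec_unit (gF z Oz).
have [E1 E2] := log_derivative_eq (emb_grp_unit (X z) oF) (solG z Oz).
by rewrite [LHS]surjective_pairing; exact: (f_equal2 pair E1 E2).
Qed.

(** Substituting F = exp (beta L_i / 2) M0 into F^-1 dF gives (b / 2) L_i + M0^-1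
    dM0, and the last term is a right multiplication because the right
    multiplications by quaternions form an algebra stable under transposition; so
    the coefficient of L_i is b / 2. *)
Lemma angle_derivative (beta : R * R -> R) (M0 F : R * R -> 'M[R]_4) z v a w b m :
  (forall z, Omega z -> G0 (M0 z) /\ F z = rot (beta z / 2) *m M0 z) -> Omega z ->
  v = dirx \/ v = diry -> is_derive z v beta b -> is_derive z v M0 m ->
  is_derive z v F (F z *m (a *: Lq qi + Rq w)) -> b = 2 * a.
Proof.
move=> FM Oz Hv dbeta dM dF; have [/G0P[u un uE] FE] := FM z Oz.
have mE : m = Rq (m *m delta_mx i0 0).
  have lin : linear (fun N : 'M[R]_4 => Rq (N *m delta_mx i0 0)).
    by move=> k N P; rewrite mulmxDl -scalemxAl Rq_linear.
  have nE : \forall w \near z, Rq (M0 w *m delta_mx i0 0) = M0 w.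
    apply: (near_open Oo) Oz => w' /FM[/G0P[u' _ ->] _].
    by rewrite Rq_one.
  have := near_eq_is_derive nE (is_derive_lin lin (linear_mx_continuous lin) dM).
  by case=> _ <-; have [_ ->] := dM.
have dr : is_derive z v (fun w => rot (beta w / 2)) ((b / 2) *: (Lq qi *m rot (beta z / 2))).
  apply: (is_derive_rot (th := fun w => beta w / 2)) => //.
  have -> : (fun w => beta w / 2) = (fun w => 2^-1 *: beta w).
    by apply/funext => w'; rewrite mulrC.
  by rewrite mulrC; exact: is_deriveZ.
have E : F z *m (a *: Lq qi + Rq w) =
    (b / 2) *: (Lq qi *m rot (beta z / 2)) *m M0 z + rot (beta z / 2) *m m.
  have [_ <-] := is_derive_mulmx dr dM.
  have [_ <-] := near_eq_is_derive (near_open Oo (fun w' Ow => (FM w' Ow).2) Oz) dF.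
  by [].
have rK (N : 'M[R]_4) : (rot (beta z / 2))^T *m (rot (beta z / 2) *m N) = N.
  by rewrite mulmxA rotV mul1mx.
have {}E : Rq u *m (a *: Lq qi + Rq w) = (b / 2) *: (Lq qi *m Rq u) + m.
  rewrite -[LHS]rK -[RHS]rK; congr (_ *m _).
  rewrite mulmxA -uE -FE E (mulmxDr (rot (beta z / 2))) -scalemxAr -scalemxAl.
  by rewrite [rot _ *m (Lq qi *m _)]mulmxA rot_Lqi.
move: E => /(congr1 (mulmx (Rq u)^T)).
rewrite mulmxA Rq_trmx_mul un mul1mx mulmxDr -scalemxAr mulmxA tr_Rq_conj.
rewrite -Lq_Rq_comm -mulmxA -tr_Rq_conj Rq_trmx_mul un mulmx1 mE tr_Rq_conj Rq_mul.
move=> /(congr1 (@Lcoef R)); rewrite !LcoefE => ->.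
by field.
Qed.

Lemma laplacian_angle (beta : R * R -> R) z a1x a2y :
  (forall w, Omega w -> is_derive w dirx beta (2 * a1 w) /\ is_derive w diry beta (2 * a2 w)) ->
  Omega z -> is_derive z dirx alpha1 a1x -> is_derive z diry alpha2 a2y ->
  laplacian beta z = 2 * (ga a1x + ga a2y).
Proof.
move=> db Oz D1 D2; rewrite /laplacian mulrDr.
have E1 w : Omega w -> 2 * a1 w = 'D_dirx beta w by move=> /db[[_ ->]].
have E2 w : Omega w -> 2 * a2 w = 'D_diry beta w by move=> /db[_ [_ ->]].
have lin : linear (fun A : 'M[R]_(4 + 1) => 2 * ga A).
  move=> k A B; rewrite ga_linear; move: (ga A) (ga B) => x y.
  by rewrite mulrDr mulrCA.
have cl := linear_mx_continuous lin.
have [_ ->] := near_eq_is_derive (near_open Oo E1 Oz) (is_derive_lin lin cl D1).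
by have [_ ->] := near_eq_is_derive (near_open Oo E2 Oz) (is_derive_lin lin cl D2).
Qed.

(** A value of the parameter for which the curvature of the extended form detects
    the divergence of the degree 2 part. *)
Lemma lsin2_neq0 : lsin2 (2 : C) != 0.
Proof.
rewrite /lsin2 /lcos /lsin.
have i0 : ('i : C) != 0.
  by apply/eqP => i0; have := @ii R; rewrite i0 mul0r => /eqP; rewrite eq_sym oppr_eq0 oner_eq0.
have n2 : (2 : C) != 0 by rewrite pnatr_eq0.
have n3 : (3 : C) != 0 by rewrite pnatr_eq0.
have n5 : (5 : C) != 0 by rewrite pnatr_eq0.
move: i0; move: ('i : C) => iota i0.
have -> : (2^-1 + 2 : C) = 5 / 2 by field.
have -> : (2^-1 - 2 : C) = - (3 / 2) by field.
by rewrite !(mulf_neq0, oppr_eq0, invr_eq0)// ?oppr_eq0 ?mulf_neq0 ?invr_eq0.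
Qed.

(** Both conditions say that the divergence of the degree 2 part of the form
    vanishes: its double is the Laplacian of the angle, and a multiple of it is
    the curvature of the extended form. *)
Lemma LCLI_stationary U : LCLI Omega z0 U -> is_MC_form_of Omega alpha U ->
  (hamiltonian_stationary Omega z0 U <->
   forall lambda : C, lambda <> 0 -> flatC Omega (extended_form alpha lambda)).
Proof.
move=> lU mc; have [fl solU] := LCLI_solution Oo alpha_smooth alpha_g lU mc.
have tE z : Omega z -> t2 z = Lq qj *m t1 z.
  by move=> Oz; have [] := LCLI_translation Oo alpha_smooth alpha_g lU mc Oz.
have [a1x [a1y [a2x [a2y [_ _ d1 d2 _]]]]] := alpha_derivatives Oo alpha_smooth alpha_g.
have curv z lambda : Omega z -> lambda != 0 -> _ :=
  fun Oz => extended_curvature Oo alpha_smooth alpha_g fl tE Oz (d1 z Oz).1 (d2 z Oz).2.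
have [_ _ U0 _] := lU.
split=> [[beta [[sb b0 [M0 [sM gM FM]]] lap]] lambda /eqP l0 z Oz|flC].
  have db w : Omega w -> is_derive w dirx beta (2 * a1 w) /\ is_derive w diry beta (2 * a2 w).
    move=> Ow; have [bx [by_ [dbw _ _]]] := smooth_elim sb; have [mx [my [dM _ _]]] := smooth_elim sM.
    have [Bx By] := dbw w Ow; have [Mx My] := dM w Ow; have [[Fx Fy] _] := solU w Ow.
    have FM' z' : Omega z' -> G0 (M0 z') /\ (U z').1 = rot (beta z' / 2) *m M0 z'.
      by move=> Oz'; rewrite -expmx_Lqi FM//; split=> //; exact: gM.
    by split; [rewrite -(angle_derivative FM' Ow (or_introl erefl) Bx Mx Fx)|
      rewrite -(angle_derivative FM' Ow (or_intror erefl) By My Fy)].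
  have := laplacian_angle db Oz (d1 z Oz).1 (d2 z Oz).2; rewrite lap// => /esym/eqP.
  rewrite mulf_eq0 pnatr_eq0 /= => /eqP E.
  by rewrite curv// E mulr0 scale0r emb_alg0.
have [beta [M0 [sb b0 db sM FM]]] := alpha_angle Oo sc Oz0 alpha_smooth alpha_g fl
  (fun z Oz => (solU z Oz).1) (congr1 fst U0).
exists beta; split.
  split=> //; exists M0; split=> // z Oz; have [gM FE] := FM z Oz => //.
  by rewrite expmx_Lqi.
move=> z Oz; rewrite (laplacian_angle db Oz (d1 z Oz).1 (d2 z Oz).2).
have n2 : (2 : C) != 0 by rewrite pnatr_eq0.
have := flC 2 (elimN eqP n2) z Oz; rewrite curv// => /emb_alg_eq0[+ _].
move=> /(congr1 (@Lcoef C)); rewrite LcoefZ Lcoef0 => /eqP.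
rewrite mulf_eq0 (negPf lsin2_neq0) /= => /eqP E.
by rewrite (complexI E) mulr0.
Qed.

End Immersions.

Theorem theorem2 (R : realType) (Omega : set (R * R)) (z0 : R * R)
  (Omega_open : open Omega) (Omega_sc : simply_connected Omega)
  (Omega_z0 : Omega z0)
  (alpha : R * R -> 'M[R]_(4 + 1) * 'M[R]_(4 + 1))
  (alpha_smooth : smooth Omega alpha)
  (alpha_g : forall z, Omega z -> in_g (alpha z).1 /\ in_g (alpha z).2) :
  ((exists U : R * R -> 'M[R]_4 * 'cV[R]_4,
      LCLI Omega z0 U /\ is_MC_form_of Omega alpha U) <->
   [/\ flat Omega alpha,
       forall z, Omega z -> part01 (cov_comp (-1) (alpha z)) = 0 /\
                            part10 (cov_comp 1 (alpha z)) = 0 &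
       forall z, Omega z -> part10 (cov_comp (-1) (alpha z)) <> 0 /\
                            part01 (cov_comp 1 (alpha z)) <> 0])
  /\
  (forall U : R * R -> 'M[R]_4 * 'cV[R]_4,
     LCLI Omega z0 U -> is_MC_form_of Omega alpha U ->
     (hamiltonian_stationary Omega z0 U <->
      forall lambda : R[i], lambda <> 0 ->
        flatC Omega (extended_form alpha lambda))).
Proof.
split; last by move=> U lU mc; exact: LCLI_stationary.
split=> [[U [lU mc]]|[fl type imm]].
  have [fl _] := LCLI_solution Omega_open alpha_smooth alpha_g lU mc; split=> // z Oz.
    have [tE _] := LCLI_translation Omega_open alpha_smooth alpha_g lU mc Oz.
    by have [g1 g2] := alpha_g z Oz; exact: type_cond_conv.
  have [tE tN] := LCLI_translation Omega_open alpha_smooth alpha_g lU mc Oz.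
  by have [g1 g2] := alpha_g z Oz; exact: immersion_cond_conv.
have tE z : Omega z -> gt (alpha z).2 = Lq qj *m gt (alpha z).1.
  by move=> Oz; have [g1 g2] := alpha_g z Oz; apply: type_cond => //; have [] := type z Oz.
apply: LCLI_exists => // z Oz; have [g1 g2] := alpha_g z Oz.
by have [] := imm z Oz => + _; apply: immersion_cond => //; exact: tE.
Qed.
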